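(* Let $M$ and $N$ be Riemannian manifolds with metrics $g_M$ and $g_N$, let $\gamma$ and $\sigma$ be unit speed geodesics in $M$ and $N$, respectively, and let $X=\gamma'$ and $Y=\sigma'$ be their unit tangent vector fields. Suppose that for every pair of vector fields $Z$ and $W$ orthogonal to $\gamma$ and $\sigma$, respectively, we have an inequality on sectional curvatures at corresponding points: $K_{XZ}\le K_{YW}$. Let $J$ and $L$ be nonzero Jacobi fields orthogonal to $\gamma$ and $\sigma$, respectively, such that $J(0)=0$, $L(0)=0$, and $J'(0)$, $L'(0)$ have the same length. Then $g_M(J,J)/g_N(L,L)$ is nondecreasing for $s>0$; in particular, $J$ is at least as long as $L$.
   Context: $s$ denotes the arclength parameter of both geodesics, and corresponding points are $\gamma(s)$ and $\sigma(s)$ with the same parameter $s$. $K_{XZ}$ denotes the sectional curvature of the plane spanned by $X$ and $Z$ (where $Z$ is nonzero), and similarly $K_{YW}$. A prime denotes covariant derivative (for the Levi-Civita connection $D$) along the geodesic. A Jacobi field along a geodesic $\gamma$ is a vector field $J$ along $\gamma$ which is the variation field of a variation of $\gamma$ through geodesics; it satisfies the Jacobi equation $J''+R_{\gamma' J}\gamma'=0$, where $R_{XY}=D_{[X,Y]}-D_XD_Y+D_YD_X$. The dimensions of $M$ and $N$ are not assumed to be the same.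
   Formalization: Both conclusions are claimed only up to parameters s such that σ has no conjugate point of σ(0) on (0,s]; otherwise false: for M flat and N the unit sphere, the ratio s²/sin²s is undefined at π and decreases just after it. *)

(* Defs.v *)
From HB Require Import structures.
From mathcomp Require Import all_boot all_order all_algebra.
From mathcomp Require Import all_classical all_reals all_analysis.
Import numFieldNormedType.Exports.
Import Order.TTheory GRing.Theory Num.Theory.

Set Implicit Arguments.
Unset Strict Implicit.
Unset Printing Implicit Defensive.

Local Open Scope classical_set_scope.
Local Open Scope ring_scope.

Section smooth_maps.
Context {R : realType} {V W : normedModType R}.

(* [f] is C^k on the open set [U], via iterated directional derivatives. *)
Fixpoint Ck (k : nat) (U : set V) (f : V -> W) : Prop :=
  match k with
  | 0%N => forall x, U x -> {for x, continuous f}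
  | k'.+1 => forall v, (forall x, U x -> derivable f x v) /\
                       Ck k' U (fun x => 'D_v f x)
  end.

Definition smooth_on (U : set V) (f : V -> W) : Prop := forall k, Ck k U f.

Definition smooth_at (f : V -> W) (x : V) : Prop :=
  exists2 U : set V, open U /\ U x & smooth_on U f.

End smooth_maps.

(* [mf_chart i] and [mf_inv i] are total functions, meaningful only on
   [mf_dom i] and on its image; [mf_at p] is a preferred chart around [p]. *)
Record manifold (R : realType) := Manifold {
  mf_space :> topologicalType;
  mf_dim : nat;
  mf_idx : Type;
  mf_dom : mf_idx -> set mf_space;
  mf_chart : mf_idx -> mf_space -> 'rV[R]_mf_dim;
  mf_inv : mf_idx -> 'rV[R]_mf_dim -> mf_space;
  mf_at : mf_space -> mf_idx;
  _ : hausdorff_space mf_space;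
  _ : @second_countable mf_space;
  _ : forall i, open (mf_dom i);
  _ : forall i, open (mf_chart i @` mf_dom i);
  _ : forall i p, mf_dom i p -> mf_inv i (mf_chart i p) = p;
  _ : forall i p, mf_dom i p -> {for p, continuous (mf_chart i)};
  _ : forall i x, (mf_chart i @` mf_dom i) x -> {for x, continuous (mf_inv i)};
  _ : forall p, mf_dom (mf_at p) p;
  _ : forall i j, smooth_on (mf_chart i @` (mf_dom i `&` mf_dom j))
                            (fun x => mf_chart j (mf_inv i x)) }.

Definition transition {R : realType} (M : manifold R) (i j : mf_idx M)
  (x : 'rV[R]_(mf_dim M)) : 'rV[R]_(mf_dim M) := mf_chart j (mf_inv i x).

Definition mxform {R : realType} {n : nat} (A : 'M[R]_n) (u v : 'rV[R]_n) : R :=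
  (u *m A *m v^T) 0 0.

Record riemannian (R : realType) := Riemannian {
  rm_base :> manifold R;
  rm_mx : mf_idx rm_base -> 'rV[R]_(mf_dim rm_base) -> 'M[R]_(mf_dim rm_base);
  _ : forall i, smooth_on (mf_chart i @` mf_dom i) (rm_mx i);
  _ : forall i x u v, (mf_chart i @` mf_dom i) x ->
        mxform (rm_mx i x) u v = mxform (rm_mx i x) v u;
  _ : forall i x u, (mf_chart i @` mf_dom i) x -> u != 0 ->
        0 < mxform (rm_mx i x) u u;
  _ : forall i j p u v, mf_dom i p -> mf_dom j p ->
        let x := mf_chart i p in
        mxform (rm_mx i x) u v =
        mxform (rm_mx j (mf_chart j p)) ('D_u (transition i j) x)
                                        ('D_v (transition i j) x) }.

Section local_coordinates.
Context {R : realType} (M : riemannian R) (i : mf_idx M).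
Local Notation T := 'rV[R]_(mf_dim M).

(* Koszul formula for constant coordinate fields [u], [v]:
   2 g(D_u v, e_l) = u g(v, e_l) + v g(u, e_l) - e_l g(u, v). *)
Definition christoffel (x u v : T) : T :=
  let g a b y := mxform (rm_mx i y) a b in
  (2^-1 *: \row_l ('D_u (g v (delta_mx 0 l)) x + 'D_v (g u (delta_mx 0 l)) x
                   - 'D_(delta_mx 0 l) (g u v) x)) *m invmx (rm_mx i x).

Definition covD_loc (X Z : T -> T) : T -> T :=
  fun x => 'D_(X x) Z x + christoffel x (X x) (Z x).

Definition bracket_loc (X Y : T -> T) : T -> T :=
  fun x => 'D_(X x) Y x - 'D_(Y x) X x.

(* R_{XY} Z = D_{[X,Y]} Z - D_X D_Y Z + D_Y D_X Z; being tensorial, it is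
   evaluated on the constant coordinate fields extending [u], [v], [w]. *)
Definition curvature_loc (x u v w : T) : T :=
  let X := cst u in let Y := cst v in let Z := cst w in
  covD_loc (bracket_loc X Y) Z x - covD_loc X (covD_loc Y Z) x
  + covD_loc Y (covD_loc X Z) x.

End local_coordinates.

(* A tangent vector at [p] is given by its components in the chart [mf_at p];
   a vector field along a curve [c] is thus a function [R -> 'rV], whose value
   at [s] is read in the chart [mf_at (c s)].  Its components in another chart
   are given by [in_chart]. *)
Section riemannian_geometry.
Context {R : realType} (M : riemannian R).
Local Notation T := 'rV[R]_(mf_dim M).
Implicit Types (p : M) (u v w z : T) (c : R -> M) (V : R -> T) (I : set R).

Definition in_chart (i : mf_idx M) p v : T :=
  'D_v (transition (mf_at p) i) (mf_chart (mf_at p) p).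

Definition metric p u v : R :=
  mxform (rm_mx (mf_at p) (mf_chart (mf_at p) p)) u v.

Definition tlength p v : R := Num.sqrt (metric p v v).

Definition curvature p u v w : T :=
  curvature_loc (mf_at p) (mf_chart (mf_at p) p) u v w.

Definition sectional p u z : R :=
  metric p (curvature p u z u) z /
  (metric p u u * metric p z z - metric p u z ^+ 2).

Definition smooth_map_at (E : normedModType R) (f : E -> M) (x : E) : Prop :=
  {for x, continuous f} /\ smooth_at (mf_chart (mf_at (f x)) \o f) x.

Definition velocity c (s : R) : T := derive1 (mf_chart (mf_at (c s)) \o c) s.

Definition covD c V (s : R) : T :=
  let i := mf_at (c s) in
  let x := mf_chart i \o c in
  let y t := in_chart i (c t) (V t) in
  derive1 y s + christoffel i (x s) (derive1 x s) (y s).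

(* The parameter set [I] need not be open: what happens along [I] is required
   on a neighbourhood of each point of [I], i.e. curves, fields and variations
   on [I] are those that extend to an open neighbourhood of [I]. *)

Definition geodesic I c : Prop := forall s, I s ->
  smooth_map_at c s /\ \forall t \near s, covD c (velocity c) t = 0.

Definition unit_speed I c : Prop :=
  forall s, I s -> tlength (c s) (velocity c s) = 1.

Definition smooth_field I c V : Prop := forall s, I s ->
  smooth_at (fun t => in_chart (mf_at (c s)) (c t) (V t)) s.

Definition orthogonal_field I c V : Prop :=
  forall s, I s -> metric (c s) (V s) (velocity c s) = 0.

(* [J] is the variation field of the variation [F] of [c] through the geodesics
   [F (_, t)]. *)
Definition jacobi_field I c (J : R -> T) : Prop :=
  exists F : R * R -> M, forall s, I s ->
  [/\ smooth_map_at F (s, 0),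
      \forall q \near (s, 0 : R),
        covD (fun a => F (a, q.2)) (velocity (fun a => F (a, q.2))) q.1 = 0,
      \forall a \near s, F (a, 0) = c a &
      \forall a \near s, J a = velocity (fun t => F (a, t)) 0].

Definition jacobi_equation I c V : Prop := forall s, I s ->
  covD c (covD c V) s + curvature (c s) (velocity c s) (V s) (velocity c s) = 0.

(* [c b] is conjugate to [c 0] along [c].  The Jacobi fields along a geodesic
   on a compact interval are exactly the smooth solutions of the Jacobi
   equation, which is the form used here. *)
Definition conjugate c (b : R) : Prop :=
  exists V, [/\ smooth_field `[0, b] c V, jacobi_equation `[0, b] c V,
    V 0 = 0, V b = 0 & exists2 s, 0 <= s <= b & V s != 0].

End riemannian_geometry.

(* Main.v *)
(* Along the geodesic sigma a parallel frame turns normal fields into curves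
   in R^n with a constant inner product, and the Jacobi equation into
   v'' = - v S with S self-adjoint.  Let A be the matrix solution with A(0) = 0
   and A'(0) = 1; the absence of conjugate points says that A(s) is invertible
   for s > 0.  Then U = A^-1 A' is self-adjoint and satisfies the Riccati
   equation U' = - U^2 - S, and L' = L U.  Fix t, let w be the parallel field
   along sigma that agrees with L at t, and put rho = <w U, w> / |w|^2.  By
   Cauchy-Schwarz, rho' <= - K(w) - rho^2, so the curvature hypothesis gives
     (<J', J> - rho |J|^2)' >= |J' - rho J|^2 >= 0,
   while <J', J> - rho |J|^2 tends to 0 at 0.  At time t this reads
   <J', J> / |J|^2 >= <L', L> / |L|^2, i.e. (|J|^2 / |L|^2)' >= 0; the quotient
   tends to 1 at 0.  Only parallel transport and the scalar inequality are
   used, so the two dimensions are unrelated. *)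
Require Import Defs.
From HB Require Import structures.
From mathcomp Require Import all_boot all_order all_algebra.
From mathcomp Require Import all_classical all_reals all_analysis.
From mathcomp Require Import ring lra.
Import numFieldNormedType.Exports.
Import Order.TTheory GRing.Theory Num.Theory.

Set Implicit Arguments.
Unset Strict Implicit.
Unset Printing Implicit Defensive.

Local Open Scope classical_set_scope.
Local Open Scope ring_scope.

(** * Directional derivatives *)

(** Since L = v A with v = L'(0), the row w U at t is v A'(t) = L'(t); hence rho at t equals <L', L>
    / |L|^2. The field w may enter the curvature hypothesis because sigma' is parallel as well, so
    that w remains orthogonal to sigma. At 0 the matrix U has a pole, and the limit is taken after
    moving a factor 1/s from U to J: A(s)/s tends to 1, J(s)/s to J'(0) and J(s) to 0.

    Most of the length has another cause. Smoothness is stated by iterated directional derivatives,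
    so total differentiability, the chain rule and the symmetry of second derivatives have to be
    derived from them in finite dimension. Tangent components are read in a chart that changes from
    point to point, so a smooth field may jump as a function; derivatives are taken in a fixed
    chart, and their independence of the chart rests on the uniqueness of the Levi-Civita
    connection. Parallel frames and A come from Picard iteration and are glued along an interval of
    any kind. *)

Section line.
Context {R : realType} {V W : normedModType R}.

Lemma is_derive_line (f : V -> W) (y v : V) (t : R) :
  derivable f (t *: v + y) v ->
  is_derive t 1 (fun s : R => f (s *: v + y)) ('D_v f (t *: v + y)).
Proof.
move=> df.
have E : (fun h : R => h^-1 *: (((fun s : R => f (s *: v + y)) \o shift t)
            (h *: (1 : R)) - f (t *: v + y)))
       = (fun h => h^-1 *: ((f \o shift (t *: v + y)) (h *: v) - f (t *: v + y))).
  apply/funext => h /=; congr (_ *: (f _ - _)).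
  by rewrite /shift /= scalerDl addrA [h *: 1]mulr1.
by split; rewrite /derivable /derive E.
Qed.

End line.

Section mean_value_real.
Context {R : realType} {V : normedModType R}.

(** The bound by [|t|] lets one statement serve both signs of [t]; below, [t] is a coordinate of a
    vector, whose sign is unknown. *)
Lemma mean_value_sym (f : R -> R) (t : R) :
  (forall s, `|s| <= `|t| -> derivable f s 1) ->
  exists2 s, `|s| <= `|t| & f t - f 0 = 'D_1 f s * t.
Proof.
move=> df.
have cts (a b : R) : (forall s, s \in `[a, b] -> `|s| <= `|t|) ->
    {within `[a, b], continuous f}.
  by move=> ab; apply: derivable_within_continuous => s /ab /df.
have [t0|t0|<-] := ltgtP 0 t.
- have ab s : s \in `[0, t] -> `|s| <= `|t|.
    by rewrite in_itv/= => /andP[s0 st]; rewrite !ger0_norm// ltW.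
  have [|c + E] := @MVT R f (fun s => 'D_1 f s) 0 t t0 _ (cts _ _ ab).
    move=> x xI; apply/derivableP/df/ab.
    by move: xI; rewrite !in_itv/= => /andP[/ltW-> /ltW->].
  rewrite in_itv/= => /andP[c0 ct]; exists c.
    by apply: ab; rewrite in_itv/= !ltW.
  by rewrite E subr0.
- have ab s : s \in `[t, 0] -> `|s| <= `|t|.
    rewrite in_itv/= => /andP[s0 st]; rewrite !ler0_norm ?lerN2//.
    exact: ltW.
  have [|c + E] := @MVT R f (fun s => 'D_1 f s) t 0 t0 _ (cts _ _ ab).
    move=> x xI; apply/derivableP/df/ab.
    by move: xI; rewrite !in_itv/= => /andP[/ltW-> /ltW->].
  rewrite in_itv/= => /andP[c0 ct]; exists c.
    by apply: ab; rewrite in_itv/= !ltW.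
  by rewrite -opprB E sub0r mulrN opprK.
- by exists 0; rewrite ?normr0// subrr mulr0.
Qed.

Lemma mean_value_line (f : V -> R) (y v : V) (t : R) :
  (forall s, `|s| <= `|t| -> derivable f (s *: v + y) v) ->
  exists2 s, `|s| <= `|t| & f (t *: v + y) - f y = 'D_v f (s *: v + y) * t.
Proof.
move=> df; have [|s st E] := @mean_value_sym (fun s => f (s *: v + y)) t.
  by move=> s /df ds; have [] := is_derive_line ds.
exists s => //; move: E; rewrite scale0r add0r => ->.
by have [_ ->] := is_derive_line (df _ st).
Qed.

End mean_value_real.

(** The coordinate functionals are required to be continuous, so that they are bounded by the norm
    and pass the smoothness of a map on to its real components. *)
Definition findim {R : realType} (V : normedModType R) :=
  exists (K : finType) (e : K -> V) (p : K -> {linear V -> R}),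
    (forall i, continuous (p i)) /\ forall x, x = \sum_i p i x *: e i.

Section findim_instances.
Context {R : realType}.

Lemma findim_real : findim R.
Proof.
exists 'I_1, (fun=> 1), (fun=> idfun); split=> [_ x //|x].
by rewrite big_ord1/= [_ *: _]mulr1.
Qed.

Lemma findim_plane : findim (R * R)%type.
Proof.
exists bool, (fun b => if b then (1, 0) else (0, 1)).
exists (fun b => if b then (fst : {linear (R * R)%type -> R})
                 else (snd : {linear (R * R)%type -> R})).
split=> [i x|[x y]].
  by case: i; [apply: cvg_fst|apply: cvg_snd].
rewrite big_bool /=; congr pair => /=.
  by rewrite [_ *: _]mulr1 [_ *: _]mulr0 addr0.
by rewrite [_ *: _]mulr0 [_ *: _]mulr1 add0r.
Qed.

Lemma entry_is_linear m n (i : 'I_m) (j : 'I_n) :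
  linear (fun A : 'M[R]_(m, n) => A i j : R).
Proof. by move=> a A B; rewrite !mxE. Qed.

Lemma findim_mx m n : findim 'M[R]_(m, n).
Proof.
exists ('I_m * 'I_n)%type, (fun ij => delta_mx ij.1 ij.2).
pose p ij : {linear 'M[R]_(m, n) -> R} :=
  HB.pack (fun A : 'M[R]_(m, n) => A ij.1 ij.2 : R)
    (GRing.isLinear.Build _ _ _ _ _ (entry_is_linear ij.1 ij.2)).
exists p; split=> [[i j] A|A]; first exact: coord_continuous.
by rewrite [LHS]matrix_sum_delta pair_bigA.
Qed.

End findim_instances.

(** * Total differentiability and symmetry of mixed derivatives *)

Section frechet.
Context {R : realType} {V : normedModType R}.

Lemma differentiable_estimate {W : normedModType R} (f : V -> W)
    (df : {linear V -> W}) (x : V) :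
  continuous df ->
  (forall eps : R, 0 < eps ->
    \forall h \near (0 : V), `|f (h + x) - f x - df h| <= eps * `|h|) ->
  differentiable f x.
Proof.
move=> dfc H.
have dxf : f \o shift x = cst (f x) + df +o_ 0 id.
  apply/eqaddoP => eps e0; near=> h.
  have -> : (f \o shift x - (cst (f x) + df)) h = f (h + x) - f x - df h.
    by rewrite opprD addrA.
  by near: h; exact: H.
apply/diff_locallyP; split; last by rewrite (diff_unique dfc dxf).
by rewrite (diff_unique dfc dxf).
Unshelve. all: by end_near. Qed.

(** The increment from [x] to [h + x] is made one coordinate at a time. Each step is a one-variable
    mean value along [e i], and continuity at [x] makes the derivative met there close to the one at
    [x]. *)
Lemma continuous_derive_differentiable (f : V -> R) (x : V) :
  findim V ->
  (\forall y \near x, forall v, derivable f y v) ->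
  (forall v, {for x, continuous (fun y => 'D_v f y)}) ->
  differentiable f x.
Proof.
move=> [K [e [p [pc pE]]]] df cf.
pose l : V -> R := fun h => \sum_i p i h * 'D_(e i) f x.
have llin : linear l.
  move=> a u v; rewrite /l scaler_sumr -big_split/=; apply: eq_bigr => i _.
  by rewrite linearP mulrDl [a *: p i u]/(a * _) [a *: (_ * _)]mulrA.
pose L : {linear V -> R} := HB.pack l (GRing.isLinear.Build _ _ _ _ l llin).
have Lc : continuous L.
  apply: continuous_big; first exact: add_continuous.
  by move=> i _ y; apply: cvgMl; exact: pc.
have /choice[C CP] : forall i, exists C, 0 < C /\ forall h, `|p i h| <= C * `|h|.
  by move=> i; have [k k0 kP] := linear_lipschitz (pc i); exists k.
apply: (differentiable_estimate Lc) => eps e0.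
(* [C i] bounds the functional [p i]. Errors of [eps / S] in each partial derivative add up to at
   most [eps] times the norm of [h], and a norm of [h] below [d / D] keeps the whole path in the
   ball of radius [d]. The [+ 1] makes both divisors positive. *)
pose S := \sum_i C i + 1; have S0 : 0 < S.
  by rewrite ltr_wpDl// sumr_ge0// => i _; exact/ltW/(CP i).1.
pose D := \sum_i C i * `|e i| + 1; have D0 : 0 < D.
  by rewrite ltr_wpDl// sumr_ge0// => i _; rewrite mulr_ge0//; exact/ltW/(CP i).1.
have : \forall y \near x, (forall v, derivable f y v) /\
    forall i, `|'D_(e i) f y - 'D_(e i) f x| <= eps / S.
  near=> y; split; first by near: y.
  near: y; apply: filter_forall => i.
  have /cvgrPdist_le/(_ (eps / S) (divr_gt0 e0 S0)) := cf (e i).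
  by apply: filterS => y; rewrite distrC.
case/nbhs_ballP => d /= d0 dP.
(* Error and length are bounded together: the length of the partial sum is what keeps the next mean
   value step inside the ball. *)
have main (r : seq K) h : `|h| * (\sum_(i <- r) C i * `|e i|) < d ->
    `|f (\sum_(i <- r) p i h *: e i + x) - f x - \sum_(i <- r) p i h * 'D_(e i) f x|
      <= (\sum_(i <- r) C i) * (eps / S) * `|h|
    /\ `|\sum_(i <- r) p i h *: e i| <= `|h| * (\sum_(i <- r) C i * `|e i|).
  elim: r => [|i r IH].
    by rewrite !big_nil add0r !subrr !normr0 mulr0 mul0r mul0r.
  rewrite !big_cons mulrDr => hd.
  have Ce0 : 0 <= `|h| * (C i * `|e i|).
    by rewrite !mulr_ge0//; exact/ltW/(CP i).1.
  have [|IH1 IH2] := IH; first by apply: le_lt_trans hd; rewrite lerDr.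
  have pie (t : R) : `|t| <= `|p i h| -> `|t *: e i| <= `|h| * (C i * `|e i|).
    move=> tp; rewrite normrZ mulrA ler_wpM2r// (le_trans tp)// mulrC.
    exact: (CP i).2.
  have din (t : R) : `|t| <= `|p i h| ->
      ball x d (t *: e i + (\sum_(i <- r) p i h *: e i + x)).
    move=> tp; rewrite -ball_normE/= addrA opprD addrCA subrr addr0 normrN.
    apply: le_lt_trans hd; apply: le_trans (ler_normD _ _) _.
    by rewrite lerD// pie.
  split; last first.
    by rewrite (le_trans (ler_normD _ _))// lerD// pie.
  have [|t tp E] := @mean_value_line _ _ f (\sum_(i <- r) p i h *: e i + x) (e i) (p i h).
    by move=> t tp; have [] := dP _ (din t tp).
  rewrite -[_ + _ + x]addrA.
  set P := \sum_(i <- r) _ in E *; set Q := \sum_(i <- r) _ * _ in IH1 *.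
  have -> : f (p i h *: e i + (P + x)) - f x - (p i h * 'D_(e i) f x + Q) =
     ('D_(e i) f (t *: e i + (P + x)) - 'D_(e i) f x) * p i h
     + (f (P + x) - f x - Q).
    by rewrite mulrBl -E; ring.
  apply: (le_trans (ler_normD _ _)).
  rewrite [(C i + _) * _]mulrDl [leRHS]mulrDl lerD//.
  rewrite normrM [C i * _]mulrC -[leRHS]mulrA ler_pM//; last exact: (CP i).2.
  by have [_] := dP _ (din t tp).
have nbh : \forall h \near (0 : V), `|h| < d / D.
  by apply: (nbhs0_lt (V := V)); rewrite divr_gt0.
near=> h.
have hD : `|h| * (\sum_i C i * `|e i|) < d.
  apply: (@le_lt_trans _ _ (`|h| * D)); first by rewrite ler_wpM2l// lerDl.
  by rewrite -ltr_pdivlMr//; near: h.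
have [+ _] := main _ _ hD; rewrite -pE => H; apply: le_trans H _.
rewrite ler_wpM2r// mulrA [_ * eps]mulrC -mulrA ler_piMr ?ltW//.
by rewrite ltr_pdivrMr// mul1r ltrDl.
Unshelve. all: by end_near. Qed.

(** The second difference is the increment of [phi], itself a difference of [f] along [t *: v]. One
    mean value along [u] and one along [v] produce the mixed derivative at an intermediate point. *)
Lemma mean_value_rectangle (f : V -> R) (x u v : V) (t : R) :
  (forall a b, `|a| <= `|t| -> `|b| <= `|t| ->
     derivable f (b *: v + (a *: u + x)) u /\
     derivable (fun z => 'D_u f z) (b *: v + (a *: u + x)) v) ->
  exists a b, [/\ `|a| <= `|t|, `|b| <= `|t| &
    f (t *: v + (t *: u + x)) - f (t *: v + x) - (f (t *: u + x) - f x) =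
    'D_v (fun z => 'D_u f z) (b *: v + (a *: u + x)) * t * t].
Proof.
move=> df.
pose phi (a : R) : R := f (a *: u + (t *: v + x)) - f (a *: u + x).
have dphi (a : R) : `|a| <= `|t| -> is_derive a 1 phi
    ('D_u f (a *: u + (t *: v + x)) - 'D_u f (a *: u + x)).
  move=> at_; apply: is_deriveB; apply: is_derive_line.
    by rewrite addrCA; exact: (df a t at_ (lexx _)).1.
  have n0 : `|0 : R| <= `|t| by rewrite normr0.
  by have := (df a 0 at_ n0).1; rewrite scale0r add0r; apply.
have [|a at_ ] := @mean_value_sym _ phi t.
  by move=> a /dphi [].
have [_ ->] := dphi a at_.
rewrite /phi scale0r !add0r => E.
have [|b bt E2] := @mean_value_line _ _ (fun z => 'D_u f z) (a *: u + x) v t.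
  by move=> b bt; have [] := df a b at_ bt.
exists a, b; split=> //; rewrite -E2 [t *: v + (a *: u + x)]addrCA -E
  [t *: v + (t *: u + x)]addrCA; ring.
Qed.

(** The second difference over the parallelogram with sides [t *: u] and [t *: v] is symmetric in
    [u] and [v]. So the two mixed derivatives take a common value at two points near [x], and
    continuity brings both points to [x]. *)
Lemma schwarz_real (f : V -> R) (x u v : V) :
  (\forall y \near x, [/\ derivable f y u, derivable f y v,
      derivable (fun z => 'D_u f z) y v & derivable (fun z => 'D_v f z) y u]) ->
  {for x, continuous (fun y => 'D_v (fun z => 'D_u f z) y)} ->
  {for x, continuous (fun y => 'D_u (fun z => 'D_v f z) y)} ->
  'D_v (fun z => 'D_u f z) x = 'D_u (fun z => 'D_v f z) x.
Proof.
move=> df c1 c2; apply/eqP; rewrite -subr_eq0 -normr_eq0.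
apply/eqP/le_anti/andP; split=> //; apply/ler_addgt0Pr => eps e0; rewrite add0r.
have e20 : 0 < eps / 2 by rewrite divr_gt0.
have : \forall y \near x, [/\ derivable f y u, derivable f y v,
      derivable (fun z => 'D_u f z) y v & derivable (fun z => 'D_v f z) y u] /\
      (`|'D_v (fun z => 'D_u f z) x - 'D_v (fun z => 'D_u f z) y| <= eps / 2 /\
      `|'D_u (fun z => 'D_v f z) x - 'D_u (fun z => 'D_v f z) y| <= eps / 2).
  have /cvgrPdist_le/(_ _ e20) := c1; have /cvgrPdist_le/(_ _ e20) := c2.
  by move=> h1 h2; apply: filterS2 df (filterI h2 h1) => y.
case/nbhs_ballP => d /= d0 dP.
pose D := `|u| + `|v| + 1; have D0 : 0 < D by rewrite ltr_wpDl// addr_ge0.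
pose t := d / D / 2; have t0 : 0 < t by rewrite !divr_gt0.
have tD : t * (`|u| + `|v|) < d.
  apply: (@le_lt_trans _ _ (t * D)); first by rewrite ler_wpM2l ?lerDl// ltW.
  by rewrite /t mulrAC divfK ?gt_eqF//; lra.
have din (a b : R) (u' v' : V) : `|a| <= `|t| -> `|b| <= `|t| ->
    `|u'| + `|v'| = `|u| + `|v| -> ball x d (b *: v' + (a *: u' + x)).
  rewrite [`|t|]gtr0_norm// => at_ bt uv.
  rewrite -ball_normE/= addrA opprD addrCA subrr addr0 normrN.
  apply: le_lt_trans tD; rewrite -uv addrC mulrDr.
  by apply: (le_trans (ler_normD _ _)); rewrite !normrZ lerD// ler_wpM2r.
have [|a [b [at_ bt E1]]] := @mean_value_rectangle f x u v t.
  by move=> a b at_ bt; have [[h1 _ h2 _] _] := dP _ (din a b u v at_ bt erefl);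
    split; [exact: h1|exact: h2].
have [|a' [b' [at' bt' E2]]] := @mean_value_rectangle f x v u t.
  by move=> a' b' at' bt'; have [[_ h1 _ h2] _] := dP _ (din a' b' v u at' bt' (addrC _ _));
    split; [exact: h1|exact: h2].
have E : 'D_v (fun z => 'D_u f z) (b *: v + (a *: u + x)) =
    'D_u (fun z => 'D_v f z) (b' *: u + (a' *: v + x)).
  have tn0 : t != 0 by rewrite gt_eqF.
  apply: (mulIf tn0); apply: (mulIf tn0).
  apply: (etrans (esym E1)); apply: (etrans _ E2).
  by rewrite [t *: u + (t *: v + x)]addrCA; ring.
have [_ [H1 _]] := dP _ (din a b u v at_ bt erefl).
have [_ [_ H2]] := dP _ (din a' b' v u at' bt' (addrC _ _)).
set B := 'D_v _ _ in E H1; rewrite -E in H2.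
rewrite (splitr eps) -(subrKA B); apply: (le_trans (ler_normD _ _)).
apply: lerD; first exact: H1.
rewrite distrC; exact: H2.
Qed.

End frechet.

(** * Maps of class C^k *)

Section is_derive_rules1.
Context {R : realType} {V W : normedModType R}.

Lemma is_derive_line0 (f : V -> W) (x v : V) (df : W) :
  is_derive (0 : R) 1 (fun s : R => f (s *: v + x)) df <-> is_derive x v f df.
Proof.
split=> [[d1 d2]|[d1 <-]]; last first.
  have := @is_derive_line _ _ _ f x v 0.
  by rewrite scale0r add0r => /(_ d1).
have d : derivable f x v by apply/derivable1P.
split=> //; rewrite -d2; have := @is_derive_line _ _ _ f x v 0.
by rewrite scale0r add0r => /(_ d)[_ ->].
Qed.

Lemma is_derive_scale (a : V -> R) (f : V -> W) (x v : V) (da : R) (df : W) :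
  is_derive x v a da -> is_derive x v f df ->
  is_derive x v (fun y => a y *: f y) (a x *: df + da *: f x).
Proof.
move=> [a1 <-] [f1 <-].
have H : (fun h => h^-1 *: (((fun y => a y *: f y) \o shift x) (h *: v) - a x *: f x))
    @ 0^' --> a x *: 'D_v f x + 'D_v a x *: f x.
  have -> : (fun h : R => h^-1 *: (((fun y => a y *: f y) \o shift x) (h *: v) - a x *: f x))
     = (fun h => a (h *: v + x) *: (h^-1 *: ((f \o shift x) (h *: v) - f x))
               + (h^-1 *: ((a \o shift x) (h *: v) - a x)) *: f x).
    apply/funext => h /=; rewrite /shift [a _ *: (_ *: _)]scalerA [a _ * _]mulrC -scalerA.
    rewrite -[h^-1 *: (a _ - _)]/(h^-1 * _) -scalerA -scalerDr.
    by congr (_ *: _); rewrite scalerBr scalerBl subrKA.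
  apply: cvgD; last by apply: cvgZr_tmp a1.
  apply: cvgZ; last exact: f1.
  suff : {for 0, continuous (fun h : R => a (h *: v + x))}.
    by move=> /continuous_withinNx; rewrite scale0r add0r.
  by apply/differentiable_continuous/derivable1_diffP/(derivable1P _ _ _).1.
split; last exact: cvg_lim H.
by apply/cvg_ex; exists (a x *: 'D_v f x + 'D_v a x *: f x).
Qed.

Lemma is_derive_linear {W' : normedModType R} (l : {linear W -> W'})
    (f : V -> W) (x v : V) (df : W) :
  continuous l -> is_derive x v f df -> is_derive x v (l \o f) (l df).
Proof.
move=> lc [f1 <-].
have H : (fun h => h^-1 *: (((l \o f) \o shift x) (h *: v) - l (f x)))
    @ 0^' --> l ('D_v f x).
  have -> : (fun h : R => h^-1 *: (((l \o f) \o shift x) (h *: v) - l (f x)))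
     = l \o (fun h => h^-1 *: ((f \o shift x) (h *: v) - f x)).
    by apply/funext => h /=; rewrite [RHS]linearZ/= [in RHS](linearB l).
  by apply: cvg_comp; [exact: f1|exact: lc].
split; last exact: cvg_lim H.
by apply/cvg_ex; exists (l ('D_v f x)).
Qed.

Lemma is_derive_fsum {K : finType} (f : K -> V -> W) (x v : V) (df : K -> W) :
  (forall i, is_derive x v (f i) (df i)) ->
  is_derive x v (fun y => \sum_i f i y) (\sum_i df i).
Proof.
move=> fd; elim: (index_enum K) => [|i r IH].
  rewrite big_nil (_ : (fun y => _) = cst 0); first exact: is_derive_cst.
  by apply/funext => y; rewrite big_nil.
rewrite big_cons (_ : (fun y => _) = f i + (fun y => \sum_(j <- r) f j y)).
  exact: is_deriveD.
by apply/funext => y; rewrite big_cons.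
Qed.

End is_derive_rules1.

Section is_derive_rules2.
Context {R : realType} {V W : normedModType R}.

(** Restricted to a line, [g] has a full differential as soon as it has a directional derivative;
    the chain rule for differentials then applies. *)
Lemma is_derive_chain {U : normedModType R} (f : V -> W) (g : U -> V)
    (x v : U) (dg : V) :
  differentiable f (g x) -> is_derive x v g dg ->
  is_derive x v (f \o g) ('D_dg f (g x)).
Proof.
move=> df /is_derive_line0 dg0; apply/is_derive_line0.
set g0 := fun s : R => g (s *: v + x).
have e0 : g0 0 = g x by rewrite /g0 scale0r add0r.
have dg1 : differentiable g0 0 by apply/derivable1_diffP; case: dg0.
have df1 : differentiable f (g0 0) by rewrite e0.
have dfg : differentiable (f \o g0) 0 by exact: differentiable_comp.
rewrite (_ : (fun s => _) = f \o g0)//.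
split; first exact/derivable1_diffP.
rewrite (deriveE _ dfg) diff_comp//= -(deriveE _ dg1).
by have [_ ->] := dg0; rewrite deriveE// e0.
Qed.

Lemma is_derive_ext (f g : V -> W) (x v : V) (df dg : W) :
  is_derive x v f df -> f =1 g -> df = dg -> is_derive x v g dg.
Proof. by move=> h /funext <- <-. Qed.

End is_derive_rules2.

Section Ck_basics1.
Context {R : realType} {V W : normedModType R}.
Implicit Types (U : set V) (f g : V -> W).

Lemma Ck_subset k U U' f : U' `<=` U -> Ck k U f -> Ck k U' f.
Proof.
move=> UU; elim: k f => [|k IH] f /=; first by move=> h x /UU/h.
by move=> h v; have [h1 h2] := h v; split=> [x /UU/h1//|]; exact: IH.
Qed.

Lemma open_near_eq (T : topologicalType) (S : Type) (U : set T) (f g : T -> S) x :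
  open U -> U x -> (forall y, U y -> f y = g y) -> \forall y \near x, f y = g y.
Proof. by move=> oU Ux fg; near=> y; apply: fg; near: y; exact: open_nbhs_nbhs.
Unshelve. all: by end_near. Qed.

Lemma Ck_eq k U f g : open U -> (forall x, U x -> f x = g x) ->
  Ck k U f -> Ck k U g.
Proof.
move=> oU; elim: k f g => [|k IH] f g fg /=.
  move=> h x Ux; have cf := h x Ux; rewrite /prop_for /continuous_at -(fg x Ux).
  by apply: cvg_trans cf; apply: near_eq_cvg; apply: open_near_eq oU Ux _.
move=> h v; have [h1 h2] := h v; split=> [x Ux|].
  by apply: near_eq_derivable (h1 x Ux); apply: open_near_eq oU Ux _.
apply: IH h2 => x Ux; apply: near_eq_derive.
by apply: open_near_eq oU Ux _.
Qed.

Lemma Ck_is_derive k U f x v : Ck k.+1 U f -> U x -> is_derive x v f ('D_v f x).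
Proof. by move=> h Ux; apply/derivableP; have [+ _] := h v; apply. Qed.

(** [Ck] speaks of the function ['D_v f] itself; this form accepts any formula that agrees with it
    on [U]. *)
Lemma CkS k U f :
  open U ->
  (forall v, exists2 df : V -> W,
     (forall x, U x -> is_derive x v f (df x)) & Ck k U df) ->
  Ck k.+1 U f.
Proof.
move=> oU h v; have [df h1 h2] := h v; split=> [x /h1[]//|].
by apply: Ck_eq h2 => // x /h1[_ ->].
Qed.

Lemma Ck_cst k U (c : W) : open U -> Ck k U (cst c).
Proof.
move=> oU; elim: k c => [|k IH] c; first by move=> x _; exact: cvg_cst.
by apply: CkS => // v; exists (cst 0) => // x _; exact: is_derive_cst.
Qed.

Lemma CkD k U f g : open U -> Ck k U f -> Ck k U g -> Ck k U (fun x => f x + g x).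
Proof.
move=> oU; elim: k f g => [|k IH] f g cf cg.
  by move=> x Ux; apply: cvgD; [exact: cf|exact: cg].
apply: CkS => // v; exists (fun x => 'D_v f x + 'D_v g x).
  by move=> x Ux; apply: is_deriveD; exact: Ck_is_derive Ux.
by apply: IH; [have [] := cf v|have [] := cg v].
Qed.

Lemma Ck_sum k U (K : finType) (f : K -> V -> W) : open U ->
  (forall i, Ck k U (f i)) -> Ck k U (fun x => \sum_i f i x).
Proof.
move=> oU fd; elim: (index_enum K) => [|i r IH].
  by apply: Ck_eq (Ck_cst k 0 oU) => // x _; rewrite big_nil.
by apply: Ck_eq (CkD oU (fd i) IH) => // x _; rewrite big_cons.
Qed.

End Ck_basics1.

Section Ck_basics2.
Context {R : realType} {V W : normedModType R}.
Implicit Types (U : set V) (f g : V -> W).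

Lemma Ck_linear {W' : normedModType R} k U f (l : {linear W -> W'}) :
  open U -> continuous l -> Ck k U f -> Ck k U (fun x => l (f x)).
Proof.
move=> oU cl; elim: k f => [|k IH] f cf.
  by move=> x Ux; apply: continuous_comp; [exact: cf|exact: cl].
apply: CkS => // v; exists (fun x => l ('D_v f x)).
  by move=> x Ux; apply: is_derive_linear => //; exact: Ck_is_derive Ux.
by apply: IH; have [] := cf v.
Qed.

End Ck_basics2.

Section Ck_basics3.
Context {R : realType} {V W : normedModType R}.
Implicit Types (U : set V) (f g : V -> W).

(** Coordinates of the target reduce the claim to real functions, where the mean value argument is
    available. *)
Lemma Ck1_differentiable U f x : findim V -> findim W -> open U -> U x ->
  Ck 1 U f -> differentiable f x.
Proof.
move=> fV [K [e [p [pc pE]]]] oU Ux cf.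
have dp i : differentiable (p i \o f) x.
  have cpf := Ck_linear oU (pc i) cf.
  apply: continuous_derive_differentiable => //.
    near=> y; move=> v; have [+ _] := cpf v; apply.
    by near: y; exact: open_nbhs_nbhs.
  by move=> v; have [_ +] := cpf v; apply.
have -> : f = fun y => \sum_i (p i \o f) y *: e i by apply/funext => y; rewrite -pE.
elim: (index_enum K) => [|i r IH].
  rewrite (_ : (fun y => _) = cst 0); first exact: differentiable_cst.
  by apply/funext => y; rewrite big_nil.
rewrite (_ : (fun y => _) = (fun y => (p i \o f) y *: e i) +
   (fun y => \sum_(j <- r) (p j \o f) y *: e j)).
  by apply: differentiableD => //; apply: differentiableZl.
by apply/funext => y; rewrite big_cons.
Unshelve. all: by end_near. Qed.

(** By definition [Ck k.+1] does not contain the continuity of [f]. It is recovered from total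
    differentiability, and this is where finite dimension enters. *)
Lemma Ck_pred k U f : findim V -> findim W -> open U -> Ck k.+1 U f -> Ck k U f.
Proof.
move=> fV fW oU; elim: k f => [|k IH] f cf.
  move=> x Ux; apply: differentiable_continuous.
  exact: Ck1_differentiable Ux cf.
by move=> v; have [h1 h2] := cf v; split=> //; exact: IH.
Qed.

Lemma Ck_le k k' U f : findim V -> findim W -> open U -> (k' <= k)%N ->
  Ck k U f -> Ck k' U f.
Proof.
move=> fV fW oU; elim: k => [|k IH]; first by rewrite leqn0 => /eqP ->.
rewrite leq_eqVlt => /predU1P[->//|]; rewrite ltnS => /IH h cf.
by apply: h; exact: Ck_pred.
Qed.

End Ck_basics3.

Section Ck_basics4.
Context {R : realType} {V W : normedModType R}.
Implicit Types (U : set V) (f g : V -> W).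

Lemma Ck_scale k U (a : V -> R) f : findim V -> findim W -> open U ->
  Ck k U a -> Ck k U f -> Ck k U (fun x => a x *: f x).
Proof.
move=> fV fW oU; elim: k a f => [|k IH] a f ca cf.
  by move=> x Ux; apply: cvgZ; [exact: ca|exact: cf].
apply: CkS => // v; exists (fun x => a x *: 'D_v f x + 'D_v a x *: f x).
  by move=> x Ux; apply: is_derive_scale; exact: Ck_is_derive Ux.
apply: CkD => //; apply: IH.
- by apply: Ck_pred => //; exact: findim_real.
- by have [] := cf v.
- by have [] := ca v.
- exact: Ck_pred.
Qed.

End Ck_basics4.

Section Ck_comp.
Context {R : realType} {E V W : normedModType R}.

(** In the chain rule the direction ['D_v g x] moves with [x]. Expanding it in coordinates leaves
    only derivatives of [f] along the fixed vectors [e i], to which the induction hypothesis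
    applies. *)
Lemma Ck_comp k (U : set E) (U' : set V) (f : V -> W) (g : E -> V) :
  findim E -> findim V -> findim W -> open U -> open U' ->
  (forall x, U x -> U' (g x)) -> Ck k U' f -> Ck k U g -> Ck k U (f \o g).
Proof.
move=> fE fV fW oU oU' gU; elim: k f => [|k IH] f cf cg.
  move=> x Ux; apply: continuous_comp; first exact: cg.
  by apply: cf; exact: gU.
have fV' := fV; case: fV' => K [e [p [pc pE]]].
have df y : U' y -> differentiable f y.
  by move=> Uy; apply: Ck1_differentiable Uy _ => //; apply: Ck_le cf.
apply: CkS => // v; exists (fun x => \sum_i p i ('D_v g x) *: 'D_(e i) f (g x)).
  move=> x Ux; have h := is_derive_chain (df _ (gU _ Ux)) (Ck_is_derive v cg Ux).
  apply: is_derive_ext h _ _ => //.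
  rewrite [LHS]deriveE; last exact: (df _ (gU _ Ux)).
  rewrite [in LHS](pE ('D_v g x)) linear_sum; apply: eq_bigr => i _.
  by rewrite linearZ [in RHS](deriveE _ (df _ (gU _ Ux))).
apply: Ck_sum => // i; apply: Ck_scale => //.
  by apply: Ck_linear => //; have [] := cg v.
apply: (IH (fun y => 'D_(e i) f y)); first by have [] := cf (e i).
exact: Ck_pred.
Qed.

End Ck_comp.

#[local] Hint Extern 0 (findim _) =>
  solve [exact: findim_real | exact: findim_plane | exact: findim_mx] : core.

(** * Calculus of maps smooth near a point *)

Section smooth_rules.
Context {R : realType} {V W : normedModType R}.
Implicit Types (f g : V -> W) (x v : V).

Lemma smooth_onP (U : set V) f x : open U -> U x -> smooth_on U f -> smooth_at f x.
Proof. by move=> oU Ux sf; exists U. Qed.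

Lemma smooth_at_near f x : smooth_at f x -> \forall y \near x, smooth_at f y.
Proof.
move=> [U [oU Ux] sf]; near=> y; exists U => //; split=> //.
by near: y; exact: open_nbhs_nbhs.
Unshelve. all: by end_near. Qed.

Lemma smooth_at_eq f g x : (\forall y \near x, f y = g y) ->
  smooth_at f x -> smooth_at g x.
Proof.
rewrite -nbhs_nearE nbhsE => -[U [oU Ux] fg] [U' [oU' Ux'] sf].
exists (U `&` U'); first by split; [exact: openI|split].
move=> k; apply: (@Ck_eq _ _ _ k _ f); first exact: openI.
  by move=> y [/fg].
by apply: Ck_subset (sf k); exact: subIsetr.
Qed.

Lemma smooth_at2 {W1 W2 W3 : normedModType R} {f : V -> W1} {g : V -> W2} {h : V -> W3} {x} :
  smooth_at f x -> smooth_at g x ->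
  (forall k U, open U -> Ck k U f -> Ck k U g -> Ck k U h) ->
  smooth_at h x.
Proof.
move=> [U [oU Ux] sf] [U' [oU' Ux'] sg] H.
exists (U `&` U'); first by split; [exact: openI|split].
move=> k; apply: H; first exact: openI.
  by apply: Ck_subset (sf k); exact: subIsetl.
by apply: Ck_subset (sg k); exact: subIsetr.
Qed.

End smooth_rules.

Section smooth_rules1.
Context {R : realType} {V W : normedModType R}.
Implicit Types (f g : V -> W) (x v : V).

Lemma smooth_at_cst (c : W) x : smooth_at (cst c) x.
Proof. by exists setT; [split=> //; exact: openT|move=> k; apply: Ck_cst; exact: openT]. Qed.

Lemma smooth_atD f g x : smooth_at f x -> smooth_at g x ->
  smooth_at (fun y => f y + g y) x.
Proof. by move=> sf sg; apply: (smooth_at2 sf sg) => k U oU cf cg; exact: CkD. Qed.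

Lemma smooth_at_sum (K : finType) (f : K -> V -> W) x :
  (forall i, smooth_at (f i) x) -> smooth_at (fun y => \sum_i f i y) x.
Proof.
move=> fd; elim: (index_enum K) => [|i r IH].
  rewrite (_ : (fun y => _) = cst 0); first exact: smooth_at_cst.
  by apply/funext => y; rewrite big_nil.
rewrite (_ : (fun y => _) = fun y => f i y + \sum_(j <- r) f j y).
  exact: smooth_atD.
by apply/funext => y; rewrite big_cons.
Qed.

Lemma smooth_at_linear {W' : normedModType R} (l : {linear W -> W'}) f x :
  continuous l -> smooth_at f x -> smooth_at (fun y => l (f y)) x.
Proof. by move=> lc sf; apply: (smooth_at2 sf sf) => k U oU cf _; exact: Ck_linear. Qed.

Lemma smooth_atN f x : smooth_at f x -> smooth_at (fun y => - f y) x.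
Proof.
move=> sf; apply: (smooth_at_linear (l := @GRing.opp W)) sf.
exact: opp_continuous.
Qed.

Lemma smooth_atB f g x : smooth_at f x -> smooth_at g x ->
  smooth_at (fun y => f y - g y) x.
Proof. by move=> sf sg; apply: smooth_atD sf _; exact: smooth_atN. Qed.

Lemma smooth_at_derive f x v : smooth_at f x -> smooth_at (fun y => 'D_v f y) x.
Proof.
by move=> [U oU sf]; exists U => // k; have [_] := sf k.+1 v.
Qed.

Lemma smooth_at_is_derive f x v : smooth_at f x -> is_derive x v f ('D_v f x).
Proof. by move=> [U [oU Ux] sf]; apply: Ck_is_derive (sf 1%N) Ux. Qed.

Lemma smooth_at_continuous f x : smooth_at f x -> {for x, continuous f}.
Proof. by move=> [U [oU Ux] sf]; exact: (sf 0%N). Qed.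

Lemma smooth_at_scale (a : V -> R) f x : findim V -> findim W ->
  smooth_at a x -> smooth_at f x -> smooth_at (fun y => a y *: f y) x.
Proof. by move=> fV fW sf sg; apply: (smooth_at2 sf sg) => k U oU; exact: Ck_scale. Qed.

Lemma smooth_at_differentiable f x : findim V -> findim W ->
  smooth_at f x -> differentiable f x.
Proof. by move=> fV fW [U [oU Ux] sf]; apply: Ck1_differentiable (sf 1%N). Qed.

Lemma smooth_at_linearP f x : findim V -> findim W -> smooth_at f x ->
  linear (fun v => 'D_v f x).
Proof.
move=> fV fW /(smooth_at_differentiable fV fW) df a u v.
by rewrite !(deriveE _ df) linearP.
Qed.

Lemma smooth_at_id x : smooth_at id x.
Proof.
exists setT => // [|k]; first by split=> //; exact: openT.
case: k => [y _|k v]; first exact: cvg_id.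
split=> [y _|]; first exact: derivable_id.
rewrite (_ : (fun y => _) = cst v); first by apply: Ck_cst; exact: openT.
by apply/funext => y; rewrite derive_id.
Qed.

End smooth_rules1.

Section smooth_rules2.
Context {R : realType} {E V W : normedModType R}.

Lemma smooth_at_comp (f : V -> W) (g : E -> V) x :
  findim E -> findim V -> findim W ->
  smooth_at f (g x) -> smooth_at g x -> smooth_at (fun y => f (g y)) x.
Proof.
move=> fE fV fW [U [oU Ux] sf] [U' [oU' Ux'] sg].
have /open_nbhs_nbhs/(smooth_at_continuous (smooth_onP oU' Ux' sg)) : open_nbhs (g x) U by split.
rewrite nbhsE => -[U'' [oU'' Ux''] gU].
exists (U' `&` U''); first by split; [exact: openI|split].
move=> k; apply: (@Ck_comp _ _ _ _ k _ U f g) => //; first exact: openI.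
  by move=> y [_ /gU].
by apply: Ck_subset (sg k); exact: subIsetl.
Qed.

Lemma derive_comp (f : V -> W) (g : E -> V) x v :
  findim E -> findim V -> findim W ->
  smooth_at f (g x) -> smooth_at g x ->
  'D_v (fun y => f (g y)) x = 'D_('D_v g x) f (g x).
Proof.
move=> fE fV fW sf sg.
have := is_derive_chain (smooth_at_differentiable fV fW sf) (smooth_at_is_derive v sg).
by case.
Qed.

End smooth_rules2.

Section schwarz.
Context {R : realType} {V W : normedModType R}.

Lemma derive_linear {W' : normedModType R} (l : {linear W -> W'}) (f : V -> W) x v :
  continuous l -> smooth_at f x -> 'D_v (fun y => l (f y)) x = l ('D_v f x).
Proof.
by move=> lc sf; have [] := is_derive_linear lc (smooth_at_is_derive v sf).
Qed.

Lemma schwarz (f : V -> W) x u v : findim W -> smooth_at f x ->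
  'D_v (fun z => 'D_u f z) x = 'D_u (fun z => 'D_v f z) x.
Proof.
move=> [K [e [p [pc pE]]]] sf.
suff H a b : (forall i, p i a = p i b) -> a = b; last first.
  by move=> E; rewrite (pE a) (pE b); apply: eq_bigr => i _; rewrite E.
apply: H => i.
rewrite -(derive_linear v (pc i) (smooth_at_derive u sf)).
rewrite -(derive_linear u (pc i) (smooth_at_derive v sf)).
have Ep w : \forall z \near x, p i ('D_w f z) = 'D_w (fun y => p i (f y)) z.
  have := smooth_at_near sf; apply: filterS => z sz.
  by rewrite derive_linear.
rewrite (near_eq_derive v (Ep u)) (near_eq_derive u (Ep v)).
have sp : smooth_at (fun y => p i (f y)) x by exact: smooth_at_linear.
apply: schwarz_real.
- have := smooth_at_near sp; apply: filterS => z sz.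
  have [d1 _] := smooth_at_is_derive u sz; have [d2 _] := smooth_at_is_derive v sz.
  have [d3 _] := smooth_at_is_derive v (smooth_at_derive u sz).
  have [d4 _] := smooth_at_is_derive u (smooth_at_derive v sz).
  split; [exact: d1|exact: d2|exact: d3|exact: d4].
- by apply: smooth_at_continuous; do 2 apply: smooth_at_derive.
- by apply: smooth_at_continuous; do 2 apply: smooth_at_derive.
Qed.

End schwarz.

Section smooth_real.
Context {R : realType} {V : normedModType R}.
Hypothesis fV : findim V.
Implicit Types (f g : V -> R) (x v : V).

Lemma smooth_atM f g x : smooth_at f x -> smooth_at g x ->
  smooth_at (fun y => f y * g y) x.
Proof. by move=> sf sg; apply: smooth_at_scale. Qed.

Lemma smooth_at_prod (K : finType) (f : K -> V -> R) x :
  (forall i, smooth_at (f i) x) -> smooth_at (fun y => \prod_i f i y) x.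
Proof.
move=> fd; elim: (index_enum K) => [|i r IH].
  rewrite (_ : (fun y => _) = cst 1); first exact: smooth_at_cst.
  by apply/funext => y; rewrite big_nil.
rewrite (_ : (fun y => _) = fun y => f i y * \prod_(j <- r) f j y).
  exact: smooth_atM.
by apply/funext => y; rewrite big_cons.
Qed.

Lemma CkV k (U : set V) f : open U -> (forall x, U x -> f x != 0) ->
  Ck k U f -> Ck k U (fun x => (f x)^-1).
Proof.
move=> oU f0; elim: k => [|k IH] cf.
  by move=> x Ux; apply: cvgV; [exact: f0|exact: cf].
have cf' : Ck k U f by exact: Ck_pred.
apply: CkS => // v.
exists (fun x => (f x)^-1 *: ((f x)^-1 *: (- 'D_v f x))).
  move=> x Ux; have [d dE] := Ck_is_derive v cf Ux.
  have h := derivableV (f0 _ Ux) d.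
  apply: is_derive_ext (derivableP h) _ _ => //.
  by rewrite deriveV ?f0// scalerA scalerN scaleNr -expr2 exprVn.
do 2 (apply: Ck_scale => //; first exact: IH).
apply: (@Ck_linear _ _ _ _ _ _ _ (@GRing.opp R)) => //.
  exact: opp_continuous.
by have [] := cf v.
Qed.

Lemma smooth_atV f x : f x != 0 -> smooth_at f x -> smooth_at (fun y => (f y)^-1) x.
Proof.
move=> f0 [U [oU Ux] sf].
have : \forall y \near x, f y != 0.
  by apply: (cvgr_neq0 (f x)) => //; exact: (sf 0%N).
rewrite -nbhs_nearE nbhsE => -[U' [oU' Ux'] fU].
exists (U `&` U'); first by split; [exact: openI|split].
move=> k; apply: CkV; first exact: openI.
  by move=> y [_ /fU].
by apply: Ck_subset (sf k); exact: subIsetl.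
Qed.

End smooth_real.

(** * Smooth matrix-valued maps *)

Section smooth_matrix.
Context {R : realType} {V : normedModType R}.
Hypothesis fV : findim V.
Implicit Types (x v : V).

Definition entry m n (i : 'I_m) (j : 'I_n) : {linear 'M[R]_(m, n) -> R} :=
  HB.pack (fun A : 'M[R]_(m, n) => A i j : R)
    (GRing.isLinear.Build _ _ _ _ _ (@entry_is_linear R m n i j)).

Lemma smooth_at_mxP m n (A : V -> 'M[R]_(m, n)) x :
  smooth_at A x <-> forall i j, smooth_at (fun y => A y i j) x.
Proof.
split=> [sA i j|sA].
  by apply: (smooth_at_linear (l := entry i j)) sA; exact: coord_continuous.
rewrite (_ : A = fun y => \sum_(ij : 'I_m * 'I_n) A y ij.1 ij.2 *: delta_mx ij.1 ij.2).
  apply: smooth_at_sum => ij; apply: smooth_at_scale => //.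
  exact: smooth_at_cst.
by apply/funext => y; rewrite [LHS]matrix_sum_delta pair_bigA.
Qed.

Lemma derive_entry m n (A : V -> 'M[R]_(m, n)) x v i j :
  smooth_at A x -> 'D_v A x i j = 'D_v (fun y => A y i j) x.
Proof.
move=> sA; rewrite -[LHS]/(entry i j ('D_v A x)) -derive_linear//.
exact: coord_continuous.
Qed.

Lemma smooth_at_mulmx m n p (A : V -> 'M[R]_(m, n)) (B : V -> 'M[R]_(n, p)) x :
  smooth_at A x -> smooth_at B x -> smooth_at (fun y => A y *m B y) x.
Proof.
move=> /smooth_at_mxP sA /smooth_at_mxP sB; apply/smooth_at_mxP => i j.
rewrite (_ : (fun y => _) = fun y => \sum_k A y i k * B y k j).
  by apply: smooth_at_sum => k; apply: smooth_atM.
by apply/funext => y; rewrite mxE.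
Qed.

Lemma derive_mulmx m n p (A : V -> 'M[R]_(m, n)) (B : V -> 'M[R]_(n, p)) x v :
  smooth_at A x -> smooth_at B x ->
  'D_v (fun y => A y *m B y) x = A x *m 'D_v B x + 'D_v A x *m B x.
Proof.
move=> sA sB; apply/matrixP => i j.
rewrite derive_entry; last exact: smooth_at_mulmx.
rewrite (_ : (fun y => _) = fun y => \sum_k A y i k *: B y k j); last first.
  by apply/funext => y; rewrite mxE.
have h k : is_derive x v (fun y => A y i k *: B y k j)
    (A x i k *: 'D_v (fun y => B y k j) x + 'D_v (fun y => A y i k) x *: B x k j).
  apply: is_derive_scale; apply: smooth_at_is_derive.
    exact: (smooth_at_mxP _ _).1 sA i k.
  exact: (smooth_at_mxP _ _).1 sB k j.
have [_ ->] := is_derive_fsum h.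
rewrite !mxE -big_split; apply: eq_bigr => k _.
by rewrite !derive_entry.
Qed.

Lemma smooth_at_trmx m n (A : V -> 'M[R]_(m, n)) x :
  smooth_at A x -> smooth_at (fun y => (A y)^T) x.
Proof.
move=> /smooth_at_mxP sA; apply/smooth_at_mxP => i j.
by rewrite (_ : (fun y => _) = fun y => A y j i)//; apply/funext => y; rewrite mxE.
Qed.

Lemma derive_trmx m n (A : V -> 'M[R]_(m, n)) x v :
  smooth_at A x -> 'D_v (fun y => (A y)^T) x = ('D_v A x)^T.
Proof.
move=> sA; apply/matrixP => i j; rewrite derive_entry; last exact: smooth_at_trmx.
rewrite mxE (derive_entry v j i sA).
by rewrite (_ : (fun y => (A y)^T i j) = fun y => A y j i)//; apply/funext => y; rewrite mxE.
Qed.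

Lemma smooth_at_det n (A : V -> 'M[R]_n) x :
  smooth_at A x -> smooth_at (fun y => \det (A y)) x.
Proof.
move=> /smooth_at_mxP sA; apply: smooth_at_sum => s.
apply: smooth_atM => //; first exact: smooth_at_cst.
exact: smooth_at_prod.
Qed.

Lemma smooth_at_adj n (A : V -> 'M[R]_n) x :
  smooth_at A x -> smooth_at (fun y => \adj (A y)) x.
Proof.
move=> /smooth_at_mxP sA; apply/smooth_at_mxP => i j.
rewrite (_ : (fun y => _) = fun y => (-1) ^+ (j + i) * \det (row' j (col' i (A y)))).
  apply: smooth_atM => //; first exact: smooth_at_cst.
  apply: smooth_at_det; apply/smooth_at_mxP => a b.
  by rewrite (_ : (fun y => _) = fun y => A y (lift j a) (lift i b))//; apply/funext => y; rewrite !mxE.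
by apply/funext => y; rewrite mxE.
Qed.

Lemma unitmx_near n (A : V -> 'M[R]_n) x :
  A x \in unitmx -> smooth_at A x -> \forall y \near x, A y \in unitmx.
Proof.
rewrite unitmxE unitfE => A0 sA.
have : \forall y \near x, \det (A y) != 0.
  apply: (cvgr_neq0 (\det (A x))) => //.
  exact: (smooth_at_continuous (smooth_at_det sA)).
by apply: filterS => y; rewrite unitmxE unitfE.
Qed.

(** Near [x] the matrix stays invertible, and there [invmx] is given by Cramer's formula; at
    singular matrices it only has a default value. *)
Lemma smooth_at_invmx n (A : V -> 'M[R]_n) x :
  A x \in unitmx -> smooth_at A x -> smooth_at (fun y => invmx (A y)) x.
Proof.
move=> uA sA; apply: (smooth_at_eq (f := fun y => (\det (A y))^-1 *: \adj (A y))).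
  by have := unitmx_near uA sA; apply: filterS => y; rewrite /invmx => ->.
apply: smooth_at_scale => //; last exact: smooth_at_adj.
apply: smooth_atV => //; first by move: uA; rewrite unitmxE unitfE.
exact: smooth_at_det.
Qed.

Lemma derive_invmx n (A : V -> 'M[R]_n) x v :
  A x \in unitmx -> smooth_at A x ->
  'D_v (fun y => invmx (A y)) x = - (invmx (A x) *m 'D_v A x *m invmx (A x)).
Proof.
move=> uA sA; have sI := smooth_at_invmx uA sA.
have : 'D_v (fun y => A y *m invmx (A y)) x = 0.
  rewrite -(derive_cst (1%:M : 'M[R]_n) x v); apply: near_eq_derive.
  by have := unitmx_near uA sA; apply: filterS => y uy; rewrite mulmxV.
rewrite derive_mulmx// => /eqP; rewrite addr_eq0 => /eqP E.
by rewrite -[LHS](mulKmx uA) E mulmxN !mulmxA.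
Qed.

End smooth_matrix.

(** * Linear differential equations *)


Section matrix_estimates.
Context {R : realType}.

Lemma mx_norm_entry m n (A : 'M[R]_(m, n)) i j : `|A i j| <= `|A|.
Proof.
rewrite [leRHS]/Num.Def.normr/= mx_normrE.
exact: (@le_bigmax _ _ _ 0 (fun ij => `|A ij.1 ij.2|) (i, j)).
Qed.

Lemma mx_norm_le m n (A : 'M[R]_(m, n)) (K : R) :
  0 <= K -> (forall i j, `|A i j| <= K) -> `|A| <= K.
Proof.
move=> K0 AK; rewrite [leLHS]/Num.Def.normr/= mx_normrE.
by apply: bigmax_le => // -[i j] _; exact: AK.
Qed.

(** The norm is the largest entry in absolute value, whence the factor [n]. *)
Lemma mx_norm_mul m n p (A : 'M[R]_(m, n)) (B : 'M[R]_(n, p)) :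
  `|A *m B| <= n%:R * (`|A| * `|B|).
Proof.
apply: mx_norm_le => [|i j]; first by rewrite !mulr_ge0.
rewrite mxE (le_trans (ler_norm_sum _ _ _))//.
rewrite -[n in n%:R]card_ord mulr_natl -sumr_const ler_sum// => k _.
by rewrite normrM ler_pM// mx_norm_entry.
Qed.

Lemma mean_value_mx m n (F : R -> 'M[R]_(m, n)) (dF : R -> 'M[R]_(m, n)) (s t K : R) :
  0 <= K ->
  (forall u, `|u - s| <= `|t - s| -> is_derive u 1 F (dF u) /\ `|dF u| <= K) ->
  `|F t - F s| <= K * `|t - s|.
Proof.
move=> K0 dFK; apply: mx_norm_le => [|i j]; first by rewrite mulr_ge0.
have dF' u : `|u - s| <= `|t - s| ->
    is_derive u 1 (fun u => F u i j) (dF u i j).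
  move=> /dFK[dFu _].
  by have := is_derive_linear (@coord_continuous _ _ _ i j : continuous (entry i j)) dFu.
have [|u ut] := @mean_value_line _ _ (fun u => F u i j) s 1 (t - s).
  move=> u ut; have [|d _] := dF' (u *: 1 + s); last exact: d.
  by rewrite [u *: 1]mulr1 addrK.
rewrite ![_ *: (1 : R)]mulr1 subrK !mxE => ->.
have us : `|u + s - s| <= `|t - s| by rewrite addrK.
have [_ ->] := dF' _ us.
by rewrite normrM ler_wpM2r// (le_trans (mx_norm_entry _ _ _))// (dFK _ us).2.
Qed.

Lemma antiderivative_real (f : R -> R) (s r : R) : continuous f -> 0 < r ->
  exists G : R -> R, forall t, `|t - s| < r -> is_derive t 1 G (f t).
Proof.
move=> cf r0.
have fi : lebesgue_measure.-integrable `[s - r, s + r] (EFin \o f).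
  apply: continuous_compact_integrable; first exact: segment_compact.
  exact: continuous_subspaceT.
exists (fun x => (\int[lebesgue_measure]_(t in [set` `[s - r, x]]) (f t))%R) => t tr.
have tI : s - r < t < s + r by move: tr; rewrite ltr_distl.
have [||d1 d2] := @continuous_FTC1_closed R f (s - r) t (s + r) _ fi _ (cf t).
- by case/andP: tI.
- by case/andP: tI.
by split; [exact: d1|rewrite -derive1E d2].
Qed.

Lemma antiderivative_mx m n (F : R -> 'M[R]_(m, n)) (s r : R) :
  continuous F -> 0 < r ->
  exists G : R -> 'M[R]_(m, n), G s = 0 /\
    forall t, `|t - s| < r -> is_derive t 1 G (F t).
Proof.
move=> cF r0.
have H (ij : 'I_m * 'I_n) : exists G : R -> R,
    forall t, `|t - s| < r -> is_derive t 1 G (F t ij.1 ij.2).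
  apply: antiderivative_real => // t.
  exact: (continuous_comp (cF t) (@coord_continuous _ _ _ ij.1 ij.2 _)).
have [G GP] := choice H.
exists (fun t => \sum_ij (G ij t - G ij s) *: delta_mx ij.1 ij.2); split.
  by apply: big1 => ij _; rewrite subrr scale0r.
move=> t tr; rewrite [F t]matrix_sum_delta pair_bigA.
apply: is_derive_fsum => ij.
have h : is_derive t 1 (fun t => G ij t - G ij s) (F t ij.1 ij.2).
  rewrite -[F t _ _]subr0; apply: is_deriveB; first exact: GP.
have := is_derive_scale h (is_derive_cst (delta_mx ij.1 ij.2 : 'M[R]_(m, n)) t 1).
by rewrite scaler0 add0r.
Qed.

Lemma half_pow_squeeze (C x : R) : (forall k, x <= C / 2 ^+ k) -> x <= 0.
Proof.
move=> h; apply: (@cvgr_to_ge _ \oo _ _ (geometric C 2^-1)).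
  by apply: cvg_geometric; rewrite ger0_norm// invf_lt1// ltr1n.
by near=> k; rewrite /geometric/= exprVn; exact: h.
Unshelve. all: by end_near. Qed.

(** The tail of the geometric series from [k] on is [2 C / 2^k]. The rate is kept explicit so that
    limits of iterates can be handled by estimates alone. *)
Lemma geometric_limit_real (u : nat -> R) (C : R) :
  (forall k, `|u k.+1 - u k| <= C / 2 ^+ k) ->
  exists l, forall k, `|l - u k| <= C *+ 2 / 2 ^+ k.
Proof.
move=> uC; have C0 : 0 <= C by have := uC 0%N; rewrite expr0 divr1; apply: le_trans.
have cu : cvgn (series (telescope u)).
  apply: normed_cvg; apply: (@series_le_cvg _ _ (geometric C 2^-1)).
  - by move=> k; exact: normr_ge0.
  - by move=> k; rewrite /geometric/= mulr_ge0// exprn_ge0// invr_ge0.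
  - by move=> k; rewrite /geometric/= /telescope exprVn; exact: uC.
  - by apply: is_cvg_geometric_series; rewrite ger0_norm// invf_lt1// ltr1n.
(* The subtracted term is the part of the tail still to come; it makes the induction on [p]
   close. *)
have far k p : `|u (k + p)%N - u k| <= C *+ 2 / 2 ^+ k - C *+ 2 / 2 ^+ (k + p).
  elim: p => [|p IH]; first by rewrite addn0 !subrr normr0.
  rewrite addnS -(subrKA (u (k + p)%N)).
  apply: (le_trans (ler_normD _ _)); apply: (le_trans (lerD (uC _) IH)).
  have h (x y : R) : C * x + (C *+ 2 * y - C *+ 2 * x) = C *+ 2 * y - C *+ 2 * (2^-1 * x).
    by rewrite -mulr_natr; field.
  by rewrite exprS invfM h.
exists (u 0%N + lim (series (telescope u) @ \oo)) => k.
have cl : u x @[x --> \oo] --> u 0%N + lim (series (telescope u) @ \oo).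
  have E : (fun k => u 0%N + series (telescope u) k) = u.
    by apply/funext => j; rewrite -eq_sum_telescope.
  suff h : (fun k => u 0%N + series (telescope u) k) x @[x --> \oo] -->
     u 0%N + lim (series (telescope u) @ \oo) by rewrite E in h.
  by apply: cvgD; [exact: cvg_cst|exact: cu].
set l := _ + _ in cl *.
have cl' : (fun j => `|u j - u k|) x @[x --> \oo] --> `|l - u k|.
  exact: (cvg_norm (cvgB cl (cvg_cst _))).
apply: (cvgr_to_le cl'); near=> j.
have kj : (k <= j)%N by near: j; exact: nbhs_infty_ge.
have := far k (j - k)%N; rewrite subnKC// => h; apply: le_trans h _.
by rewrite gerBl divr_ge0// ?mulrn_wge0// exprn_ge0.
Unshelve. all: by end_near. Qed.

Lemma geometric_limit m n (u : nat -> 'M[R]_(m, n)) (C : R) :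
  (forall k, `|u k.+1 - u k| <= C / 2 ^+ k) ->
  exists l, forall k, `|l - u k| <= C *+ 2 / 2 ^+ k.
Proof.
move=> uC; have C0 : 0 <= C by have := uC 0%N; rewrite expr0 divr1; apply: le_trans.
have H (ij : 'I_m * 'I_n) : exists l,
    forall k, `|l - u k ij.1 ij.2| <= C *+ 2 / 2 ^+ k.
  apply: geometric_limit_real => k; apply: le_trans (uC k).
  by have := mx_norm_entry (u k.+1 - u k) ij.1 ij.2; rewrite !mxE.
have [l lP] := choice H; exists (\matrix_(i, j) l (i, j)) => k.
apply: mx_norm_le => [|i j]; first by rewrite divr_ge0// ?mulrn_wge0// exprn_ge0.
by rewrite !mxE; exact: lP (i, j) k.
Qed.

End matrix_estimates.

(** * Local solutions by Picard iteration *)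

Section picard.
Context {R : realType} {n : nat}.
Variables (B : R -> 'M[R]_n) (s d b : R).
Hypotheses (d0 : 0 < d) (b0 : 0 <= b).
Hypothesis cB : forall t, `|t - s| <= d -> {for t, continuous B}.
Hypothesis Bb : forall t, `|t - s| <= d -> `|B t| <= b.
(** The Picard map contracts by this product: [n] comes from the norm of a matrix product, [b]
    bounds [B], and [d] is the length of integration. *)
Hypothesis small : n%:R * b * d <= 2^-1.

(* Composing with the retraction [c] onto the interval makes all integrands
   continuous on the whole line. *)
Let c (t : R) : R := Num.max (s - d) (Num.min (s + d) t).

Let c_in t : `|c t - s| <= d.
Proof.
by rewrite ler_distl /c le_max lexx/= ge_max ge_min lexx andbT/=; have := d0; lra.
Qed.

Let c_id t : `|t - s| <= d -> c t = t.
Proof.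
by rewrite ler_distl => /andP[h1 h2]; rewrite /c (min_idPr h2) (max_idPr h1).
Qed.

Let c_cont : continuous c.
Proof.
apply: max_fun_continuous; first by move=> x; exact: cvg_cst.
by apply: min_fun_continuous; [move=> x; exact: cvg_cst|move=> x; exact: cvg_id].
Qed.

Let good (Y : R -> 'M[R]_n) := continuous (fun t => Y (c t)).

Let F (Y : R -> 'M[R]_n) (t : R) := Y (c t) *m B (c t).

Let F_cont Y : good Y -> continuous (F Y).
Proof.
move=> gY t; have cBt : {for t, continuous (fun t => B (c t))}.
  by apply: continuous_comp; [exact: c_cont|exact/cB/c_in].
apply/cvgrPdist_le => e e0.
have K0 : 0 < n%:R * (`|B (c t)| + (`|Y (c t)| + 1)) + 1.
  by rewrite ltr_wpDl// mulr_ge0// !addr_ge0.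
set K := _ + 1 in K0.
have eK : 0 < e / K by rewrite divr_gt0.
have e1 : 0 < Num.min 1 (e / K) by rewrite lt_min ltr01.
have /cvgrPdist_le/(_ _ e1) h1 := gY t.
have /cvgrPdist_le/(_ _ e1) h2 := cBt.
near=> t'.
have h1' : `|Y (c t) - Y (c t')| <= Num.min 1 (e / K) by near: t'.
have h2' : `|B (c t) - B (c t')| <= Num.min 1 (e / K) by near: t'.
move: h1' h2'; rewrite !le_min => /andP[h11 h12] /andP[_ h22].
have Yt' : `|Y (c t')| <= `|Y (c t)| + 1.
  rewrite -[Y (c t')](subrK (Y (c t))) addrC (le_trans (ler_normD _ _))//.
  by rewrite lerD2l distrC.
have -> : F Y t - F Y t' = (Y (c t) - Y (c t')) *m B (c t) + Y (c t') *m (B (c t) - B (c t')).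
  by rewrite /F mulmxBl mulmxBr subrKA.
apply: (le_trans (ler_normD _ _)).
apply: (le_trans (lerD (mx_norm_mul _ _) (mx_norm_mul _ _))).
apply: (@le_trans _ _ (n%:R * (e / K * `|B (c t)|) + n%:R * ((`|Y (c t)| + 1) * (e / K)))).
  by rewrite lerD// ler_wpM2l// ler_pM.
have -> : n%:R * (e / K * `|B (c t)|) + n%:R * ((`|Y (c t)| + 1) * (e / K)) =
   e / K * (K - 1) by rewrite /K; ring.
by rewrite mulrBr mulr1 divfK ?gt_eqF// gerBl ltW.
Unshelve. all: by end_near. Qed.

(** The Picard map, which sends [Y] to 1 plus the integral of [Y B] from [s], chosen for all [Y] at
    once. The derivative is given on twice the radius, so that it is two-sided at the end points of
    the closed interval of radius [d]. *)
Let antider : exists A : (R -> 'M[R]_n) -> R -> 'M[R]_n, forall Y, good Y ->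
  A Y s = 1%:M /\ forall t, `|t - s| < d *+ 2 -> is_derive t 1 (A Y) (F Y t).
Proof.
have H (Y : R -> 'M[R]_n) : exists G : R -> 'M[R]_n, good Y ->
   G s = 1%:M /\ forall t, `|t - s| < d *+ 2 -> is_derive t 1 G (F Y t).
  have [gY|ngY] := pselect (good Y); last by exists (fun=> 0).
  have [||G [G0 GP]] := @antiderivative_mx R n n (F Y) s (d *+ 2).
  - exact: F_cont.
  - by rewrite mulrn_wgt0.
  exists (fun t => G t + 1%:M) => _; rewrite G0 add0r; split=> // t ts.
  by rewrite -[F Y t]addr0; apply: is_deriveD; exact: GP.
by have [A AP] := choice H; exists A.
Qed.

(** The iterates start at the constant 1 and the bound on their successive differences is halved
    each time. Hence they converge uniformly, and the limit is a fixed point of the Picard map. *)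
Lemma picard_solution : exists Y : R -> 'M[R]_n, [/\ Y s = 1%:M,
  forall t, `|t - s| <= d -> is_derive t 1 Y (Y t *m B t) &
  forall t, `|t - s| <= d -> {for t, continuous Y}].
Proof.
have [A AP] := antider.
have d2 t : `|t - s| <= d -> `|t - s| < d *+ 2.
  by move=> h; apply: le_lt_trans h _; rewrite mulr2n ltrDl.
have A_cont Y t : good Y -> `|t - s| <= d -> {for t, continuous (A Y)}.
  move=> gY /d2 td; have [_ /(_ t td)[dA _]] := AP Y gY.
  exact/differentiable_continuous/derivable1_diffP.
have A_good Y : good Y -> good (A Y).
  move=> gY t; apply: continuous_comp; first exact: c_cont.
  by apply: A_cont => //; exact: c_in.
have est Y Y' K : good Y -> good Y' -> 0 <= K ->
    (forall t, `|t - s| <= d -> `|Y t - Y' t| <= K) ->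
    forall t, `|t - s| <= d -> `|A Y t - A Y' t| <= K / 2.
  move=> gY gY' K0 YY' t td.
  have [As dA] := AP Y gY; have [As' dA'] := AP Y' gY'.
  have -> : A Y t - A Y' t = (A Y t - A Y' t) - (A Y s - A Y' s).
    by rewrite As As' subrr subr0.
  apply: (le_trans (@mean_value_mx _ _ _ (fun t => A Y t - A Y' t)
     (fun t => F Y t - F Y' t) s t (n%:R * (K * b)) _ _)).
  - by rewrite !mulr_ge0.
  - move=> u /le_trans/(_ td) ud; split.
      by apply: is_deriveB; [exact/dA/d2|exact/dA'/d2].
    rewrite /F -mulmxBl (le_trans (mx_norm_mul _ _))// ler_wpM2l//.
    by rewrite ler_pM// ?YY' ?Bb ?c_in.
  - apply: (@le_trans _ _ (n%:R * (K * b) * d)); first by rewrite ler_wpM2l// !mulr_ge0.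
    have -> : n%:R * (K * b) * d = K * (n%:R * b * d) by ring.
    by rewrite ler_wpM2l.
pose Y k := iter k A (fun=> 1%:M).
have gY k : good (Y k).
  by elim: k => [|k IH] /=; [move=> t; exact: cvg_cst|exact: A_good].
have [C0 [C00 Y01]] : exists C, 0 <= C /\ forall t, `|t - s| <= d -> `|Y 1%N t - Y 0%N t| <= C.
  have [As dA] := AP _ (gY 0%N).
  exists (n%:R * (`|1%:M : 'M[R]_n| * b) * d); split; first by rewrite !mulr_ge0// ltW.
  move=> t td; rewrite -[Y 0%N t]As.
  apply: (le_trans (@mean_value_mx _ _ _ (Y 1%N) (F (Y 0%N)) s t
    (n%:R * (`|1%:M : 'M[R]_n| * b)) _ _)).
  - by rewrite !mulr_ge0.
  - move=> u /le_trans/(_ td) ud; split; first exact/dA/d2.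
    by rewrite (le_trans (mx_norm_mul _ _))// ler_wpM2l// ler_wpM2l// Bb ?c_in.
  - by rewrite ler_wpM2l// !mulr_ge0.
have Yk k t : `|t - s| <= d -> `|Y k.+1 t - Y k t| <= C0 / 2 ^+ k.
  elim: k t => [|k IH] t td; first by rewrite expr0 divr1 Y01.
  rewrite exprS invfM mulrCA mulrC.
  have K0 : 0 <= C0 / 2 ^+ k by rewrite divr_ge0// exprn_ge0.
  exact: (est _ _ _ (gY k.+1) (gY k) K0 IH t td).
have [L LP] : exists L : R -> 'M[R]_n, forall t, `|t - s| <= d ->
    forall k, `|L t - Y k t| <= C0 *+ 2 / 2 ^+ k.
  have H (t : R) : exists l : 'M[R]_n, `|t - s| <= d ->
      forall k, `|l - Y k t| <= C0 *+ 2 / 2 ^+ k.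
    have [td|td] := boolP (`|t - s| <= d); last by exists 0.
    by have [l lP] := @geometric_limit _ _ _ (fun k => Y k t) C0 (fun k => Yk k t td); exists l.
  by have [L LP] := choice H; exists L.
have gL : good L.
  move=> t; apply/cvgrPdist_le => e e0.
  have [k kP] : exists k, C0 *+ 2 / 2 ^+ k <= e / 3.
    apply/not_existsP => h.
    have /half_pow_squeeze : forall k, e / 3 <= C0 *+ 2 / 2 ^+ k.
      by move=> k; apply/ltW; rewrite ltNge; apply/negP => /h.
    by apply/negP; rewrite -ltNge divr_gt0.
  have e3 : 0 < e / 3 by rewrite divr_gt0.
  have /cvgrPdist_le/(_ _ e3) h := gY k t.
  near=> t'.
  have -> : L (c t) - L (c t') = (L (c t) - Y k (c t)) + (Y k (c t) - Y k (c t'))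
      - (L (c t') - Y k (c t')).
    by rewrite subrKA opprB subrKA.
  rewrite (_ : e = e / 3 + e / 3 + e / 3); last by field.
  apply: (le_trans (ler_normB _ _)); apply: lerD; last first.
    by apply: le_trans kP; apply: LP; exact: c_in.
  apply: (le_trans (ler_normD _ _)); apply: lerD.
    by apply: le_trans kP; apply: LP; exact: c_in.
  by near: t'.
(* For every [k], both [A L] and [L] are close to the iterate [Y k.+1]. *)
have LA t : `|t - s| <= d -> A L t = L t.
  move=> td; apply/eqP; rewrite -subr_eq0 -normr_le0.
  apply: (@half_pow_squeeze _ (C0 *+ 2)) => k.
  rewrite -(subrKA (Y k.+1 t)) (le_trans (ler_normD _ _))//.
  have h1 : `|A L t - Y k.+1 t| <= C0 *+ 2 / 2 ^+ k / 2.
    by apply: est => //; rewrite ?divr_ge0 ?mulrn_wge0 ?exprn_ge0// => u ud; exact: LP.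
  have h2 : `|Y k.+1 t - L t| <= C0 *+ 2 / 2 ^+ k / 2.
    by rewrite distrC (le_trans (LP _ td k.+1))// exprS invfM mulrCA mulrC.
  by rewrite (le_trans (lerD h1 h2))// -splitr.
have [As dA] := AP L gL.
(* [L] is controlled on the closed interval only, whereas [A L] is differentiable on a neighbourhood
   of it; hence the latter is the witness. *)
exists (A L); split=> // t td; last exact: A_cont.
have := dA t (d2 _ td); rewrite /F c_id//.
by rewrite -(LA t td).
Unshelve. all: by end_near. Qed.

End picard.

Section linear_ode.
Context {R : realType} {n : nat}.
Implicit Types (B Y : R -> 'M[R]_n) (s t : R).

(** Bootstrap: if [Y] is of class C^k then so is [Y B], which is the derivative of [Y]. *)
Lemma linear_ode_smooth B Y s :
  smooth_at B s -> (\forall t \near s, is_derive t (1 : R) Y (Y t *m B t)) ->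
  smooth_at Y s.
Proof.
move=> [U [oU Us] sB]; rewrite -nbhs_nearE nbhsE => -[U' [oU' Us'] dY].
exists (U `&` U'); first by split; [exact: openI|split].
have oI : open (U `&` U') by exact: openI.
have cB k : Ck k (U `&` U') B by apply: Ck_subset (sB k); exact: subIsetl.
elim=> [|k IH].
  by move=> t [_ /dY[d _]]; exact/differentiable_continuous/derivable1_diffP.
apply: CkS => // v; exists (fun t => v *: (Y t *m B t)).
  move=> t [_ /dY[d dE]].
  have dt : differentiable Y t by exact/derivable1_diffP.
  split; first exact: diff_derivable.
  by rewrite -dE !deriveE// -[in LHS](mulr1 v) [LHS]linearZ.
have cYB : Ck k (U `&` U') (fun t => Y t *m B t).
  rewrite (_ : (fun t => _) = fun t => \sum_(ij : 'I_n * 'I_n)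
     (\sum_(l < n) Y t ij.1 l * B t l ij.2) *: (delta_mx ij.1 ij.2 : 'M[R]_n)).
    apply: Ck_sum => // ij; apply: Ck_scale => //; last exact: Ck_cst.
    apply: Ck_sum => // l; apply: Ck_scale => //.
      by apply: (Ck_linear (l := entry ij.1 l)) => //; exact: coord_continuous.
    by apply: (Ck_linear (l := entry l ij.2)) => //; exact: coord_continuous.
  apply/funext => t; rewrite [LHS]matrix_sum_delta pair_bigA.
  by apply: eq_bigr => ij _; rewrite mxE.
by apply: Ck_scale => //; exact: Ck_cst.
Qed.

Lemma linear_ode_local B s : smooth_at B s ->
  exists Y, [/\ Y s = 1%:M, smooth_at Y s & \forall t \near s, 'D_1 Y t = Y t *m B t].
Proof.
move=> sB; have cB := smooth_at_near sB.
have : \forall t \near s, smooth_at B t /\ `|B t| <= `|B s| + 1.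
  near=> t; split; first by near: t.
  near: t; have /cvgrPdist_le/(_ _ ltr01) := smooth_at_continuous sB.
  apply: filterS => t; rewrite distrC => h.
  rewrite -[B t](subrK (B s)) addrC (le_trans (ler_normD _ _))//.
  by rewrite lerD2l.
case/nbhs_ballP => e /= e0 eP.
set b := `|B s| + 1 in eP; have b0 : 0 < b by rewrite ltr_wpDl.
(* [e / 2] keeps the closed interval inside the ball where [B] is bounded by [b]; the other bound
   gives the contraction constant 1/2, the [+ 1] keeping the divisor positive also when [n] is 0. *)
pose d := Num.min (e / 2) ((n%:R * b + 1)^-1 / 2).
have nb0 : 0 < n%:R * b + 1 by rewrite ltr_wpDl// mulr_ge0// ltW.
have d0 : 0 < d by rewrite lt_min !divr_gt0// invr_gt0.
have din t : `|t - s| <= d -> smooth_at B t /\ `|B t| <= b.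
  move=> td; apply: eP; rewrite -ball_normE/= distrC.
  apply: (le_lt_trans td); rewrite gt_min; apply/orP; left.
  by rewrite ltr_pdivrMr// mulr_natr mulr2n ltrDl.
have [|||||Y [Ys dY cY]] := @picard_solution R n B s d b.
- exact: d0.
- exact: ltW.
- by move=> t /din[/smooth_at_continuous].
- by move=> t /din[].
- apply: (@le_trans _ _ ((n%:R * b + 1) * ((n%:R * b + 1)^-1 / 2))).
    apply: ler_pM; [by rewrite mulr_ge0// ltW|exact: ltW|by rewrite lerDl|].
    by rewrite ge_min lexx orbT.
  by rewrite mulrA mulfV ?gt_eqF// mul1r.
have near_d : \forall t \near s, `|t - s| <= d.
  have /cvgrPdist_le/(_ _ d0) := @cvg_id _ (nbhs s).
  by apply: filterS => t; rewrite distrC.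
exists Y; split=> //.
  apply: linear_ode_smooth sB _.
  by apply: filterS near_d => t; exact: dY.
by apply: filterS near_d => t /dY[].
Unshelve. all: by end_near. Qed.

End linear_ode.

Section locally_constant.
Context {R : realType}.

Lemma derive0_constant m n (C : R -> 'M[R]_(m, n)) (a b : R) :
  a <= b -> (forall s, a <= s <= b -> is_derive s 1 C 0) -> C a = C b.
Proof.
move=> ab dC; apply/matrixP => i j.
have df s : s \in `[a, b] -> is_derive s 1 (fun t => C t i j) 0.
  rewrite in_itv/= => /dC h.
  have := is_derive_linear (@coord_continuous _ _ _ i j : continuous (entry i j)) h.
  by rewrite linear0.
have h1 s : s \in `]a, b[ -> is_derive s 1 (fun t => C t i j) 0.
  by move=> sab; apply: df; exact: subset_itv_oo_cc.
have h2 : {within `[a, b], continuous (fun t => C t i j)}.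
  by apply: derivable_within_continuous => s /df[].
have [c _] := MVT_segment ab h1 h2.
by rewrite mul0r => /eqP; rewrite subr_eq0 => /eqP ->.
Qed.

Lemma locally_constant m n (C : R -> 'M[R]_(m, n)) (a b : R) :
  a <= b -> (forall s, a <= s <= b -> \forall t \near s, C t = C s) -> C a = C b.
Proof.
move=> ab hC; apply: derive0_constant ab _ => s sab.
apply: (near_eq_is_derive _ (is_derive_cst (C s) s 1)).
near=> t; rewrite /cst; apply/esym; near: t; exact: hC.
Unshelve. all: by end_near. Qed.

End locally_constant.

(** * Gluing local frames of solutions along an interval *)

Section gluing.
Context {R : realType} {n : nat}.
(* [P Y s] stands for: near [s], the rows of [Y] are a frame of solutions of a
   linear differential equation. *)
Variable P : (R -> 'M[R]_n) -> R -> Prop.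
Hypothesis P_eq : forall Y Y' s, P Y s -> (\forall t \near s, Y t = Y' t) -> P Y' s.
Hypothesis P_near : forall Y s, P Y s -> \forall t \near s, P Y t.
Hypothesis P_mul : forall Y s C, P Y s -> C \in unitmx -> P (fun t => C *m Y t) s.
Hypothesis P_unit : forall Y s, P Y s -> Y s \in unitmx.
Hypothesis P_uniq : forall Y Y' s, P Y s -> P Y' s ->
  \forall t \near s, Y' t = (Y' s *m invmx (Y s)) *m Y t.

(** By [P_uniq] the quotient of two frames is locally constant, hence constant on the segment. *)
Lemma glue_unique (Y Y' : R -> 'M[R]_n) (a b : R) : a <= b ->
  (forall s, a <= s <= b -> P Y s /\ P Y' s) ->
  Y' a *m invmx (Y a) = Y' b *m invmx (Y b).
Proof.
move=> ab YY; apply: (locally_constant (C := fun t => Y' t *m invmx (Y t)) ab).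
move=> s /YY[PY PY']; have := P_uniq PY PY'; have := P_near PY.
apply: filterS2 => t /P_unit uY {1}->.
by rewrite mulmxK.
Qed.

(** Continuity method: [S] collects the end points that a frame starting at [a] can reach. A local
    frame at the supremum prolongs any frame that comes close enough to it, so the supremum is
    attained and equals [b]. *)
Lemma glue_segment (a b : R) : a <= b ->
  (forall s, a <= s <= b -> exists Y, P Y s) ->
  exists Y, forall s, a <= s <= b -> P Y s.
Proof.
move=> ab ex.
pose S : set R := [set x | a <= x <= b /\ exists Y, forall s, a <= s <= x -> P Y s].
have Sa : S a.
  split; first by rewrite lexx.
  have [|Y PY] := ex a; first by rewrite lexx.
  by exists Y => s sa; rewrite (le_anti sa : a = s) in PY *.
have Sb x : S x -> x <= b by move=> [/andP[]].
have supS : has_sup S by split; [exists a|exists b => x /Sb].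
pose m := sup S.
have am : a <= m by apply: ub_le_sup => //; case: supS.
have mb : m <= b by apply: ge_sup; [exists a|move=> x /Sb].
have [|Y0 PY0] := ex m; first by rewrite am.
have /nbhs_ballP[e /= e0 eP] := P_near PY0.
have [x Sx mx] := sup_adherent e0 supS.
have xm : x <= m by apply: ub_le_sup => //; case: supS.
have [/andP[ax xb] [Y PY]] := Sx.
have inB y : m - e < y -> y < m + e -> P Y0 y.
  by move=> h1 h2; apply: eP; rewrite -ball_normE/= distrC ltr_distl h1.
have PYx : P Y x by apply: PY; rewrite ax lexx.
have PY0x : P Y0 x by apply: inB => //; rewrite (le_lt_trans xm)// ltrDl.
(* [C] makes the local frame agree with [Y] at [x], hence near [x] by uniqueness; so the two pieces
   of [Z] join at [x] without losing [P]. *)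
pose C := Y x *m invmx (Y0 x).
have uC : C \in unitmx by rewrite unitmx_mul unitmx_inv !P_unit.
pose Z t := if t <= x then Y t else C *m Y0 t.
have PZ s : a <= s -> s < m + e -> P Z s.
  move=> as_ sme; have [sx|xs|sx] := ltgtP s x.
  - apply: (@P_eq Y); first by apply: PY; rewrite as_ ltW.
    near=> t; rewrite /Z ifT//; apply/ltW; near: t; exact: lt_nbhsl.
  - apply: (@P_eq (fun t => C *m Y0 t)).
      by apply: P_mul => //; apply: inB => //; exact: lt_trans mx xs.
    near=> t; rewrite /Z ifF//; apply/negbTE; rewrite -ltNge; near: t.
    exact: lt_nbhsr.
  - rewrite sx; apply: (@P_eq Y) => //.
    have := P_uniq PY0x PYx; apply: filterS => t YE; rewrite /Z; case: ifP => //.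
pose y := Num.min b (m + e / 2).
have Sy : S y.
  split.
    rewrite ge_min lexx/= andbT le_min ab/= (le_trans am)// lerDl.
    by rewrite ltW// divr_gt0.
  exists Z => s /andP[as_ sy]; apply: PZ => //; apply: (le_lt_trans sy).
  by rewrite gt_min ltrD2l ltr_pdivrMr// mulr_natr mulr2n ltrDl e0 orbT.
have ym : y <= m by apply: ub_le_sup => //; case: supS.
have yb : y = b.
  apply/min_idPl; rewrite leNgt; apply/negP => h.
  move: ym; rewrite /y (min_idPr (ltW h)) leNgt ltrDl divr_gt0//.
by have [_] := Sy; rewrite yb.
Unshelve. all: by end_near. Qed.

Let seg (t u : R) := Num.min 0 t <= u <= Num.max 0 t.

(** [I] may be open or unbounded, so a frame is built on the segment between 0 and [t] for each [t].
    Being normalised at 0, these frames agree wherever two of them are defined. *)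
Lemma glue_interval (I : interval R) : 0 \in I ->
  (forall s, s \in I -> exists Y, P Y s) ->
  exists Y, Y 0 = 1%:M /\ forall s, s \in I -> P Y s.
Proof.
move=> I0 ex.
have seg0 t : seg t 0 by rewrite /seg ge_min le_max lexx.
have segt t : seg t t by rewrite /seg ge_min le_max lexx !orbT.
have segI s u : s \in I -> seg s u -> u \in I.
  move=> sI; rewrite /seg; case: (leP 0 s) => s0 us.
    exact: (interval_is_interval I0 sI).
  exact: (interval_is_interval sI I0).
have uniq (t : R) (Y Y' : R -> 'M[R]_n) : Y 0 = 1%:M -> Y' 0 = 1%:M ->
    (forall u, seg t u -> P Y u) -> (forall u, seg t u -> P Y' u) -> Y' t = Y t.
  move=> Y0 Y'0 PY PY'.
  have uY : Y t \in unitmx by apply/P_unit/PY.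
  suff : Y' 0 *m invmx (Y 0) = Y' t *m invmx (Y t).
    by rewrite Y0 Y'0 mul1mx invmx1 => E; rewrite -[Y' t](mulmxKV uY) -E mul1mx.
  have [t0|t0] := leP 0 t.
    apply: (glue_unique t0) => s st.
    have ss : seg t s by rewrite /seg (min_idPl t0) (max_idPr t0).
    by split; [exact: PY|exact: PY'].
  apply/esym; apply: (glue_unique (ltW t0)) => s st.
  have ss : seg t s by rewrite /seg (min_idPr (ltW t0)) (max_idPl (ltW t0)).
  by split; [exact: PY|exact: PY'].
have H (t : R) : exists Y : R -> 'M[R]_n,
   (exists2 Y' : R -> 'M[R]_n, Y' 0 = 1%:M & forall u, seg t u -> P Y' u) ->
   Y 0 = 1%:M /\ forall u, seg t u -> P Y u.
  have [[Y' Y0 PY]|nY] := pselect (exists2 Y' : R -> 'M[R]_n,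
      Y' 0 = 1%:M & forall u, seg t u -> P Y' u).
    by exists Y'.
  by exists (fun=> 0) => /nY.
have [Y YP] := choice H.
have exY s : s \in I -> exists2 Y', Y' 0 = 1%:M & forall u, seg s u -> P Y' u.
  move=> sI; have [|s' ss|Y1 Y1P] := @glue_segment (Num.min 0 s) (Num.max 0 s).
  - by rewrite ge_min !le_max lexx.
  - exact/ex/(segI s).
  - have u0 : Y1 0 \in unitmx by apply/P_unit/Y1P/seg0.
    exists (fun t => invmx (Y1 0) *m Y1 t); first by rewrite mulVmx.
    by move=> u us; apply: P_mul; [exact: Y1P|rewrite unitmx_inv].
(* The value at [t] is read off the frame built for the segment between 0 and [t]. *)
exists (fun t => Y t t); split.
  by have [] := YP 0 (exY 0 I0).
move=> s sI; have [Y0 PY] := YP s (exY s sI).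
apply: (@P_eq (Y s)); first exact/PY/segt.
have /nbhs_ballP[e /= e0 eP] := P_near (PY _ (segt s)).
near=> t.
have ts : ball s e t by near: t; exact: nbhsx_ballx.
(* When [t] lies slightly beyond [s], the frame built for [s] still satisfies [P] as far as [t],
   because [P] is an open condition; so it can be compared with the frame built for [t]. *)
have PYt u : seg t u -> P (Y s) u.
  move=> ut; have [us|us] := boolP (seg s u); first exact: PY.
  apply: eP; move: ts ut us; rewrite -ball_normE/= !ltr_distl /seg.
  by case: (leP 0 t) => t0; case: (leP 0 s) => s0; rewrite negb_and -!ltNge; lra.
have [Yt0 PYt'] := YP t (ex_intro2 _ _ (Y s) Y0 PYt).
exact: uniq Yt0 Y0 PYt' PYt.
Unshelve. all: by end_near. Qed.

End gluing.

Section linear_ode_frames.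
Context {R : realType} {n : nat}.
Implicit Types (B Y : R -> 'M[R]_n) (s t : R).

Lemma near_derive0_constant m p (C : R -> 'M[R]_(m, p)) s :
  (\forall t \near s, is_derive t (1 : R) C 0) -> \forall t \near s, C t = C s.
Proof.
case/nbhs_ballP => e /= e0 eP.
have : \forall t \near s, ball s e t by exact: nbhsx_ballx.
apply: filterS => t; rewrite -ball_normE/= ltr_distl => st.
have [ts|/ltW ts] := leP t s.
  apply: (derive0_constant ts) => u us; apply: eP.
  by rewrite -ball_normE/= ltr_distl; lra.
apply/esym; apply: (derive0_constant ts) => u us; apply: eP.
by rewrite -ball_normE/= ltr_distl; lra.
Qed.

(** The quotient of the two frames has zero derivative, the two contributions of [B] cancelling. *)
Lemma linear_ode_unique B Y Y' s :
  smooth_at Y s -> smooth_at Y' s -> Y s \in unitmx ->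
  (\forall t \near s, 'D_1 Y t = Y t *m B t) ->
  (\forall t \near s, 'D_1 Y' t = Y' t *m B t) ->
  \forall t \near s, Y' t = (Y' s *m invmx (Y s)) *m Y t.
Proof.
move=> sY sY' uY dY dY'.
have uYn := unitmx_near findim_real uY sY.
have : \forall t \near s, is_derive t (1 : R) (fun t => Y' t *m invmx (Y t)) 0.
  have sYn := smooth_at_near sY; have sYn' := smooth_at_near sY'.
  near=> t.
  have ut : Y t \in unitmx by near: t.
  have st : smooth_at Y t by near: t.
  have st' : smooth_at Y' t by near: t.
  have si := smooth_at_invmx findim_real ut st.
  have E : 'D_1 (fun t => Y' t *m invmx (Y t)) t = 0.
    rewrite derive_mulmx// derive_invmx//.
    have -> : 'D_1 Y t = Y t *m B t by near: t.
    have -> : 'D_1 Y' t = Y' t *m B t by near: t.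
    by rewrite mulKmx// mulmxN mulmxA addNr.
  by rewrite -E; apply: smooth_at_is_derive; exact: smooth_at_mulmx.
move=> /near_derive0_constant; apply: filterS2 uYn => t ut /= <-.
by rewrite mulmxKV.
Unshelve. all: by end_near. Qed.

Lemma linear_ode_interval B (I : interval R) : 0 \in I ->
  (forall s, s \in I -> smooth_at B s) ->
  exists Y, Y 0 = 1%:M /\ forall s, s \in I ->
    [/\ smooth_at Y s, \forall t \near s, 'D_1 Y t = Y t *m B t & Y s \in unitmx].
Proof.
move=> I0 sB.
apply: (glue_interval (P := fun Y s => [/\ smooth_at Y s,
  \forall t \near s, 'D_1 Y t = Y t *m B t & Y s \in unitmx])) => //.
- move=> Y Y' s [sY dY uY] YY'; split.
  + exact: smooth_at_eq YY' sY.
  + have := near_join YY'; apply: filterS2 dY => t dY YY't.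
    by rewrite -(nbhs_singleton YY't) -(near_eq_derive _ YY't).
  + by rewrite -(nbhs_singleton YY').
- move=> Y s [sY dY uY]; have := near_join dY.
  by apply: filterS3 (smooth_at_near sY) (unitmx_near findim_real uY sY) => t.
- move=> Y s C [sY dY uY] uC; split.
  + by apply: smooth_at_mulmx => //; exact: smooth_at_cst.
  + apply: filterS2 (smooth_at_near sY) dY => t sYt dYt.
    rewrite derive_mulmx//; last exact: smooth_at_cst.
    by rewrite derive_cst mul0mx addr0 dYt mulmxA.
  + by rewrite unitmx_mul uC uY.
- by move=> Y s [].
- by move=> Y Y' s [sY dY uY] [sY' dY' _]; exact: linear_ode_unique dY dY'.
move=> s /sB/linear_ode_local[Y [Ys sY dY]]; exists Y; split=> //.
by rewrite Ys unitmx1.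
Qed.

End linear_ode_frames.

(** The tool for the singularity at parameter 0: both Jacobi fields and the matrix solution vanish
    there, and only their quotients by [s] have informative limits. *)
Lemma quotient_cvg {R : realType} {W : normedModType R} (F : R -> W) :
  smooth_at F 0 -> F 0 = 0 -> s^-1 *: F s @[s --> 0^'+] --> 'D_1 F 0.
Proof.
move=> sF F0; apply: cvg_dnbhs_at_right.
have [dF _] := smooth_at_is_derive (1 : R) sF.
have E : (fun h : R => h^-1 *: ((F \o shift 0) (h *: (1 : R)) - F 0)) = (fun s => s^-1 *: F s).
  by apply/funext => h; rewrite /= F0 subr0 addr0 [h *: 1]mulr1.
by move: dF; rewrite /derivable /derive E.
Qed.

(** * Product rules for maps that are linear in moving arguments *)

Section moving_arguments.
Context {R : realType} {E V W : normedModType R} {p : nat}.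
Hypotheses (fE : findim E) (fV : findim V) (fW : findim W).

Lemma linear_row_expand (l : 'rV[R]_p -> W) (v : 'rV[R]_p) : linear l ->
  l v = \sum_j v 0 j *: l (delta_mx 0 j).
Proof.
move=> ll; pose L : {linear 'rV[R]_p -> W} := HB.pack l (GRing.isLinear.Build _ _ _ _ l ll).
by rewrite {1}[v]row_sum_delta -[l]/(L : _ -> _) linear_sum; apply: eq_bigr => j _; rewrite linearZ.
Qed.

Variables (A : V -> 'rV[R]_p -> W) (f : E -> V) (u : E -> 'rV[R]_p) (z : E).
Hypothesis linA : \forall y \near f z, linear (A y).
Hypothesis sA : forall v, smooth_at (fun y => A y v) (f z).
Hypothesis sf : smooth_at f z.
Hypothesis su : smooth_at u z.

Let suj j : smooth_at (fun y => u y 0 j) z.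
Proof. by move/(smooth_at_mxP fE): su; apply. Qed.

Let sAf j : smooth_at (fun y => A (f y) (delta_mx 0 j)) z.
Proof. by apply: (smooth_at_comp (f := fun y => A y (delta_mx 0 j))). Qed.

Let expand : \forall y \near z,
  \sum_j u y 0 j *: A (f y) (delta_mx 0 j) = A (f y) (u y).
Proof.
have h : \forall y \near z, linear (A (f y)) by exact: (smooth_at_continuous sf linA).
by apply: filterS h => y ll; rewrite -linear_row_expand.
Qed.

Lemma smooth_at_linear_field : smooth_at (fun y => A (f y) (u y)) z.
Proof.
apply: (smooth_at_eq expand); apply: smooth_at_sum => j.
exact: smooth_at_scale.
Qed.

(** [A] is smooth in the base point for each fixed vector. Expanding [u] in the standard basis
    trades the moving vector for fixed ones with smooth coefficients. *)
Lemma derive_linear_field d : 'D_d (fun y => A (f y) (u y)) z =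
  'D_('D_d f z) (fun y => A y (u z)) (f z) + A (f z) ('D_d u z).
Proof.
rewrite -(near_eq_derive d expand).
have dz j : is_derive z d (fun y => u y 0 j *: A (f y) (delta_mx 0 j))
  (u z 0 j *: 'D_('D_d f z) (fun y => A y (delta_mx 0 j)) (f z) +
   'D_d u z 0 j *: A (f z) (delta_mx 0 j)).
  rewrite derive_entry// -(derive_comp (f := fun y => A y (delta_mx 0 j)))//.
  exact: (is_derive_scale (smooth_at_is_derive d (suj j)) (smooth_at_is_derive d (sAf j))).
have [_ ->] := is_derive_fsum dz; rewrite big_split/=; congr (_ + _); last first.
  by rewrite -linear_row_expand//; exact: (nbhs_singleton linA).
have expand0 : \forall y \near f z, \sum_j u z 0 j *: A y (delta_mx 0 j) = A y (u z).
  by apply: filterS linA => y ll; rewrite -linear_row_expand.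
rewrite -(near_eq_derive _ expand0).
have dz' j : is_derive (f z) ('D_d f z) (fun y => u z 0 j *: A y (delta_mx 0 j))
   (u z 0 j *: 'D_('D_d f z) (fun y => A y (delta_mx 0 j)) (f z)).
  by apply: is_deriveZ; exact: smooth_at_is_derive.
by have [_ ->] := is_derive_fsum dz'.
Qed.

End moving_arguments.

Section moving_bilinear.
Context {R : realType} {E V W : normedModType R} {p q : nat}.
Hypotheses (fE : findim E) (fV : findim V) (fW : findim W).
Variables (A : V -> 'rV[R]_p -> 'rV[R]_q -> W) (f : E -> V)
  (u : E -> 'rV[R]_p) (v : E -> 'rV[R]_q) (z : E).
Hypothesis linA1 : \forall y \near f z, forall w, linear (fun x => A y x w).
Hypothesis linA2 : \forall y \near f z, forall x, linear (A y x).
Hypothesis sA : forall x w, smooth_at (fun y => A y x w) (f z).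
Hypothesis sf : smooth_at f z.
Hypothesis su : smooth_at u z.
Hypothesis sv : smooth_at v z.

Let svj j : smooth_at (fun y => v y 0 j) z.
Proof. by move/(smooth_at_mxP fE): sv; apply. Qed.

Let lin1 w : \forall y \near f z, linear (fun x => A y x w).
Proof. by apply: filterS linA1 => y. Qed.

Let sAu j : smooth_at (fun y => A (f y) (u y) (delta_mx 0 j)) z.
Proof. exact: (smooth_at_linear_field fE fV fW (lin1 _) (fun x => sA x _) sf su). Qed.

Let expand : \forall y \near z,
  \sum_j v y 0 j *: A (f y) (u y) (delta_mx 0 j) = A (f y) (u y) (v y).
Proof.
have h : \forall y \near z, forall x, linear (A (f y) x) by exact: (smooth_at_continuous sf linA2).
by apply: filterS h => y ll; rewrite -linear_row_expand.
Qed.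

Lemma smooth_at_bilinear_field : smooth_at (fun y => A (f y) (u y) (v y)) z.
Proof.
apply: (smooth_at_eq expand); apply: smooth_at_sum => j.
exact: smooth_at_scale.
Qed.

Lemma derive_bilinear_field d : 'D_d (fun y => A (f y) (u y) (v y)) z =
  'D_('D_d f z) (fun y => A y (u z) (v z)) (f z) +
  A (f z) ('D_d u z) (v z) + A (f z) (u z) ('D_d v z).
Proof.
rewrite -(near_eq_derive d expand).
have dz j : is_derive z d (fun y => v y 0 j *: A (f y) (u y) (delta_mx 0 j))
  (v z 0 j *: ('D_('D_d f z) (fun y => A y (u z) (delta_mx 0 j)) (f z) +
     A (f z) ('D_d u z) (delta_mx 0 j)) +
   'D_d v z 0 j *: A (f z) (u z) (delta_mx 0 j)).
  rewrite derive_entry//.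
  rewrite -(derive_linear_field fE fV fW (lin1 _) (fun x => sA x _) sf su).
  exact: (is_derive_scale (smooth_at_is_derive d (svj j)) (smooth_at_is_derive d (sAu j))).
have [_ ->] := is_derive_fsum dz; rewrite big_split/=; congr (_ + _); last first.
  by rewrite -linear_row_expand//; exact: (nbhs_singleton linA2).
under eq_bigr do rewrite scalerDr.
rewrite big_split/=; congr (_ + _); last first.
  by rewrite -linear_row_expand//; exact: (nbhs_singleton linA2).
have expand0 : \forall y \near f z,
    \sum_j v z 0 j *: A y (u z) (delta_mx 0 j) = A y (u z) (v z).
  by apply: filterS linA2 => y ll; rewrite -linear_row_expand.
rewrite -(near_eq_derive _ expand0).
have dz' j : is_derive (f z) ('D_d f z) (fun y => v z 0 j *: A y (u z) (delta_mx 0 j))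
   (v z 0 j *: 'D_('D_d f z) (fun y => A y (u z) (delta_mx 0 j)) (f z)).
  by apply: is_deriveZ; exact: smooth_at_is_derive.
by have [_ ->] := is_derive_fsum dz'.
Qed.

End moving_bilinear.

(** * Riemannian geometry in a chart *)


Section mxform_theory.
Context {R : realType} {n : nat}.
Implicit Types (A : 'M[R]_n) (u v w : 'rV[R]_n).

Lemma mxformDl A u v w : mxform A (u + v) w = mxform A u w + mxform A v w.
Proof. by rewrite /mxform !mulmxDl mxE. Qed.

Lemma mxformZl A (a : R) u w : mxform A (a *: u) w = a * mxform A u w.
Proof. by rewrite /mxform -!scalemxAl mxE. Qed.

Lemma mxformDr A u v w : mxform A w (u + v) = mxform A w u + mxform A w v.
Proof. by rewrite /mxform linearD/= mulmxDr mxE. Qed.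

Lemma mxformZr A (a : R) u w : mxform A w (a *: u) = a * mxform A w u.
Proof. by rewrite /mxform linearZ/= -scalemxAr mxE. Qed.

Lemma mxform0l A w : mxform A 0 w = 0.
Proof. by rewrite /mxform !mul0mx mxE. Qed.

Lemma mxform0r A w : mxform A w 0 = 0.
Proof. by rewrite /mxform linear0 mulmx0 mxE. Qed.

Lemma mxformNl A u w : mxform A (- u) w = - mxform A u w.
Proof. by rewrite -scaleN1r mxformZl mulN1r. Qed.

Lemma mxformNr A u w : mxform A w (- u) = - mxform A w u.
Proof. by rewrite -scaleN1r mxformZr mulN1r. Qed.

Lemma mxform_linearl A w : linear (fun u => mxform A u w).
Proof. by move=> a u v; rewrite mxformDl mxformZl. Qed.

Lemma mxform_linearr A w : linear (mxform A w).
Proof. by move=> a u v; rewrite mxformDr mxformZr. Qed.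

Lemma mxform_delta A i j : mxform A (delta_mx 0 i) (delta_mx 0 j) = A i j.
Proof.
by rewrite /mxform -rowE trmx_delta -colE !mxE.
Qed.

Definition posdef A := (forall u v, mxform A u v = mxform A v u) /\
  (forall u, u != 0 -> 0 < mxform A u u).

Lemma posdef_unitmx A : posdef A -> A \in unitmx.
Proof.
move=> [_ pos]; rewrite -row_free_unit -kermx_eq0; apply/eqP/row_matrixP => i.
rewrite row0; apply/eqP/negPn/negP => /pos.
by rewrite /mxform -row_mul mulmx_ker row0 mul0mx mxE ltxx.
Qed.

Lemma posdef_inj A u v : posdef A -> (forall w, mxform A u w = mxform A v w) -> u = v.
Proof.
move=> [_ pos] uv; apply/eqP; rewrite -subr_eq0; apply/negPn/negP => /pos.
by rewrite [ltRHS]mxformDl mxformNl uv subrr ltxx.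
Qed.

End mxform_theory.

(** * Charts and their transition maps *)

Section manifold_axioms.
Context {R : realType} (M : manifold R).
Implicit Types (i j k : mf_idx M) (p : M) (x : 'rV[R]_(mf_dim M)).

Definition img i := mf_chart i @` mf_dom i.

Lemma mf_domO i : open (mf_dom i).
Proof. by case: M i. Qed.
Lemma imgO i : open (img i).
Proof. by rewrite /img; case: M i. Qed.
Lemma chartK i p : mf_dom i p -> mf_inv i (mf_chart i p) = p.
Proof. by case: M i p. Qed.
Lemma inv_continuous i x : img i x -> {for x, continuous (mf_inv i)}.
Proof. by rewrite /img; case: M i x. Qed.
Lemma mf_at_dom p : mf_dom (mf_at p) p.
Proof. by case: M p. Qed.
Lemma transition_smooth_on i j :
  smooth_on (mf_chart i @` (mf_dom i `&` mf_dom j)) (transition i j).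
Proof. by rewrite /transition; case: M i j. Qed.

Lemma img_chart i p : mf_dom i p -> img i (mf_chart i p).
Proof. by move=> ip; exists p. Qed.

(** Charts and transitions are total functions that are meaningful only on their domains. Identities
    between them hold near a point of the overlap, which is enough to differentiate them. *)
Lemma near_overlap i j p : mf_dom i p -> mf_dom j p ->
  \forall x \near mf_chart i p, exists2 q, mf_dom i q /\ mf_dom j q & mf_chart i q = x.
Proof.
move=> ip jp.
have h1 : \forall x \near mf_chart i p, img i x.
  by apply: open_nbhs_nbhs; split; [exact: imgO|exact: img_chart].
have h2 : \forall x \near mf_chart i p, mf_dom j (mf_inv i x).
  apply: (inv_continuous (img_chart ip)); rewrite chartK//.
  by apply: open_nbhs_nbhs; split; [exact: mf_domO|].
apply: filterS2 h1 h2 => x [q iq <-]; rewrite chartK// => jq.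
by exists q.
Qed.

Lemma transition_smooth i j p : mf_dom i p -> mf_dom j p ->
  smooth_at (transition i j) (mf_chart i p).
Proof.
move=> ip jp; have := near_overlap ip jp; rewrite -nbhs_nearE nbhsE => -[U [oU Up] h].
apply: (smooth_onP oU Up) => k.
apply: Ck_subset (transition_smooth_on i j k) => x /h[q [iq jq] <-].
by exists q.
Qed.

Lemma transition_chart i j p : mf_dom i p -> transition i j (mf_chart i p) = mf_chart j p.
Proof. by move=> ip; rewrite /transition chartK. Qed.

(** The differential of the change of charts at [p]: it carries tangent components from chart [i] to
    chart [j]. *)
Definition dtr i j p (v : 'rV[R]_(mf_dim M)) : 'rV[R]_(mf_dim M) :=
  'D_v (transition i j) (mf_chart i p).

Lemma dtr_linear i j p : mf_dom i p -> mf_dom j p -> linear (dtr i j p).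
Proof. by move=> ip jp; apply: smooth_at_linearP => //; exact: transition_smooth. Qed.

Lemma dtr_id i p v : mf_dom i p -> dtr i i p v = v.
Proof.
move=> ip; rewrite /dtr -[RHS](derive_id (mf_chart i p) v).
apply: near_eq_derive; apply: filterS (near_overlap ip ip) => x [q [iq _] <-].
exact: transition_chart.
Qed.

Lemma dtr_comp i j k p v : mf_dom i p -> mf_dom j p -> mf_dom k p ->
  dtr j k p (dtr i j p v) = dtr i k p v.
Proof.
move=> ip jp kp; rewrite /dtr -{1}(transition_chart j ip) -derive_comp//.
- apply: near_eq_derive; apply: filterS (near_overlap ip jp) => x [q [iq jq] <-].
  by rewrite !transition_chart.
- by rewrite transition_chart//; exact: transition_smooth.
- exact: transition_smooth.
Qed.

Lemma dtr0 i j p : mf_dom i p -> mf_dom j p -> dtr i j p 0 = 0.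
Proof. by rewrite /dtr derive0. Qed.

Lemma dtrD i j p u v : mf_dom i p -> mf_dom j p ->
  dtr i j p (u + v) = dtr i j p u + dtr i j p v.
Proof. by move=> ip jp; have := dtr_linear ip jp 1 u v; rewrite !scale1r. Qed.

Lemma dtrZ i j p a v : mf_dom i p -> mf_dom j p ->
  dtr i j p (a *: v) = a *: dtr i j p v.
Proof.
move=> ip jp; have := dtr_linear ip jp a v 0.
by rewrite addr0 dtr0// addr0.
Qed.

End manifold_axioms.

Section riemannian_local.
Context {R : realType} (M : riemannian R).
Local Notation T := 'rV[R]_(mf_dim M).
Implicit Types (i j : mf_idx M) (p : M) (x u v w : T).

Lemma rm_smooth_on i : smooth_on (img i) (@rm_mx _ M i).
Proof. by rewrite /img; case: M i. Qed.
Lemma rm_posdef i x : img i x -> posdef (rm_mx i x).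
Proof.
rewrite /img; case: M i x => b m /= _ sy po _ i x ix.
by split=> [u v|u]; [exact: sy|exact: po].
Qed.
Lemma rm_transition i j p u v : mf_dom i p -> mf_dom j p ->
  mxform (rm_mx i (mf_chart i p)) u v =
  mxform (rm_mx j (mf_chart j p)) (dtr i j p u) (dtr i j p v).
Proof. by rewrite /dtr; case: M i j p u v => /= ? ? ? ? ? H *; exact: H. Qed.

Lemma near_img i x : img i x -> \forall y \near x, img i y.
Proof. by move=> ix; apply: open_nbhs_nbhs; split; [exact: imgO|]. Qed.

Lemma rm_smooth i x : img i x -> smooth_at (rm_mx i) x.
Proof. by move=> ix; exists (img i); [split=> //; exact: imgO|exact: rm_smooth_on]. Qed.

Definition gform i u v x : R := mxform (rm_mx i x) u v.

Lemma smooth_at_gform i u v x : img i x -> smooth_at (gform i u v) x.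
Proof.
move=> ix; have h : smooth_at (fun y => u *m rm_mx i y *m v^T) x.
  apply: smooth_at_mulmx => //; last exact: smooth_at_cst.
  by apply: smooth_at_mulmx => //; [exact: smooth_at_cst|exact: rm_smooth].
by move/(smooth_at_mxP (findim_mx _ _)): h; apply.
Qed.

Lemma gform_sym i u v x : img i x -> gform i u v x = gform i v u x.
Proof. by move=> /rm_posdef[h _]; exact: h. Qed.

Lemma derive_gform_linearr i u w x : img i x -> linear (fun v => 'D_w (gform i u v) x).
Proof.
move=> ix a v v'.
have s1 := smooth_at_gform u v ix; have s2 := smooth_at_gform u v' ix.
have [_ <-] := is_deriveD (is_deriveZ a (smooth_at_is_derive w s1)) (smooth_at_is_derive w s2).
congr ('D_w _ x); apply/funext => y.
by rewrite /gform mxformDr mxformZr.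
Qed.

(** Pairing with a vector cancels the inverse metric in [christoffel]; linearity in [w] then extends
    the Koszul formula from coordinate vectors to all [w]. *)
Lemma mxform_christoffel i x u v w : img i x ->
  mxform (rm_mx i x) (christoffel i x u v) w =
  2^-1 * ('D_u (gform i v w) x + 'D_v (gform i u w) x - 'D_w (gform i u v) x).
Proof.
move=> ix; rewrite /mxform /christoffel mulmxKV; last exact/posdef_unitmx/rm_posdef.
rewrite -scalemxAl mxE; congr (_ * _); rewrite mxE.
rewrite (linear_row_expand w (derive_gform_linearr v u ix)).
rewrite (linear_row_expand w (derive_gform_linearr u v ix)).
have lD : linear (fun w => 'D_w (gform i u v) x).
  by apply: smooth_at_linearP => //; exact: smooth_at_gform.
rewrite (linear_row_expand w lD) -big_split -sumrB/=; apply: eq_bigr => l _.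
by rewrite !mxE mulrC mulrBr mulrDr.
Qed.

Lemma smooth_at_christoffel i x u v : img i x ->
  smooth_at (fun y => christoffel i y u v) x.
Proof.
move=> ix; apply: smooth_at_mulmx => //; last first.
  by apply: smooth_at_invmx => //; [exact/posdef_unitmx/rm_posdef|exact: rm_smooth].
apply: smooth_at_scale => //; first exact: smooth_at_cst.
apply/smooth_at_mxP => // k l.
rewrite (_ : (fun y => _) = fun y => 'D_u (gform i v (delta_mx 0 l)) y +
   'D_v (gform i u (delta_mx 0 l)) y - 'D_(delta_mx 0 l) (gform i u v) y).
  by apply: smooth_atB; [apply: smooth_atD|]; apply: smooth_at_derive; exact: smooth_at_gform.
by apply/funext => y; rewrite mxE.
Qed.

Lemma christoffel_sym i x u v : img i x -> christoffel i x u v = christoffel i x v u.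
Proof.
move=> ix; apply: (posdef_inj (rm_posdef ix)) => w.
rewrite !mxform_christoffel//; congr (_ * (_ - _)); first exact: addrC.
apply: near_eq_derive; apply: filterS (near_img ix) => y iy.
exact: gform_sym.
Qed.

Lemma christoffel_linearr i x u : img i x -> linear (christoffel i x u).
Proof.
move=> ix a v v'; apply: (posdef_inj (rm_posdef ix)) => w.
rewrite mxformDl mxformZl !mxform_christoffel//.
have lw : linear (fun v => 'D_u (gform i v w) x).
  move=> b y y'; have := derive_gform_linearr w u ix b y y'.
  have E z : 'D_u (gform i z w) x = 'D_u (gform i w z) x.
    apply: near_eq_derive; apply: filterS (near_img ix) => t it.
    exact: gform_sym.
  by rewrite !E.
have lD : linear (fun v => 'D_v (gform i u w) x).
  by apply: smooth_at_linearP => //; exact: smooth_at_gform.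
have e1 : 'D_u (gform i (a *: v + v') w) x = a * 'D_u (gform i v w) x + 'D_u (gform i v' w) x.
  exact: lw.
have e2 : 'D_(a *: v + v') (gform i u w) x = a * 'D_v (gform i u w) x + 'D_v' (gform i u w) x.
  exact: lD.
have e3 : 'D_w (gform i u (a *: v + v')) x = a * 'D_w (gform i u v) x + 'D_w (gform i u v') x.
  exact: derive_gform_linearr.
rewrite e1 e2 e3; ring.
Qed.

Lemma christoffel_linearl i x v : img i x -> linear (christoffel i x ^~ v).
Proof.
move=> ix a u u'; have h := christoffel_linearr v ix a u u'.
by rewrite /= (christoffel_sym _ v ix) (christoffel_sym u v ix) (christoffel_sym u' v ix).
Qed.

Lemma christoffelDr i x u v v' : img i x ->
  christoffel i x u (v + v') = christoffel i x u v + christoffel i x u v'.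
Proof. by move=> ix; have := christoffel_linearr u ix 1 v v'; rewrite !scale1r. Qed.

Lemma christoffelDl i x u u' v : img i x ->
  christoffel i x (u + u') v = christoffel i x u v + christoffel i x u' v.
Proof. by move=> ix; have := christoffel_linearl v ix 1 u u'; rewrite /= !scale1r. Qed.

Lemma metric_compatible i x u v w : img i x ->
  'D_w (gform i u v) x = mxform (rm_mx i x) (christoffel i x w u) v +
                         mxform (rm_mx i x) u (christoffel i x w v).
Proof.
move=> ix; rewrite -[mxform _ u _](gform_sym _ _ ix) /gform !mxform_christoffel//.
have -> : 'D_w (gform i v u) x = 'D_w (gform i u v) x.
  apply: near_eq_derive; apply: filterS (near_img ix) => y iy; exact: gform_sym.
set a := 'D_w _ x; set b := 'D_u _ x; set c := 'D_v _ x; by field.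
Qed.

End riemannian_local.

Local Opaque derive christoffel.

Section covariant_local.
Context {R : realType} (M : riemannian R) {E : normedModType R}.
Hypothesis fE : findim E.
Local Notation T := 'rV[R]_(mf_dim M).
Implicit Types (i j : mf_idx M) (p : M) (d e z : E) (x y : E -> T).

(** Covariant derivative in the direction [d] of the field [y] along the map [x], in the coordinates
    of chart [i]. The source is left general: the line for curves, the plane for variations, and the
    coordinate space itself with [x = id]. *)
Definition cov i x y d : E -> T :=
  fun z => 'D_d y z + christoffel i (x z) ('D_d x z) (y z).

Lemma smooth_at_img i x z : smooth_at x z -> img i (x z) ->
  \forall t \near z, img i (x t).
Proof. by move=> sx ix; exact: (smooth_at_continuous sx (near_img ix)). Qed.

Lemma smooth_at_christoffel_field i x y y' z :
  smooth_at x z -> img i (x z) -> smooth_at y z -> smooth_at y' z ->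
  smooth_at (fun t => christoffel i (x t) (y t) (y' t)) z.
Proof.
move=> sx ix sy sy'.
apply: (smooth_at_bilinear_field fE (findim_mx _ _) _ (A := christoffel i)) => //.
- by apply: filterS (near_img ix) => t it w; exact: christoffel_linearl.
- by apply: filterS (near_img ix) => t it w; exact: christoffel_linearr.
- by move=> u w; exact: smooth_at_christoffel.
Qed.

Lemma derive_christoffel_field i x y y' z d :
  smooth_at x z -> img i (x z) -> smooth_at y z -> smooth_at y' z ->
  'D_d (fun t => christoffel i (x t) (y t) (y' t)) z =
  'D_('D_d x z) (fun t => christoffel i t (y z) (y' z)) (x z) +
  christoffel i (x z) ('D_d y z) (y' z) + christoffel i (x z) (y z) ('D_d y' z).
Proof.
move=> sx ix sy sy'.
apply: (derive_bilinear_field fE (findim_mx _ _) _ (A := christoffel i)) => //.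
- by apply: filterS (near_img ix) => t it w; exact: christoffel_linearl.
- by apply: filterS (near_img ix) => t it w; exact: christoffel_linearr.
- by move=> u w; exact: smooth_at_christoffel.
Qed.

Lemma smooth_at_cov i x y d z : smooth_at x z -> img i (x z) -> smooth_at y z ->
  smooth_at (cov i x y d) z.
Proof.
move=> sx ix sy; apply: smooth_atD; first exact: smooth_at_derive.
by apply: smooth_at_christoffel_field => //; exact: smooth_at_derive.
Qed.

Lemma smooth_at_metric_field i x y y' z :
  smooth_at x z -> img i (x z) -> smooth_at y z -> smooth_at y' z ->
  smooth_at (fun t => mxform (rm_mx i (x t)) (y t) (y' t)) z.
Proof.
move=> sx ix sy sy'.
apply: (smooth_at_bilinear_field fE (findim_mx _ _) _
  (A := fun t u v => mxform (rm_mx i t) u v)) => //.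
- by near=> t => w; exact: mxform_linearl.
- by near=> t => w; exact: mxform_linearr.
- by move=> u w; exact: smooth_at_gform.
Unshelve. all: by end_near. Qed.

Lemma derive_metric_field i x y y' z d :
  smooth_at x z -> img i (x z) -> smooth_at y z -> smooth_at y' z ->
  'D_d (fun t => mxform (rm_mx i (x t)) (y t) (y' t)) z =
  mxform (rm_mx i (x z)) (cov i x y d z) (y' z) +
  mxform (rm_mx i (x z)) (y z) (cov i x y' d z).
Proof.
move=> sx ix sy sy'.
rewrite (derive_bilinear_field fE (findim_mx _ _) _
  (A := fun t u v => mxform (rm_mx i t) u v)) //.
- rewrite (metric_compatible (y z) (y' z) _ ix) /cov mxformDl mxformDr; ring.
- by near=> t => w; exact: mxform_linearl.
- by near=> t => w; exact: mxform_linearr.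
- by move=> u w; exact: smooth_at_gform.
Unshelve. all: by end_near. Qed.

(** The bracket of constant fields is 0, which leaves [D_v D_u w - D_u D_v w] in the sign convention
    of [curvature_loc]. *)
Lemma curvature_locE i (x u v w : T) : img i x ->
  curvature_loc i x u v w =
  'D_v (fun t => christoffel i t u w) x + christoffel i x v (christoffel i x u w)
  - ('D_u (fun t => christoffel i t v w) x + christoffel i x u (christoffel i x v w)).
Proof.
move=> ix.
have E1 (a : T) : covD_loc i (cst a) (cst w) = (fun t => christoffel i t a w).
  by apply/funext => t; rewrite /covD_loc derive_cst add0r.
have E2 : bracket_loc (cst u) (cst v) x = 0.
  by rewrite /bracket_loc !derive_cst subrr.
have E3 : covD_loc i (bracket_loc (cst u) (cst v)) (cst w) x = 0.
  have h0 : christoffel i x 0 w = 0.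
    have := christoffelDl 0 0 w ix; rewrite addr0 => /eqP.
    by rewrite -subr_eq0 opprD addrA subrr sub0r oppr_eq0 => /eqP.
  by rewrite /covD_loc E2 derive0 add0r.
rewrite /curvature_loc; move: E1 E3; move: (cst w) => W E1 E3.
by rewrite E3 (E1 u) (E1 v) sub0r addrC /covD_loc.
Qed.

(** The second derivatives of [x] and of [y] are symmetric and cancel; what remains is the
    curvature. Skew-symmetry, chart invariance and smoothness of the curvature and the Jacobi
    equation are all drawn from this identity. *)
Lemma covariant_commute i x y z d e :
  smooth_at x z -> img i (x z) -> smooth_at y z ->
  cov i x (cov i x y d) e z - cov i x (cov i x y e) d z =
  curvature_loc i (x z) ('D_d x z) ('D_e x z) (y z).
Proof.
move=> sx ix sy; rewrite (curvature_locE _ _ _ ix).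
have D2 d' e' : 'D_e' (cov i x y d') z = 'D_e' (fun t => 'D_d' y t) z +
   ('D_('D_e' x z) (fun t => christoffel i t ('D_d' x z) (y z)) (x z) +
    christoffel i (x z) ('D_e' (fun t => 'D_d' x t) z) (y z) +
    christoffel i (x z) ('D_d' x z) ('D_e' y z)).
  have s1 : smooth_at (fun t => 'D_d' y t) z by exact: smooth_at_derive.
  have s3 : smooth_at (fun t => 'D_d' x t) z by exact: smooth_at_derive.
  have s2 := smooth_at_christoffel_field sx ix s3 sy.
  have [_ ->] := is_deriveD (smooth_at_is_derive e' s1) (smooth_at_is_derive e' s2).
  by rewrite (derive_christoffel_field e' sx ix s3 sy).
have exp d' e' : cov i x (cov i x y d') e' z =
   'D_('D_e' x z) (fun t => christoffel i t ('D_d' x z) (y z)) (x z) +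
   christoffel i (x z) ('D_e' x z) (christoffel i (x z) ('D_d' x z) (y z)) +
   ('D_e' (fun t => 'D_d' y t) z + christoffel i (x z) ('D_e' (fun t => 'D_d' x t) z) (y z)
    + (christoffel i (x z) ('D_d' x z) ('D_e' y z) + christoffel i (x z) ('D_e' x z) ('D_d' y z))).
  have alg (a b c a1 a2 a3 : T) :
      a + (b + a1 + a2) + (a3 + c) = b + c + (a + a1 + (a2 + a3)).
    by apply/rowP => k; rewrite !mxE; ring.
  apply: (etrans _ (alg _ _ _ _ _ _)).
  by rewrite -D2 -christoffelDr.
apply: (etrans (congr2 (fun a b : T => a - b) (exp d e) (exp e d))).
have -> : 'D_e (fun t => 'D_d y t) z = 'D_d (fun t => 'D_e y t) z.
  exact: (schwarz d e (findim_mx _ _) sy).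
have -> : 'D_e (fun t => 'D_d x t) z = 'D_d (fun t => 'D_e x t) z.
  exact: (schwarz d e (findim_mx _ _) sx).
have alg (a b a' b' p q r r' : T) :
    a + b + (p + q + (r + r')) - (a' + b' + (p + q + (r' + r))) = a + b - (a' + b').
  by apply/rowP => k; rewrite !mxE; ring.
exact: alg.
Qed.

End covariant_local.

Local Opaque curvature_loc.

Section cov_rules.
Context {R : realType} (M : riemannian R) {E : normedModType R}.
Hypothesis fE : findim E.
Local Notation T := 'rV[R]_(mf_dim M).
Implicit Types (i j : mf_idx M) (p : M) (d e z : E) (x y : E -> T).

Lemma cov_eq i x y y' d z : (\forall t \near z, y t = y' t) ->
  cov i x y d z = cov i x y' d z.
Proof.
by move=> yy'; rewrite /cov (near_eq_derive d yy') (nbhs_singleton yy').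
Qed.

End cov_rules.

(** * Symmetries of the curvature tensor *)

Section curvature_symmetries.
Context {R : realType} (M : riemannian R).
Local Notation T := 'rV[R]_(mf_dim M).
Implicit Types (i j : mf_idx M) (p : M) (x u v w : T).

(** The mixed second derivatives of the inner product of the constant fields [w] and [w'] agree.
    Expanded by compatibility with the metric, their mixed terms cancel, and the commutators left
    over are curvatures. *)
Lemma curvature_skew i x u v w w' : img i x ->
  mxform (rm_mx i x) (curvature_loc i x u v w) w' +
  mxform (rm_mx i x) w (curvature_loc i x u v w') = 0.
Proof.
move=> ix; have sid := @smooth_at_id R T x.
have sc (a t : T) : smooth_at (cst a) t := smooth_at_cst a t.
have Did (a t : T) : 'D_a id t = a by rewrite derive_id.
have comm a := covariant_commute (findim_mx _ _) u v sid ix (sc a x).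
rewrite !Did in comm.
have C a b : smooth_at (cov i id (cst b) a) x.
  exact: (smooth_at_cov (findim_mx _ _)).
have D1 a : \forall t \near x, 'D_a (gform i w w') t =
    mxform (rm_mx i t) (cov i id (cst w) a t) w' +
    mxform (rm_mx i t) w (cov i id (cst w') a t).
  apply: filterS (near_img ix) => t it.
  exact: (derive_metric_field (findim_mx _ _) a (smooth_at_id t) it (sc w t) (sc w' t)).
have D2 a b : 'D_b (fun t => 'D_a (gform i w w') t) x =
    mxform (rm_mx i x) (cov i id (cov i id (cst w) a) b x) w' +
    mxform (rm_mx i x) (cov i id (cst w) a x) (cov i id (cst w') b x) +
    (mxform (rm_mx i x) (cov i id (cst w) b x) (cov i id (cst w') a x) +
     mxform (rm_mx i x) w (cov i id (cov i id (cst w') a) b x)).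
  rewrite (near_eq_derive b (D1 a)).
  have s1 := smooth_at_metric_field (findim_mx _ _) sid ix (C a w) (sc w' x).
  have s2 := smooth_at_metric_field (findim_mx _ _) sid ix (sc w x) (C a w').
  have [_ ->] := is_deriveD (smooth_at_is_derive b s1) (smooth_at_is_derive b s2).
  rewrite (derive_metric_field (findim_mx _ _) b sid ix (C a w) (sc w' x)).
  by rewrite (derive_metric_field (findim_mx _ _) b sid ix (sc w x) (C a w')).
have S := schwarz u v findim_real (smooth_at_gform w w' ix).
rewrite (D2 u v) (D2 v u) in S.
rewrite -!comm mxformDl mxformDr mxformNl mxformNr.
move: S => /eqP; rewrite -subr_eq0 => /eqP <-.
have alg (a b c a' b' c' : R) : a - a' + (c - c') = a + b + (b' + c) - (a' + b' + (b + c')).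
  by ring.
exact: alg.
Qed.

Lemma curvature_antisym i x u v w : img i x ->
  curvature_loc i x u v w = - curvature_loc i x v u w.
Proof. by move=> ix; rewrite !(curvature_locE _ _ _ ix) opprB. Qed.

(** The curvature is [K v u w - K u v w] for some [K] symmetric in its last two arguments, so the
    cyclic sum cancels term by term. *)
Lemma curvature_bianchi i x u v w : img i x ->
  curvature_loc i x u v w + curvature_loc i x v w u + curvature_loc i x w u v = 0.
Proof.
move=> ix.
have [K [sK KE]] : exists K : T -> T -> T -> T, (forall a b c, K a b c = K a c b) /\
    forall a b c, curvature_loc i x a b c = K b a c - K a b c.
  exists (fun a b c => 'D_a (fun t => christoffel i t b c) x
                       + christoffel i x a (christoffel i x b c)).
  split=> a b c; last exact: curvature_locE.
  have h : \forall t \near x, christoffel i t b c = christoffel i t c b.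
    by apply: filterS (near_img ix) => t it; exact: christoffel_sym.
  apply: (congr2 +%R); first exact: near_eq_derive h.
  exact: (congr1 (christoffel i x a)) (christoffel_sym b c ix).
rewrite !KE (sK u w v) (sK v u w) (sK w v u).
have alg (a b c : T) : a - b + (c - a) + (b - c) = 0.
  by apply/rowP => k; rewrite !mxE; ring.
exact: alg.
Qed.

(** This is pair symmetry with a repeated vector. A single Bianchi identity then suffices, since one
    of its terms vanishes by skew-symmetry. It makes the Jacobi operator self-adjoint. *)
Lemma curvature_selfadjoint i x u v w : img i x ->
  mxform (rm_mx i x) (curvature_loc i x u v u) w =
  mxform (rm_mx i x) (curvature_loc i x u w u) v.
Proof.
move=> ix.
have [Q [skew anti bianchi QE]] : exists Q : T -> T -> T -> T -> R,
    [/\ forall a b c d, Q a b c d = - Q a b d c, forall a b c d, Q a b c d = - Q b a c d,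
      forall a b c d, Q a b c d + Q b c a d + Q c a b d = 0 &
      forall a b c d, mxform (rm_mx i x) (curvature_loc i x a b c) d = Q a b c d].
  exists (fun a b c d => mxform (rm_mx i x) (curvature_loc i x a b c) d); split=> a b c d.
  - apply/eqP; rewrite -addr_eq0; apply/eqP; have := curvature_skew a b c d ix.
    have [sym _] := rm_posdef ix.
    by rewrite (sym c (curvature_loc i x a b d)).
  - by rewrite (curvature_antisym _ _ _ ix) mxformNl.
  - by rewrite -2!mxformDl curvature_bianchi// mxform0l.
  - by [].
apply: (etrans (QE u v u w)); apply: (etrans _ (esym (QE u w u v))).
have z0 a b c : Q a b c c = 0.
  by have /eqP := skew a b c c; rewrite -addr_eq0 -mulr2n mulrn_eq0/= => /eqP.
have := bianchi u v w u; rewrite z0 addr0 => /eqP; rewrite addr_eq0 => /eqP E.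
by rewrite skew E opprK anti skew opprK.
Qed.

End curvature_symmetries.

Lemma sub_eq_oppr (V : zmodType) (a b c d : V) : c + d = a + b -> c - a = - (d - b).
Proof. by move=> h; apply: (addIr d); rewrite opprB subrK addrAC h addrAC subrr add0r. Qed.

(** * Independence of the chart *)

Section chart_invariance.
Context {R : realType} (M : riemannian R).
Local Notation T := 'rV[R]_(mf_dim M).
Implicit Types (i j : mf_idx M) (p : M) (u v w : T).

(** This is the uniqueness of the Levi-Civita connection: the connections of the two charts are both
    symmetric and compatible with the metric, which forces their difference to vanish. *)
Lemma christoffel_transition i j p u v : mf_dom i p -> mf_dom j p ->
  cov j (transition i j) (fun y => 'D_v (transition i j) y) u (mf_chart i p) =
  dtr i j p (christoffel i (mf_chart i p) u v).
Proof.
move=> ip jp; set x := mf_chart i p; set tr := transition i j.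
have ix : img i x := img_chart ip.
have trx : tr x = mf_chart j p := transition_chart j ip.
have jx : img j (tr x) by rewrite trx; exact: img_chart.
have str : smooth_at tr x := transition_smooth ip jp.
have sD w : smooth_at (fun y => 'D_w tr y) x := smooth_at_derive w str.
pose S a b := cov j tr (fun y => 'D_b tr y) a x - dtr i j p (christoffel i x a b).
(* [s] is symmetric in its first two arguments and skew in the last two. *)
pose s a b c := mxform (rm_mx j (tr x)) (S a b) (dtr i j p c).
have gij a b : mxform (rm_mx i x) a b = mxform (rm_mx j (tr x)) (dtr i j p a) (dtr i j p b).
  by rewrite trx; exact: rm_transition.
have gsym a b : mxform (rm_mx j (tr x)) a b = mxform (rm_mx j (tr x)) b a.
  by have [+ _] := rm_posdef jx; apply.
have sE a b c : s a b c =
    mxform (rm_mx j (tr x)) (cov j tr (fun y => 'D_b tr y) a x) (dtr i j p c)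
    - mxform (rm_mx j (tr x)) (dtr i j p (christoffel i x a b)) (dtr i j p c).
  exact: (etrans (mxformDl _ _ _ _) (congr1 _ (mxformNl _ _ _))).
have s_skew a b c : s a b c = - s a c b.
  have nearg : \forall y \near x, mxform (rm_mx j (tr y)) ('D_b tr y) ('D_c tr y) = gform i b c y.
    apply: filterS (near_overlap ip jp) => y [q [iq jq] <-].
    by rewrite /gform (rm_transition _ _ iq jq) /tr transition_chart.
  have E1 := derive_metric_field (findim_mx _ _) a str jx (sD b) (sD c).
  have E2 := near_eq_derive a nearg.
  have E3 := metric_compatible b c a ix.
  have E := etrans (esym E1) (etrans E2 (etrans E3 (congr2 +%R (gij _ _) (gij _ _)))).
  apply: (etrans (sE a b c)); apply: (etrans _ (esym (congr1 -%R (sE a c b)))).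
  apply: sub_eq_oppr; apply: (etrans _ (etrans E _)).
    exact: (congr1 (+%R _) (gsym _ _)).
  exact: (congr1 (+%R _) (gsym _ _)).
have s_sym a b c : s a b c = s b a c.
  rewrite /s /S (christoffel_sym _ _ ix) /cov (christoffel_sym _ _ jx).
  by rewrite (schwarz a b (findim_mx _ _) str).
(* Three skew swaps alternating with three symmetric ones restore the order of the arguments, with
   the sign -1. *)
have s0 a b c : s a b c = 0.
  have : s a b c = - s a b c.
    by rewrite {1}s_skew s_sym s_skew opprK s_sym s_skew s_sym.
  by move=> /eqP; rewrite -addr_eq0 -mulr2n mulrn_eq0/= => /eqP.
apply/eqP; rewrite -subr_eq0; apply/eqP.
apply: (posdef_inj (rm_posdef jx)) => w; rewrite mxform0l.
have -> : w = dtr i j p (dtr j i p w) by rewrite dtr_comp// dtr_id.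
exact: s0.
Qed.

Section transition_field.
Context {E : normedModType R}.
Hypothesis fE : findim E.

(** Differentiating the transported field produces second derivatives of the transition map, and
    these are the ones that [christoffel_transition] accounts for. *)
Lemma cov_transition i j p (x y : E -> T) d z :
  mf_dom i p -> mf_dom j p -> x z = mf_chart i p ->
  smooth_at x z -> smooth_at y z ->
  cov j (fun t => transition i j (x t)) (fun t => 'D_(y t) (transition i j) (x t)) d z =
  dtr i j p (cov i x y d z).
Proof.
move=> ip jp xp sx sy; set tr := transition i j.
have str : smooth_at tr (x z) by rewrite xp; exact: transition_smooth.
have lin : \forall t \near x z, linear (fun v => 'D_v tr t).
  by apply: filterS (smooth_at_near str) => t st; exact: smooth_at_linearP.
have E1 := derive_comp d fE (findim_mx _ _) (findim_mx _ _) str sx.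
have E2 := derive_linear_field fE (findim_mx _ _) (findim_mx _ _)
  (A := fun t v => 'D_v tr t) lin (fun v => smooth_at_derive v str) sx sy d.
have E3 := christoffel_transition ('D_d x z) (y z) ip jp.
rewrite -xp in E3; rewrite /cov E1 E2 (dtrD _ _ ip jp) -E3 /cov addrAC addrC.
by rewrite /dtr xp.
Qed.

End transition_field.

Lemma curvature_transition i j p u v w : mf_dom i p -> mf_dom j p ->
  dtr i j p (curvature_loc i (mf_chart i p) u v w) =
  curvature_loc j (mf_chart j p) (dtr i j p u) (dtr i j p v) (dtr i j p w).
Proof.
move=> ip jp; set x := mf_chart i p; set tr := transition i j.
have ix : img i x := img_chart ip.
have trx : tr x = mf_chart j p := transition_chart j ip.
have jx : img j (tr x) by rewrite trx; exact: img_chart.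
have str : smooth_at tr x := transition_smooth ip jp.
have sid := @smooth_at_id R T x.
have sc (a t : T) : smooth_at (cst a) t := smooth_at_cst a t.
have Did (a t : T) : 'D_a id t = a by rewrite derive_id.
(* Both curvatures are commutators of covariant derivatives, of the constant
   field [w] along [id] and of its image along the transition map. *)
have := covariant_commute (findim_mx _ _) u v sid ix (sc w x); rewrite !Did => <-.
have := covariant_commute (findim_mx _ _) u v str jx (smooth_at_derive w str).
rewrite trx => <-.
have main a b : dtr i j p (cov i id (cov i id (cst w) a) b x) =
    cov j tr (cov j tr (fun y => 'D_w tr y) a) b x.
  have C : smooth_at (cov i id (cst w) a) x by exact: (smooth_at_cov (findim_mx _ _)).
  have E1 := cov_transition (findim_mx _ _) b ip jp erefl sid C.
  apply: (etrans (esym E1)); apply: cov_eq.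
  apply: filterS (near_overlap ip jp) => y [q [iq jq] <-].
  exact: esym (cov_transition (findim_mx _ _) a iq jq erefl (smooth_at_id _) (sc w _)).
rewrite -scaleN1r (dtrD _ _ ip jp) (dtrZ _ _ ip jp) scaleN1r.
exact: (congr2 (fun a b : T => a - b) (main u v) (main v u)).
Qed.

End chart_invariance.

(** * Fields along a curve *)


Section pointwise_charts.
Context {R : realType} (M : riemannian R).
Local Notation T := 'rV[R]_(mf_dim M).
Implicit Types (i j : mf_idx M) (p : M) (u v w : T).

Lemma in_chartE i p v : in_chart i p v = dtr (mf_at p) i p v.
Proof. by []. Qed.

Lemma in_chart_at p v : in_chart (mf_at p) p v = v.
Proof. by rewrite in_chartE dtr_id//; exact: mf_at_dom. Qed.

Lemma in_chart_change i j p v : mf_dom i p -> mf_dom j p ->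
  in_chart j p v = dtr i j p (in_chart i p v).
Proof. by move=> ip jp; rewrite !in_chartE dtr_comp//; exact: mf_at_dom. Qed.

Lemma in_chartD i p u v : mf_dom i p ->
  in_chart i p (u + v) = in_chart i p u + in_chart i p v.
Proof. by move=> ip; apply: dtrD => //; exact: mf_at_dom. Qed.

Lemma in_chartZ i p a v : mf_dom i p -> in_chart i p (a *: v) = a *: in_chart i p v.
Proof. by move=> ip; apply: dtrZ => //; exact: mf_at_dom. Qed.

Lemma in_chart_linear i p : mf_dom i p -> linear (in_chart i p).
Proof. by move=> ip a u v; rewrite in_chartD// in_chartZ. Qed.

Lemma in_chart_inj i p : mf_dom i p -> injective (in_chart i p).
Proof.
move=> ip u v uv; rewrite -(in_chart_at p u) -(in_chart_at p v).
by rewrite !(in_chart_change _ ip (mf_at_dom p)) uv.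
Qed.

Lemma metricE i p u v : mf_dom i p ->
  metric p u v = mxform (rm_mx i (mf_chart i p)) (in_chart i p u) (in_chart i p v).
Proof. by move=> ip; rewrite /metric (rm_transition _ _ (mf_at_dom p) ip). Qed.

Lemma metric_posdef p : posdef (rm_mx (mf_at p) (mf_chart (mf_at p) p)).
Proof. by apply: rm_posdef; apply: img_chart; exact: mf_at_dom. Qed.

Lemma curvatureE i p u v w : mf_dom i p ->
  in_chart i p (curvature p u v w) =
  curvature_loc i (mf_chart i p) (in_chart i p u) (in_chart i p v) (in_chart i p w).
Proof. by move=> ip; exact: (curvature_transition _ _ _ (mf_at_dom p) ip). Qed.

End pointwise_charts.

Section smooth_maps_to_manifold.
Context {R : realType} (M : riemannian R) {E : normedModType R}.
Hypothesis fE : findim E.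
Local Notation T := 'rV[R]_(mf_dim M).
Implicit Types (i j : mf_idx M) (F : E -> M) (z : E).

Lemma smooth_map_dom F z i : {for z, continuous F} -> mf_dom i (F z) ->
  \forall t \near z, mf_dom i (F t).
Proof.
move=> cF iz; apply: cF; apply: open_nbhs_nbhs; split=> //; exact: mf_domO.
Qed.

Lemma smooth_at_chart_change F z i j :
  (\forall t \near z, mf_dom i (F t)) -> mf_dom j (F z) ->
  smooth_at (mf_chart i \o F) z -> smooth_at (mf_chart j \o F) z.
Proof.
move=> iF jz sF; have iz := nbhs_singleton iF.
apply: (smooth_at_eq (f := fun t => transition i j (mf_chart i (F t)))).
  by apply: filterS iF => t it; rewrite transition_chart.
apply: (smooth_at_comp fE _ _ (f := transition i j) (g := mf_chart i \o F)) => //.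
exact: transition_smooth.
Qed.

Lemma smooth_at_chart F z j : smooth_map_at F z -> mf_dom j (F z) ->
  smooth_at (mf_chart j \o F) z.
Proof.
move=> [cF sF] jz; apply: smooth_at_chart_change sF => //.
by apply: smooth_map_dom => //; exact: mf_at_dom.
Qed.

(** The preferred chart moves with [t], which a change of charts repairs. Continuity is assumed at
    [z] only; nearby it is recovered by composing the smooth coordinates with the inverse chart. *)
Lemma smooth_map_near F z : smooth_map_at F z -> \forall t \near z, smooth_map_at F t.
Proof.
move=> [cF sF]; set i := mf_at (F z).
have iF : \forall t \near z, mf_dom i (F t).
  by apply: smooth_map_dom => //; exact: mf_at_dom.
have := near_join iF; apply: filterS2 (smooth_at_near sF) => t st it.
have itt := nbhs_singleton it; split; last first.
  apply: (smooth_at_chart_change it) => //; exact: mf_at_dom.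
have ct : {for t, continuous (mf_inv i \o (mf_chart i \o F))}.
  apply: continuous_comp; first exact: smooth_at_continuous.
  by apply: inv_continuous; exact: img_chart.
rewrite /prop_for /continuous_at /= chartK// in ct.
apply: cvg_trans ct; apply: near_eq_cvg; apply: filterS it => u iu.
by rewrite /= chartK.
Qed.

End smooth_maps_to_manifold.

Section fields_along_curves.
Context {R : realType} (M : riemannian R).
Local Notation T := 'rV[R]_(mf_dim M).
Variable c : R -> M.
Implicit Types (i j : mf_idx M) (V W : R -> T) (s t : R).

(** The preferred chart changes from point to point, so [V] itself may jump; its components in a
    fixed chart are what can be differentiated. *)
Definition loc i V : R -> T := fun t => in_chart i (c t) (V t).
Definition crd i : R -> T := mf_chart i \o c.

Definition sfield V s := smooth_map_at c s /\ smooth_at (loc (mf_at (c s)) V) s.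

Lemma crd_smooth i s : smooth_map_at c s -> mf_dom i (c s) -> smooth_at (crd i) s.
Proof. by move=> cs is_; exact: smooth_at_chart. Qed.

Lemma curve_dom i s : smooth_map_at c s -> mf_dom i (c s) ->
  \forall t \near s, mf_dom i (c t).
Proof. by move=> [cs _] is_; exact: smooth_map_dom. Qed.

Lemma crd_img i s : mf_dom i (c s) -> img i (crd i s).
Proof. by move=> is_; exact: img_chart. Qed.

Lemma loc_change i j s V : smooth_map_at c s -> mf_dom i (c s) -> mf_dom j (c s) ->
  \forall t \near s, 'D_(loc i V t) (transition i j) (crd i t) = loc j V t.
Proof.
move=> cs is_ js; apply: filterS2 (curve_dom cs is_) (curve_dom cs js) => t it jt.
by rewrite /loc (in_chart_change _ it jt).
Qed.

Lemma crd_change i j s : smooth_map_at c s -> mf_dom i (c s) ->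
  \forall t \near s, transition i j (crd i t) = crd j t.
Proof.
move=> cs is_; apply: filterS (curve_dom cs is_) => t it.
by rewrite /crd /= transition_chart.
Qed.

Lemma loc_smooth_change i j s V : smooth_map_at c s -> mf_dom i (c s) -> mf_dom j (c s) ->
  smooth_at (loc i V) s -> smooth_at (loc j V) s.
Proof.
move=> cs is_ js sV; have sx := crd_smooth cs is_.
have str : smooth_at (transition i j) (crd i s) by exact: transition_smooth.
apply: smooth_at_eq (loc_change V cs is_ js) _.
pose A (t v : T) : T := 'D_v (transition i j) t.
have lin : \forall t \near crd i s, linear (A t).
  by apply: filterS (smooth_at_near str) => t st; exact: smooth_at_linearP.
have sA v : smooth_at (A^~ v) (crd i s) by exact: smooth_at_derive.
exact: (smooth_at_linear_field findim_real (findim_mx _ _) (findim_mx _ _) lin sA sx sV).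
Qed.

Lemma sfield_loc i s V : sfield V s -> mf_dom i (c s) -> smooth_at (loc i V) s.
Proof. by move=> [cs sV] is_; apply: loc_smooth_change sV => //; exact: mf_at_dom. Qed.

Lemma loc_sfield i s V : smooth_map_at c s -> mf_dom i (c s) ->
  smooth_at (loc i V) s -> sfield V s.
Proof.
by move=> cs is_ sV; split=> //; apply: loc_smooth_change sV => //; exact: mf_at_dom.
Qed.

Lemma sfield_near s V : sfield V s -> \forall t \near s, sfield V t.
Proof.
move=> [cs sV].
apply: filterS3 (smooth_map_near findim_real cs) (curve_dom cs (mf_at_dom _)) (smooth_at_near sV).
by move=> t ct it st; exact: (loc_sfield ct it st).
Qed.

Lemma covD_at V s : covD c V s = cov (mf_at (c s)) (crd (mf_at (c s))) (loc (mf_at (c s)) V) 1 s.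
Proof. by rewrite /covD /cov !derive1E. Qed.

(** [covD] is computed at each parameter in the chart preferred there. Differentiating it once more
    takes its components in one fixed chart. *)
Lemma covD_loc_chart j s V : sfield V s -> mf_dom j (c s) ->
  in_chart j (c s) (covD c V s) = cov j (crd j) (loc j V) 1 s.
Proof.
move=> sV js; have [cs _] := sV; set i := mf_at (c s).
have is_ : mf_dom i (c s) by exact: mf_at_dom.
rewrite in_chartE covD_at.
have E := cov_transition findim_real 1 is_ js erefl (crd_smooth cs is_) (sfield_loc sV is_).
apply: (etrans (esym E)).
rewrite /cov (near_eq_derive (1 : R) (loc_change V cs is_ js))
  (near_eq_derive (1 : R) (crd_change j cs is_)).
by rewrite (nbhs_singleton (loc_change V cs is_ js)) (nbhs_singleton (crd_change j cs is_)).
Qed.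

Lemma covD_near_loc i s V : sfield V s -> mf_dom i (c s) ->
  \forall t \near s, cov i (crd i) (loc i V) 1 t = loc i (covD c V) t.
Proof.
move=> sV is_; have [cs _] := sV.
apply: filterS2 (sfield_near sV) (curve_dom cs is_) => t sVt it.
by rewrite [RHS]covD_loc_chart.
Qed.

Lemma velocity_loc i s : smooth_map_at c s -> mf_dom i (c s) ->
  loc i (velocity c) s = 'D_1 (crd i) s.
Proof.
move=> cs is_; have as_ := mf_at_dom (c s); set a := mf_at (c s) in as_ *.
rewrite /loc in_chartE /velocity derive1E /dtr.
have str : smooth_at (transition a i) (crd a s) by exact: transition_smooth.
have E := derive_comp (1 : R) findim_real (findim_mx _ _) (findim_mx _ _) str (crd_smooth cs as_).
by rewrite -[LHS]E; apply: near_eq_derive; exact: crd_change.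
Qed.

Lemma velocity_near_loc i s : smooth_map_at c s -> mf_dom i (c s) ->
  \forall t \near s, 'D_1 (crd i) t = loc i (velocity c) t.
Proof.
move=> cs is_; apply: filterS2 (smooth_map_near findim_real cs) (curve_dom cs is_) => t ct it.
by rewrite velocity_loc.
Qed.

Lemma sfield_velocity s : smooth_map_at c s -> sfield (velocity c) s.
Proof.
move=> cs; split=> //; apply: smooth_at_eq (velocity_near_loc cs (mf_at_dom _)) _.
by apply: smooth_at_derive; apply: crd_smooth => //; exact: mf_at_dom.
Qed.

Lemma metric_near_loc i s V W : smooth_map_at c s -> mf_dom i (c s) ->
  \forall t \near s, mxform (rm_mx i (crd i t)) (loc i V t) (loc i W t) =
                     metric (c t) (V t) (W t).
Proof.
by move=> cs is_; apply: filterS (curve_dom cs is_) => t it; rewrite (metricE _ _ it).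
Qed.

Lemma smooth_at_metric s V W : sfield V s -> sfield W s ->
  smooth_at (fun t => metric (c t) (V t) (W t)) s.
Proof.
move=> sV sW; have [cs _] := sV; have is_ := mf_at_dom (c s).
apply: smooth_at_eq (metric_near_loc V W cs is_) _.
apply: (smooth_at_metric_field findim_real);
  [exact: crd_smooth|exact: crd_img|exact: sfield_loc|exact: sfield_loc].
Qed.

Lemma derive_metric s V W : sfield V s -> sfield W s ->
  'D_1 (fun t => metric (c t) (V t) (W t)) s =
  metric (c s) (covD c V s) (W s) + metric (c s) (V s) (covD c W s).
Proof.
move=> sV sW; have [cs _] := sV; have is_ := mf_at_dom (c s).
rewrite -(near_eq_derive (1 : R) (metric_near_loc V W cs is_)).
rewrite (derive_metric_field findim_real 1 (crd_smooth cs is_) (crd_img is_)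
  (sfield_loc sV is_) (sfield_loc sW is_)).
by rewrite /metric !covD_at /loc !in_chart_at.
Qed.

End fields_along_curves.

(** * Parallel frames *)


Section plane.
Context {R : realType}.

Lemma smooth_at_horizontal (s a : R) : smooth_at (fun t : R => (t, a)) s.
Proof.
rewrite (_ : (fun t : R => (t, a)) = fun t => t *: ((1, 0) : (R * R)%type) + (0, a)).
  have s1 : smooth_at (fun t : R => t *: ((1, 0) : (R * R)%type)) s.
    by apply: smooth_at_scale => //; [exact: smooth_at_id|exact: smooth_at_cst].
  exact: (smooth_atD s1 (smooth_at_cst _ _)).
apply/funext => u; rewrite -[u *: _]/(u * 1, u * 0) mulr1 mulr0 -[_ + _]/(u + 0, 0 + a).
by rewrite addr0 add0r.
Qed.

Lemma smooth_at_vertical (s a : R) : smooth_at (fun t : R => (s, t)) a.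
Proof.
rewrite (_ : (fun t : R => (s, t)) = fun t => t *: ((0, 1) : (R * R)%type) + (s, 0)).
  have s1 : smooth_at (fun t : R => t *: ((0, 1) : (R * R)%type)) a.
    by apply: smooth_at_scale => //; [exact: smooth_at_id|exact: smooth_at_cst].
  exact: (smooth_atD s1 (smooth_at_cst _ _)).
apply/funext => u; rewrite -[u *: _]/(u * 0, u * 1) mulr1 mulr0 -[_ + _]/(0 + s, u + 0).
by rewrite addr0 add0r.
Qed.

End plane.

Section chart_jacobian.
Context {R : realType} (M : riemannian R).
Local Notation T := 'rV[R]_(mf_dim M).
Local Notation MX := 'M[R]_(mf_dim M).
Implicit Types (i j : mf_idx M) (p : M) (u v w : T).

Definition jac i p : MX := \matrix_(a, b) in_chart i p (delta_mx 0 a) 0 b.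

Lemma in_chart_jac i p v : mf_dom i p -> in_chart i p v = v *m jac i p.
Proof.
move=> ip; rewrite (linear_row_expand v (in_chart_linear ip)) mulmx_sum_row.
by apply: eq_bigr => a _; congr (_ *: _); apply/rowP => b; rewrite !mxE.
Qed.

Lemma jac_unitmx i p : mf_dom i p -> jac i p \in unitmx.
Proof.
move=> ip; rewrite -row_free_unit -kermx_eq0; apply/eqP/row_matrixP => a.
rewrite row0; apply: (in_chart_inj ip).
by rewrite !in_chart_jac// -row_mul mulmx_ker row0 mul0mx.
Qed.

Lemma curvature_loc_linear i (x u w : T) : img i x ->
  linear (fun v => curvature_loc i x u v w).
Proof.
move=> ix a v v'; rewrite !(curvature_locE _ _ _ ix).
have s1 b : smooth_at (fun t => christoffel i t b w) x by exact: smooth_at_christoffel.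
have L1 : linear (fun v => 'D_v (fun t => christoffel i t u w) x).
  by apply: smooth_at_linearP => //; exact: s1.
have L2 := christoffel_linearl (christoffel i x u w) ix.
have L3 : 'D_u (fun t => christoffel i t (a *: v + v') w) x =
    a *: 'D_u (fun t => christoffel i t v w) x + 'D_u (fun t => christoffel i t v' w) x.
  have [_ <-] := is_deriveD (is_deriveZ a (smooth_at_is_derive u (s1 v)))
                            (smooth_at_is_derive u (s1 v')).
  by apply: near_eq_derive; apply: filterS (near_img ix) => t it; exact: christoffel_linearl.
have L4 : christoffel i x u (christoffel i x (a *: v + v') w) =
    a *: christoffel i x u (christoffel i x v w) + christoffel i x u (christoffel i x v' w).
  apply: (etrans (congr1 (christoffel i x u) (christoffel_linearl w ix a v v'))).
  exact: christoffel_linearr.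
have alg (p q r s p' q' r' s' : T) : a *: p + p' + (a *: q + q') - (a *: r + r' + (a *: s + s')) =
    a *: (p + q - (r + s)) + (p' + q' - (r' + s')).
  by apply/rowP => k; rewrite !mxE; ring.
apply: (etrans _ (alg _ _ _ _ _ _ _ _)).
exact: (congr2 (fun a b : T => a - b) (congr2 +%R (L1 _ _ _) (L2 _ _ _)) (congr2 +%R L3 L4)).
Qed.

Lemma smooth_at_curvature_field i (x y : R -> T) s :
  smooth_at x s -> img i (x s) -> smooth_at y s ->
  smooth_at (fun t => curvature_loc i (x t) ('D_1 x t) (y t) ('D_1 x t)) s.
Proof.
(* On the surface [(s, r) |-> x s + r y s] the curvature is a commutator of
   covariant derivatives, and these preserve smoothness. *)
move=> sx ix sy.
pose X (q : R * R) : T := x q.1 + q.2 *: y q.1.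
pose Z (q : R * R) : T := 'D_1 x q.1.
have sf1 (q : R * R) : smooth_at (fst : R * R -> R) q.
  apply: (smooth_at_linear (l := (fst : {linear (R * R)%type -> R})) (f := id)).
    by move=> a; exact: cvg_fst.
  exact: smooth_at_id.
have sf2 (q : R * R) : smooth_at (snd : R * R -> R) q.
  apply: (smooth_at_linear (l := (snd : {linear (R * R)%type -> R})) (f := id)).
    by move=> a; exact: cvg_snd.
  exact: smooth_at_id.
have sinj (t : R) : smooth_at (fun t : R => (t, 0 : R)) t := smooth_at_horizontal t 0.
have sxf : smooth_at (fun q : R * R => x q.1) (s, 0).
  by apply: (smooth_at_comp _ _ _ (f := x) (g := fst)).
have syf : smooth_at (fun q : R * R => y q.1) (s, 0).
  by apply: (smooth_at_comp _ _ _ (f := y) (g := fst)).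
have sX : smooth_at X (s, 0).
  by apply: smooth_atD => //; apply: smooth_at_scale.
have sZ : smooth_at Z (s, 0).
  apply: (smooth_at_comp _ _ _ (f := fun t => 'D_1 x t) (g := fst)) => //.
  exact: smooth_at_derive.
have X0 t : X (t, 0) = x t by rewrite /X/= scale0r addr0.
have iX : img i (X (s, 0)) by rewrite X0.
pose d : (R * R)%type := (1, 0); pose e : (R * R)%type := (0, 1).
pose K q := cov i X (cov i X Z d) e q - cov i X (cov i X Z e) d q.
have sK : smooth_at K (s, 0).
  have C a : smooth_at (cov i X Z a) (s, 0) := smooth_at_cov findim_plane a sX iX sZ.
  exact: (smooth_atB (smooth_at_cov findim_plane e sX iX (C d))
                     (smooth_at_cov findim_plane d sX iX (C e))).
have sK' : smooth_at (fun t : R => K (t, 0)) s.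
  exact: (smooth_at_comp findim_real findim_plane (findim_mx _ _) sK (sinj s)).
apply: smooth_at_eq sK'.
have near0 (Q : set (R * R)%type) : (\forall q \near (s, 0 : R), Q q) ->
    \forall t \near s, Q (t, 0).
  by move=> nQ; exact: (smooth_at_continuous (sinj s) nQ).
have nX := near0 _ (smooth_at_near sX); have nZ := near0 _ (smooth_at_near sZ).
have ni := smooth_at_img sx ix.
near=> t.
have sXt : smooth_at X (t, 0) by near: t.
have sZt : smooth_at Z (t, 0) by near: t.
have iXt : img i (X (t, 0)) by rewrite X0; near: t.
have sxt : smooth_at x t by near: t; exact: (smooth_at_near sx).
have syt : smooth_at y t by near: t; exact: (smooth_at_near sy).
have DX a : 'D_a X (t, 0) = 'D_(a.1) x t + a.2 *: y t.
  have D2 : 'D_a (snd : R * R -> R) (t, 0) = a.2.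
    have E := derive_linear (l := (snd : {linear (R * R)%type -> R})) a
      (fun b => cvg_snd) (smooth_at_id (t, 0 : R)).
    by rewrite -[LHS]/('D_a (fun q : R * R => snd (id q)) (t, 0)) E derive_id.
  have s1 : smooth_at (fun q : R * R => x q.1) (t, 0).
    by apply: (smooth_at_comp _ _ _ (f := x) (g := fst)).
  have s2 : smooth_at (fun q : R * R => y q.1) (t, 0).
    by apply: (smooth_at_comp _ _ _ (f := y) (g := fst)).
  have d2 := is_derive_scale (smooth_at_is_derive a (sf2 (t, 0))) (smooth_at_is_derive a s2).
  have [_ ->] := is_deriveD (smooth_at_is_derive a s1) d2.
  by rewrite /= scale0r add0r D2.
have := covariant_commute findim_plane d e sXt iXt sZt.
rewrite !DX X0 /d /e /= scale0r addr0 scale1r derive0 add0r.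
exact.
Unshelve. all: by end_near. Qed.

End chart_jacobian.

Section parallel_frames.
Context {R : realType} (M : riemannian R).
Local Notation n := (mf_dim M).
Local Notation T := 'rV[R]_(mf_dim M).
Local Notation MX := 'M[R]_(mf_dim M).
Variable c : R -> M.
Implicit Types (i j : mf_idx M) (V W : R -> T) (s t : R) (Y : R -> MX).

Definition locm i Y : R -> MX := fun t => Y t *m jac i (c t).

Lemma loc_mulmx i (v : R -> T) Y t : mf_dom i (c t) ->
  loc c i (fun t => v t *m Y t) t = v t *m locm i Y t.
Proof. by move=> it; rewrite /loc (in_chart_jac _ it) mulmxA. Qed.

Lemma loc_row i a Y t : mf_dom i (c t) ->
  loc c i (fun t => row a (Y t)) t = row a (locm i Y t).
Proof. by move=> it; rewrite /loc (in_chart_jac _ it) row_mul. Qed.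

Lemma smooth_at_rowP Y s : smooth_at Y s <-> forall a, smooth_at (fun t => row a (Y t)) s.
Proof.
split=> [/(smooth_at_mxP findim_real) sY a|sY]; apply/(smooth_at_mxP findim_real).
  move=> b k; rewrite (_ : (fun t => _) = fun t => Y t a k); first exact: sY.
  by apply/funext => t; rewrite mxE.
move=> a b; have /(smooth_at_mxP findim_real)/(_ 0 b) := sY a.
by rewrite (_ : (fun t => _) = fun t => Y t a b)//; apply/funext => t; rewrite mxE.
Qed.

(* The parallel transport equation of a frame in the chart [i] is [Z' = Z B]. *)
Definition transport i (t : R) : MX :=
  \matrix_(a, b) (- christoffel i (crd c i t) ('D_1 (crd c i) t) (delta_mx 0 a) 0 b).

Lemma christoffel_transport i t (y : T) : mf_dom i (c t) ->
  christoffel i (crd c i t) ('D_1 (crd c i) t) y = - (y *m transport i t).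
Proof.
move=> it; have l := christoffel_linearr ('D_1 (crd c i) t) (crd_img it).
rewrite (linear_row_expand y l) mulmx_sum_row -sumrN.
apply: eq_bigr => a _; rewrite -scalerN; congr (_ *: _).
by apply/rowP => b; rewrite !mxE opprK.
Qed.

Lemma smooth_at_transport i s : smooth_map_at c s -> mf_dom i (c s) ->
  smooth_at (transport i) s.
Proof.
move=> cs is_; apply/(smooth_at_mxP findim_real) => a b.
have sx := crd_smooth cs is_.
have := smooth_at_christoffel_field findim_real sx (crd_img is_)
  (smooth_at_derive (1 : R) sx) (smooth_at_cst (delta_mx 0 a : T) s).
move=> /(smooth_at_mxP findim_real)/(_ 0 b)/smooth_atN.
by rewrite (_ : (fun t => - _) = fun t => transport i t a b)//; apply/funext => t; rewrite [RHS]mxE.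
Qed.

(** The rows of [Y] are the vectors of the frame. They are required to be parallel on a
    neighbourhood of [s], which makes this an open condition, as gluing demands. *)
Definition pframe Y s := [/\ smooth_map_at c s, smooth_at (locm (mf_at (c s)) Y) s,
  \forall t \near s, forall a, covD c (fun t => row a (Y t)) t = 0 & Y s \in unitmx].

Lemma row_sfield Y s : smooth_map_at c s ->
  smooth_at (locm (mf_at (c s)) Y) s <-> forall a, sfield c (fun t => row a (Y t)) s.
Proof.
move=> cs; set i := mf_at (c s); have is_ := mf_at_dom (c s).
have E a : \forall t \near s, loc c i (fun t => row a (Y t)) t = row a (locm i Y t).
  by apply: filterS (curve_dom cs is_) => t it; rewrite loc_row.
split=> [/smooth_at_rowP h a|h].
  split=> //; apply: smooth_at_eq (h a); apply: filterS (E a) => t; exact: esym.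
by apply/smooth_at_rowP => a; apply: smooth_at_eq (E a) (h a).2.
Qed.

Lemma locm_smooth i Y s : smooth_map_at c s -> mf_dom i (c s) ->
  (forall a, sfield c (fun t => row a (Y t)) s) -> smooth_at (locm i Y) s.
Proof.
move=> cs is_ h; apply/smooth_at_rowP => a.
apply: smooth_at_eq (sfield_loc (h a) is_).
by apply: filterS (curve_dom cs is_) => t it; rewrite loc_row.
Qed.

Lemma locm_unitmx i Y t : mf_dom i (c t) -> (locm i Y t \in unitmx) = (Y t \in unitmx).
Proof. by move=> it; rewrite unitmx_mul jac_unitmx// andbT. Qed.

Lemma cov_mulmx i (v : R -> T) (Z : R -> MX) t :
  mf_dom i (c t) -> smooth_at v t -> smooth_at Z t ->
  cov i (crd c i) (fun t => v t *m Z t) 1 t =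
  'D_1 v t *m Z t + v t *m ('D_1 Z t - Z t *m transport i t).
Proof.
move=> it sv sZ; rewrite /cov christoffel_transport//.
rewrite (derive_mulmx findim_real (1 : R) sv sZ) mulmxBr mulmxA.
by rewrite addrAC addrC addrA.
Qed.

Lemma covD_mulmx i (v : R -> T) Y s :
  smooth_map_at c s -> mf_dom i (c s) ->
  (forall a, sfield c (fun t => row a (Y t)) s) -> smooth_at v s ->
  sfield c (fun t => v t *m Y t) s /\
  in_chart i (c s) (covD c (fun t => v t *m Y t) s) =
    'D_1 v s *m locm i Y s + v s *m ('D_1 (locm i Y) s - locm i Y s *m transport i s).
Proof.
move=> cs is_ sY sv; have sZ := locm_smooth cs is_ sY.
have E : \forall t \near s, v t *m locm i Y t = loc c i (fun t => v t *m Y t) t.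
  by apply: filterS (curve_dom cs is_) => t it; rewrite loc_mulmx.
have sV : sfield c (fun t => v t *m Y t) s.
  apply: (loc_sfield cs is_); apply: smooth_at_eq E _.
  exact: (smooth_at_mulmx findim_real).
split=> //; rewrite (covD_loc_chart sV is_) -(cov_eq _ _ _ E).
exact: cov_mulmx.
Qed.

Lemma parallel_ode i Y s : smooth_map_at c s -> mf_dom i (c s) ->
  (forall a, sfield c (fun t => row a (Y t)) s) ->
  (forall a, covD c (fun t => row a (Y t)) s = 0) <->
  'D_1 (locm i Y) s = locm i Y s *m transport i s.
Proof.
move=> cs is_ sY.
have main a : in_chart i (c s) (covD c (fun t => row a (Y t)) s) =
    row a ('D_1 (locm i Y) s - locm i Y s *m transport i s).
  have [_] := covD_mulmx cs is_ sY (smooth_at_cst (delta_mx 0 a : T) s).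
  rewrite derive_cst mul0mx add0r -rowE => <-.
  by congr (in_chart i _ (covD c _ s)); apply/funext => t; rewrite rowE.
have in0 : in_chart i (c s) 0 = 0 :> T by rewrite (in_chart_jac _ is_) mul0mx.
split=> [h|h a].
  apply/eqP; rewrite -subr_eq0; apply/eqP/row_matrixP => a.
  by rewrite -main h in0 row0.
by apply: (in_chart_inj is_); rewrite main h subrr row0 in0.
Qed.

Lemma pframe_near Y s : pframe Y s -> \forall t \near s, pframe Y t.
Proof.
move=> [cs sY dY uY]; have is_ := mf_at_dom (c s).
have rs := (row_sfield Y cs).1 sY.
have uY' : \forall t \near s, locm (mf_at (c s)) Y t \in unitmx.
  by apply: (unitmx_near findim_real) => //; rewrite locm_unitmx.
have rs' : \forall t \near s, forall a, sfield c (fun t => row a (Y t)) t.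
  have h a : \forall t \near s, sfield c (fun t => row a (Y t)) t by exact: sfield_near.
  exact: filter_forall h.
have dY' := near_join dY.
have cs' := smooth_map_near findim_real cs; have is' := curve_dom cs is_.
near=> t.
have ct : smooth_map_at c t by near: t.
have it : mf_dom (mf_at (c s)) (c t) by near: t.
split; first exact: ct.
- by apply/(row_sfield Y ct); near: t.
- by near: t.
- by rewrite -(locm_unitmx Y it); near: t.
Unshelve. all: by end_near. Qed.

Lemma pframe_near_ode i Y s : pframe Y s -> mf_dom i (c s) ->
  [/\ smooth_at (locm i Y) s, locm i Y s \in unitmx &
  \forall t \near s, 'D_1 (locm i Y) t = locm i Y t *m transport i t].
Proof.
move=> PY is_; have [cs sY dY uY] := PY.
have rs := (row_sfield Y cs).1 sY.
split; [exact: locm_smooth|by rewrite locm_unitmx|].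
apply: filterS2 (pframe_near PY) (curve_dom cs is_) => t [ct sYt dYt uYt] it.
by apply/(parallel_ode ct it ((row_sfield Y ct).1 sYt)); exact: (nbhs_singleton dYt).
Qed.

Lemma pframe_local s : smooth_map_at c s -> exists Y, pframe Y s.
Proof.
move=> cs; set i := mf_at (c s); have is_ : mf_dom i (c s) by exact: mf_at_dom.
have [Z [Zs sZ dZ]] := linear_ode_local (smooth_at_transport cs is_).
(* [Z] solves the transport equation in the fixed chart [i]; the inverse of [jac] brings its rows
   back to the chart preferred at each point. *)
pose Y t := Z t *m invmx (jac i (c t)).
have E : \forall t \near s, locm i Y t = Z t.
  by apply: filterS (curve_dom cs is_) => t it; rewrite /locm mulmxKV// jac_unitmx.
exists Y.
have sY : smooth_at (locm i Y) s by apply: smooth_at_eq sZ; apply: filterS E => t; exact: esym.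
have rs := (row_sfield Y cs).1 sY.
have rs' : \forall t \near s, forall a, sfield c (fun t => row a (Y t)) t.
  have h a : \forall t \near s, sfield c (fun t => row a (Y t)) t by exact: sfield_near.
  exact: filter_forall h.
have uY : Y s \in unitmx by rewrite -(locm_unitmx Y is_) (nbhs_singleton E) Zs unitmx1.
split; [exact: cs|exact: sY| |exact: uY].
have cs' := smooth_map_near findim_real cs; have is' := curve_dom cs is_.
have E' := near_join E.
near=> t.
have ct : smooth_map_at c t by near: t.
have it : mf_dom i (c t) by near: t.
have rt : forall a, sfield c (fun t => row a (Y t)) t by near: t.
apply/(parallel_ode ct it rt).
have Et : \forall t \near t, locm i Y t = Z t by near: t.
rewrite (near_eq_derive (1 : R) Et) (nbhs_singleton Et).
by near: t.
Unshelve. all: by end_near. Qed.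

Lemma pframe_eq Y Y' s : pframe Y s -> (\forall t \near s, Y t = Y' t) -> pframe Y' s.
Proof.
move=> [cs sY dY uY] E; split; first exact: cs.
- apply: smooth_at_eq sY; apply: filterS E => t Et; by rewrite /locm Et.
- apply: filterS2 dY (near_join E) => t dYt Et a.
  rewrite -(dYt a) !covD_at; apply: cov_eq; apply: filterS Et => u Eu.
  by rewrite /loc Eu.
- by rewrite -(nbhs_singleton E).
Qed.

Lemma pframe_mul Y s (C : MX) : pframe Y s -> C \in unitmx ->
  pframe (fun t => C *m Y t) s.
Proof.
move=> PY uC; have [cs sY dY uY] := PY; have is_ := mf_at_dom (c s); split; first exact: cs.
- have := smooth_at_mulmx findim_real (smooth_at_cst C s) sY.
  by apply: smooth_at_eq; near=> t; rewrite /locm mulmxA.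
- apply: filterS (pframe_near PY) => t [ct sYt dYt uYt] a.
  have it := mf_at_dom (c t).
  have rt := (row_sfield Y ct).1 sYt.
  have ode := (parallel_ode ct it rt).1 (nbhs_singleton dYt).
  have [_ h] := covD_mulmx ct it rt (smooth_at_cst (row a C) t).
  apply: (in_chart_inj it); rewrite (in_chart_jac 0 it) mul0mx.
  have -> : (fun t => row a (C *m Y t)) = (fun t => cst (row a C) t *m Y t).
    by apply/funext => u; rewrite row_mul.
  by rewrite h ode subrr mulmx0 addr0 derive_cst mul0mx.
- by rewrite unitmx_mul uC.
Unshelve. all: by end_near. Qed.

Lemma pframe_unique Y Y' s : pframe Y s -> pframe Y' s ->
  \forall t \near s, Y' t = (Y' s *m invmx (Y s)) *m Y t.
Proof.
move=> PY PY'; have [cs _ _ uY] := PY; have is_ := mf_at_dom (c s).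
set i := mf_at (c s) in is_.
have [sZ uZ dZ] := pframe_near_ode PY is_; have [sZ' _ dZ'] := pframe_near_ode PY' is_.
apply: filterS2 (linear_ode_unique sZ sZ' uZ dZ dZ') (curve_dom cs is_) => t + it.
have uJ := jac_unitmx it; have uJs := jac_unitmx is_.
have -> : locm i Y' s *m invmx (locm i Y s) = Y' s *m invmx (Y s).
  set A := _ *m invmx _; have AE : A *m locm i Y s = locm i Y' s by rewrite mulmxKV.
  move: AE; rewrite /locm mulmxA => /(congr1 (mulmx^~ (invmx (jac i (c s))))).
  by rewrite !mulmxK// => <-; rewrite mulmxK.
rewrite /locm mulmxA => /(congr1 (mulmx^~ (invmx (jac i (c t))))) /=.
by rewrite (mulmxK uJ) (mulmxK uJ).
Qed.

Lemma pframe_interval (I : interval R) : 0 \in I ->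
  (forall s, s \in I -> smooth_map_at c s) ->
  exists Y, Y 0 = 1%:M /\ forall s, s \in I -> pframe Y s.
Proof.
move=> I0 sc; apply: (glue_interval pframe_eq pframe_near pframe_mul _ pframe_unique I0).
  by move=> Y s [].
by move=> s /sc; exact: pframe_local.
Qed.

End parallel_frames.

(** * Metric and curvature in a parallel frame *)

Section frame_coordinates.
Context {R : realType} (M : riemannian R).
Local Notation T := 'rV[R]_(mf_dim M).
Local Notation MX := 'M[R]_(mf_dim M).
Variable c : R -> M.
Implicit Types (i j : mf_idx M) (V W : R -> T) (s t : R) (Y : R -> MX).

Lemma pframe_field Y s (v : R -> T) : pframe c Y s -> smooth_at v s ->
  sfield c (fun t => v t *m Y t) s /\
  covD c (fun t => v t *m Y t) s = 'D_1 v s *m Y s.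
Proof.
move=> PY sv; have [cs sY dY _] := PY; have is_ := mf_at_dom (c s).
have rs := (row_sfield Y cs).1 sY.
have [sV h] := covD_mulmx cs is_ rs sv; split; first exact: sV.
have ode := (parallel_ode cs is_ rs).1 (nbhs_singleton dY).
apply: (in_chart_inj is_); rewrite h ode subrr mulmx0 addr0.
by rewrite (in_chart_jac _ is_) mulmxA.
Qed.

Lemma pframe_coord Y s V : pframe c Y s -> sfield c V s ->
  smooth_at (fun t => V t *m invmx (Y t)) s.
Proof.
move=> PY sV; have [cs sY _ uY] := PY; set i := mf_at (c s) in sY.
have is_ : mf_dom i (c s) by exact: mf_at_dom.
have uZ : locm c i Y s \in unitmx by rewrite locm_unitmx.
have h := smooth_at_mulmx findim_real (sfield_loc sV is_) (smooth_at_invmx findim_real uZ sY).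
apply: smooth_at_eq h.
apply: filterS2 (curve_dom cs is_) (pframe_near PY) => t it [_ _ _ ut].
have uJ := jac_unitmx it.
rewrite /loc (in_chart_jac _ it).
have ul : locm c i Y t \in unitmx by rewrite locm_unitmx.
by rewrite -{1}[V t](mulmxKV ut) -[_ *m Y t *m _]mulmxA (mulmxK ul).
Qed.

Definition gram Y t : MX :=
  Y t *m rm_mx (mf_at (c t)) (mf_chart (mf_at (c t)) (c t)) *m (Y t)^T.

Lemma metric_frame Y t (v w : T) :
  metric (c t) (v *m Y t) (w *m Y t) = mxform (gram Y t) v w.
Proof. by rewrite /metric /mxform /gram trmx_mul !mulmxA. Qed.

Lemma gram_posdef Y t : Y t \in unitmx -> posdef (gram Y t).
Proof.
move=> uY; have [sym pos] := metric_posdef (c t).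
split=> [u v|u u0]; rewrite -!metric_frame; first exact: sym.
apply: pos; apply: contra u0 => /eqP uY0.
by rewrite -[u](mulmxK uY) uY0 mul0mx.
Qed.

(** Parallel transport is an isometry: the derivative of the inner product of two rows involves only
    their covariant derivatives, which vanish. *)
Lemma gram_constant Y s : pframe c Y s -> is_derive s (1 : R) (gram Y) 0.
Proof.
move=> PY; have [cs sY dY _] := PY.
have rs := (row_sfield Y cs).1 sY.
have E a b : (fun t => gram Y t a b) = (fun t => metric (c t) (row a (Y t)) (row b (Y t))).
  by apply/funext => t; rewrite !rowE metric_frame mxform_delta.
have sg : smooth_at (gram Y) s.
  by apply/(smooth_at_mxP findim_real) => a b; rewrite E; exact: smooth_at_metric.
suff E0 : 'D_1 (gram Y) s = 0 by rewrite -E0; exact: smooth_at_is_derive.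
apply/matrixP => a b; rewrite (derive_entry _ _ _ sg) E (derive_metric (rs a) (rs b)).
rewrite !(nbhs_singleton dY) [RHS]mxE.
by rewrite /metric mxform0l mxform0r addr0.
Qed.

Lemma gram_interval Y (I : interval R) s : 0 \in I ->
  (forall s, s \in I -> pframe c Y s) -> s \in I -> gram Y s = gram Y 0.
Proof.
move=> I0 PY sI; have [s0|/ltW s0] := leP 0 s.
  apply/esym; apply: (derive0_constant s0) => t ts; apply/gram_constant/PY.
  exact: (interval_is_interval I0 sI).
apply: (derive0_constant s0) => t ts; apply/gram_constant/PY.
exact: (interval_is_interval sI I0).
Qed.

Lemma curvature_linear p (u w : T) : linear (fun v => curvature p u v w).
Proof. by apply: curvature_loc_linear; apply: img_chart; exact: mf_at_dom. Qed.

Lemma curvature_metric_sym p (u v w : T) :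
  metric p (curvature p u v u) w = metric p (curvature p u w u) v.
Proof. by apply: curvature_selfadjoint; apply: img_chart; exact: mf_at_dom. Qed.

(** The matrix in the frame of the Jacobi operator, which sends [v] to the curvature term
    [R_{c' v} c']; it acts on the right of row coordinates. *)
Definition curvmx Y t : MX :=
  (\matrix_(a, b) curvature (c t) (velocity c t) (row a (Y t)) (velocity c t) 0 b)
  *m invmx (Y t).

Lemma curvature_frame Y t (v : T) : Y t \in unitmx ->
  curvature (c t) (velocity c t) (v *m Y t) (velocity c t) = v *m curvmx Y t *m Y t.
Proof.
move=> uY; rewrite /curvmx mulmxA (mulmxKV uY).
pose l (a : T) := curvature (c t) (velocity c t) (a *m Y t) (velocity c t).
have ll : linear l.
  by move=> b x y; rewrite /l mulmxDl -scalemxAl; exact: curvature_linear.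
rewrite -/(l v) (linear_row_expand v ll) mulmx_sum_row.
apply: eq_bigr => a _; congr (_ *: _); rewrite /l -rowE.
by apply/rowP => b; rewrite [RHS]mxE [RHS]mxE.
Qed.

Lemma curvmx_smooth Y s : pframe c Y s -> smooth_at (curvmx Y) s.
Proof.
move=> PY; have [cs sY _ uY] := PY; set i := mf_at (c s) in sY.
have is_ : mf_dom i (c s) by exact: mf_at_dom.
have rs := (row_sfield Y cs).1 sY.
have sV a : sfield c (fun t => curvature (c t) (velocity c t) (row a (Y t)) (velocity c t)) s.
  apply: (loc_sfield cs is_).
  have sx := crd_smooth cs is_.
  have h := smooth_at_curvature_field sx (crd_img is_) (sfield_loc (rs a) is_).
  apply: smooth_at_eq h.
  apply: filterS2 (curve_dom cs is_) (velocity_near_loc cs is_) => t it Ev.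
  by rewrite Ev [RHS](curvatureE _ _ _ it).
apply/smooth_at_rowP => a.
have h := pframe_coord PY (sV a).
rewrite (_ : (fun t => row a (curvmx Y t)) = fun t =>
  curvature (c t) (velocity c t) (row a (Y t)) (velocity c t) *m invmx (Y t))//.
apply/funext => t; rewrite /curvmx row_mul; congr (_ *m _).
by apply/rowP => b; rewrite [LHS]mxE [LHS]mxE.
Qed.

Lemma curvmx_sym Y t (v w : T) : Y t \in unitmx ->
  mxform (gram Y t) (v *m curvmx Y t) w = mxform (gram Y t) (w *m curvmx Y t) v.
Proof.
move=> uY; rewrite -!metric_frame -!(curvature_frame _ uY).
exact: curvature_metric_sym.
Qed.

End frame_coordinates.

(** * Variations through geodesics *)

Transparent derive.

Section jacobi_variation.
Context {R : realType} (M : riemannian R).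
Local Notation T := 'rV[R]_(mf_dim M).
Implicit Types (c : R -> M) (J : R -> T) (s : R).

Lemma derive_row_of_plane (F : R * R -> T) s a :
  'D_1 (fun t => F (t, a)) s = 'D_((1, 0) : (R * R)%type) F (s, a).
Proof.
have E : (fun h : R => h^-1 *: (((fun t => F (t, a)) \o shift s) (h *: (1 : R)) - F (s, a)))
    = (fun h => h^-1 *: ((F \o shift (s, a)) (h *: ((1, 0) : (R * R)%type)) - F (s, a))).
  apply/funext => h /=; congr (_ *: (F _ - _)).
  by rewrite -[h *: (1, 0)]/(h * 1, h * 0) mulr0 -[_ + (s, a)]/(h * 1 + s, 0 + a) add0r.
by rewrite /derive E.
Qed.

Lemma derive_col_of_plane (F : R * R -> T) s a :
  'D_1 (fun t => F (s, t)) a = 'D_((0, 1) : (R * R)%type) F (s, a).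
Proof.
have E : (fun h : R => h^-1 *: (((fun t => F (s, t)) \o shift a) (h *: (1 : R)) - F (s, a)))
    = (fun h => h^-1 *: ((F \o shift (s, a)) (h *: ((0, 1) : (R * R)%type)) - F (s, a))).
  apply/funext => h /=; congr (_ *: (F _ - _)).
  by rewrite -[h *: (0, 1)]/(h * 0, h * 1) mulr0 -[_ + (s, a)]/(0 + s, h * 1 + a) add0r.
by rewrite /derive E.
Qed.

End jacobi_variation.

Local Opaque derive.

Section jacobi_fields.
Context {R : realType} (M : riemannian R).
Local Notation T := 'rV[R]_(mf_dim M).
Implicit Types (c : R -> M) (J : R -> T) (s : R).

Lemma smooth_map_comp {E V : normedModType R} (F : V -> M) (g : E -> V) z :
  findim E -> findim V -> smooth_map_at F (g z) -> smooth_at g z ->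
  smooth_map_at (F \o g) z.
Proof.
move=> fE fV [cF sF] sg; split; last exact: (smooth_at_comp fE fV (findim_mx _ _) sF sg).
by apply: continuous_comp => //; exact: smooth_at_continuous.
Qed.

Lemma near_horizontal (s a : R) (Q : set (R * R)%type) :
  (\forall q \near (s, a), Q q) -> \forall t \near s, Q (t, a).
Proof. by move=> nQ; exact: (smooth_at_continuous (smooth_at_horizontal s a) nQ). Qed.

Lemma cov_eq2 i (x x' y y' : R -> T) s :
  (\forall t \near s, x t = x' t) -> (\forall t \near s, y t = y' t) ->
  cov i x y 1 s = cov i x' y' 1 s.
Proof.
move=> xx yy; rewrite /cov (near_eq_derive (1 : R) xx) (near_eq_derive (1 : R) yy).
by rewrite (nbhs_singleton xx) (nbhs_singleton yy).
Qed.

Let e1 : (R * R)%type := (1, 0).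
Let e2 : (R * R)%type := (0, 1).

Lemma cov_horizontal i (x y : R * R -> T) s a :
  cov i (fun t => x (t, a)) (fun t => y (t, a)) 1 s = cov i x y e1 (s, a).
Proof. by rewrite /cov !derive_row_of_plane. Qed.

(** In the coordinates [X] of the variation, J'' is D_1 D_1 of the second partial derivative.
    Absence of torsion turns it into D_1 D_2 of the first one, while D_2 D_1 of the first vanishes
    because the curves are geodesics. So J'' is a commutator, that is, a curvature. *)
Lemma jacobi_variation (c : R -> M) (J : R -> T) (s : R) (F : R * R -> M) :
  smooth_map_at c s -> smooth_map_at F (s, 0) ->
  (\forall q \near (s, 0 : R),
     covD (fun a => F (a, q.2)) (velocity (fun a => F (a, q.2))) q.1 = 0) ->
  (\forall a \near s, F (a, 0) = c a) ->
  (\forall a \near s, J a = velocity (fun t => F (a, t)) 0) ->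
  sfield c J s /\
  covD c (covD c J) s + curvature (c s) (velocity c s) (J s) (velocity c s) = 0.
Proof.
move=> cs sF geo Fc JF.
have Fs : F (s, 0) = c s := nbhs_singleton Fc.
set i := mf_at (c s); have is_ : mf_dom i (c s) by exact: mf_at_dom.
have iFs : mf_dom i (F (s, 0)) by rewrite Fs.
pose X : R * R -> T := mf_chart i \o F.
have sX : smooth_at X (s, 0) by exact: (smooth_at_chart findim_plane).
have sFn := smooth_map_near findim_plane sF.
have iFn : \forall q \near (s, 0 : R), mf_dom i (F q).
  by apply: smooth_map_dom => //; case: sF.
have sXn := smooth_at_near sX.
have iX : img i (X (s, 0)) by exact: img_chart.
(* The geodesic equation is needed on a whole neighbourhood in the plane, because [C1]
   differentiates it across the variation. *)
have geoX : \forall q \near (s, 0 : R), cov i X (fun q => 'D_e1 X q) e1 q = 0.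
  apply: filterS3 geo sFn iFn => -[a b] /= ga sFab iab.
  have sr : smooth_map_at (fun t => F (t, b)) a.
    exact: (smooth_map_comp findim_real findim_plane (sFab : smooth_map_at F ((fun t => (t, b)) a))
      (smooth_at_horizontal a b)).
  have sv := sfield_velocity sr.
  have E := covD_loc_chart sv iab.
  rewrite ga (in_chart_jac _ iab) mul0mx in E.
  apply: (etrans _ (esym E)); apply: (etrans (esym (cov_horizontal i X _ a b))).
  apply: cov_eq2; first by near=> t.
  apply: filterS (velocity_near_loc sr iab) => t Et.
  exact: (etrans (esym (derive_row_of_plane X t b)) Et).
have crdX : \forall a \near s, crd c i a = X (a, 0).
  by apply: filterS Fc => a Fa; rewrite /crd /X /= Fa.
have locJ : \forall a \near s, loc c i J a = 'D_e2 X (a, 0).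
  have := near_horizontal sFn; have := near_horizontal iFn.
  apply: filterS3 (filterI Fc JF) => a [Fa Ja] ia sa.
  have sc : smooth_map_at (fun t => F (a, t)) 0.
    exact: (smooth_map_comp findim_real findim_plane (sa : smooth_map_at F ((fun t => (a, t)) 0))
      (smooth_at_vertical a 0)).
  have E := velocity_loc sc ia.
  by rewrite /loc Ja -Fa; apply: (etrans E); exact: (derive_col_of_plane X).
have sD2 : smooth_at (fun q => 'D_e2 X q) (s, 0) by exact: smooth_at_derive.
have sD1 : smooth_at (fun q => 'D_e1 X q) (s, 0) by exact: smooth_at_derive.
have sJ : sfield c J s.
  split; first exact: cs.
  have h : smooth_at (fun a => 'D_e2 X (a, 0)) s.
    exact: (smooth_at_comp findim_real findim_plane (findim_mx _ _) sD2 (smooth_at_horizontal s 0)).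
  by apply: smooth_at_eq h; apply: filterS locJ => a; exact: esym.
split; first exact: sJ.
have locJ' : \forall a \near s, loc c i (covD c J) a = cov i X (fun q => 'D_e2 X q) e1 (a, 0).
  apply: filterS3 (covD_near_loc sJ is_) (near_join crdX) (near_join locJ) => a Ea ca la.
  by rewrite -Ea -cov_horizontal; exact: cov_eq2.
have torsion : \forall q \near (s, 0 : R),
    cov i X (fun q => 'D_e2 X q) e1 q = cov i X (fun q => 'D_e1 X q) e2 q.
  apply: filterS2 sXn iFn => q sq iq.
  rewrite /cov (schwarz e2 e1 (findim_mx _ _) sq).
  by rewrite (christoffel_sym _ _ (img_chart iq)).
have C1 : cov i X (cov i X (fun q => 'D_e1 X q) e1) e2 (s, 0) = 0.
  have zn : \forall q \near (s, 0 : R), cov i X (fun q => 'D_e1 X q) e1 q = cst 0 q.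
    exact: geoX.
  rewrite (cov_eq _ _ _ zn) /cov derive_cst add0r.
  have h0 := christoffelDr ('D_e2 X (s, 0)) 0 0 iX.
  move/eqP: h0; rewrite addr0 -subr_eq0 opprD addrA subrr sub0r oppr_eq0 => /eqP h0.
  exact: h0.
set A := cov i X (cov i X (fun q => 'D_e1 X q) e2) e1 (s, 0).
have C2 : A = curvature_loc i (X (s, 0)) ('D_e2 X (s, 0)) ('D_e1 X (s, 0)) ('D_e1 X (s, 0)).
  apply: (etrans (esym (subr0 A))); apply: (etrans (congr1 (fun z => A - z) (esym C1))).
  exact: covariant_commute.
have JJ : covD c (covD c J) s = A.
  rewrite covD_at (cov_eq2 i crdX locJ') cov_horizontal.
  exact: cov_eq.
have vel : velocity c s = 'D_e1 X (s, 0).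
  apply: (etrans (esym (in_chart_at (c s) (velocity c s)))).
  apply: (etrans (velocity_loc cs is_)).
  by rewrite (near_eq_derive (1 : R) crdX); exact: (derive_row_of_plane X).
have Js : J s = 'D_e2 X (s, 0).
  exact: (etrans (esym (in_chart_at (c s) (J s))) (nbhs_singleton locJ)).
have Xs : X (s, 0) = mf_chart i (c s) by rewrite /X /= Fs.
rewrite JJ C2 Xs vel Js /curvature (curvature_antisym _ _ _ (img_chart is_)).
exact: addNr.
Unshelve. all: by end_near. Qed.

Lemma jacobi_field_equation (I : set R) c J : geodesic I c -> jacobi_field I c J ->
  forall s, I s -> sfield c J s /\
  covD c (covD c J) s + curvature (c s) (velocity c s) (J s) (velocity c s) = 0.
Proof.
move=> gc [F FP] s Is; have [sF geo Fc JF] := FP s Is.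
have [cs _] := gc s Is; exact: jacobi_variation sF geo Fc JF.
Qed.

End jacobi_fields.

(** * The Jacobi equation in a parallel frame *)


Section second_order_ode.
Context {R : realType} {n : nat}.

Lemma smooth_at_block (A B C D : R -> 'M[R]_n) s :
  smooth_at A s -> smooth_at B s -> smooth_at C s -> smooth_at D s ->
  smooth_at (fun t => block_mx (A t) (B t) (C t) (D t)) s.
Proof.
move=> sA sB sC sD; apply/(smooth_at_mxP findim_real) => i j.
have E (X : R -> 'M[R]_n) k l : smooth_at X s -> smooth_at (fun t => X t k l) s.
  by move=> /(smooth_at_mxP findim_real); apply.
case: (split_ordP i) => a ->; case: (split_ordP j) => b ->.
- rewrite (_ : (fun t => _) = fun t => A t a b); first exact: E.
  by apply/funext => t; rewrite block_mxEul.
- rewrite (_ : (fun t => _) = fun t => B t a b); first exact: E.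
  by apply/funext => t; rewrite block_mxEur.
- rewrite (_ : (fun t => _) = fun t => C t a b); first exact: E.
  by apply/funext => t; rewrite block_mxEdl.
- rewrite (_ : (fun t => _) = fun t => D t a b); first exact: E.
  by apply/funext => t; rewrite block_mxEdr.
Qed.

Lemma smooth_at_mxsub {m p m' p'} (f : 'I_m' -> 'I_m) (g : 'I_p' -> 'I_p)
    (Z : R -> 'M[R]_(m, p)) s : smooth_at Z s ->
  smooth_at (fun t => mxsub f g (Z t)) s /\
  'D_1 (fun t => mxsub f g (Z t)) s = mxsub f g ('D_1 Z s).
Proof.
move=> sZ; have E a b : (fun t => mxsub f g (Z t) a b) = (fun t => Z t (f a) (g b)).
  by apply/funext => t; rewrite mxE.
have sm : smooth_at (fun t => mxsub f g (Z t)) s.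
  apply/(smooth_at_mxP findim_real) => a b; rewrite E.
  by move/(smooth_at_mxP findim_real): sZ; apply.
split=> //; apply/matrixP => a b.
by rewrite (derive_entry _ _ _ sm) E mxE (derive_entry _ _ _ sZ).
Qed.

(* The equation [v'' = - v S] is solved as the first order system
   [(v, v')' = (v, v') B] for row vectors of twice the length. *)
Lemma jacobi_fundamental (S : R -> 'M[R]_n) (I : interval R) : 0 \in I ->
  (forall s, s \in I -> smooth_at S s) ->
  exists A A1 : R -> 'M[R]_n, [/\ A 0 = 0, A1 0 = 1%:M,
   forall s, s \in I -> [/\ smooth_at A s, smooth_at A1 s,
     \forall t \near s, 'D_1 A t = A1 t &
     \forall t \near s, 'D_1 A1 t = - (A t *m S t)] &
   forall v : R -> 'rV[R]_n, v 0 = 0 ->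
     (forall s, s \in I -> smooth_at v s /\ 'D_1 (fun t => 'D_1 v t) s = - (v s *m S s)) ->
     forall s, s \in I -> v s = 'D_1 v 0 *m A s /\ 'D_1 v s = 'D_1 v 0 *m A1 s].
Proof.
move=> I0 sS.
pose B t : 'M[R]_(n + n) := block_mx 0 (- S t) 1%:M 0.
have sB s : s \in I -> smooth_at B s.
  move=> sI; apply: smooth_at_block; [exact: smooth_at_cst| |exact: smooth_at_cst|exact: smooth_at_cst].
  by apply: smooth_atN; exact: sS.
have [Z [Z0 ZP]] := linear_ode_interval I0 sB.
(* As [Z 0] is the identity, its lower blocks are 0 and 1: the lower rows of [Z] are the solutions
   that vanish at 0 and have the unit vectors as derivatives there. *)
exists (fun t => dlsubmx (Z t)), (fun t => drsubmx (Z t)).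
have subE (X : 'M[R]_(n + n)) : (dlsubmx X = mxsub (@rshift n n) (@lshift n n) X)
    * (drsubmx X = mxsub (@rshift n n) (@rshift n n) X).
  by split; apply/matrixP => a b; rewrite !mxE.
split.
- by rewrite Z0 (@scalar_mx_block _ n n 1) block_mxKdl.
- by rewrite Z0 (@scalar_mx_block _ n n 1) block_mxKdr.
- move=> s sI; have [sZ dZ uZ] := ZP s sI.
  have E1 : (fun t => dlsubmx (Z t)) = (fun t => mxsub (@rshift n n) (@lshift n n) (Z t)).
    by apply/funext => t; rewrite subE.
  have E2 : (fun t => drsubmx (Z t)) = (fun t => mxsub (@rshift n n) (@rshift n n) (Z t)).
    by apply/funext => t; rewrite subE.
  have ZB t : Z t *m B t = block_mx (ursubmx (Z t)) (- (ulsubmx (Z t) *m S t))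
                                    (drsubmx (Z t)) (- (dlsubmx (Z t) *m S t)).
    rewrite -{1}[Z t]submxK /B mulmx_block !mulmx0 !mulmx1 !add0r !addr0.
    by rewrite !mulmxN.
  split.
  + by rewrite E1; exact: (smooth_at_mxsub _ _ sZ).1.
  + by rewrite E2; exact: (smooth_at_mxsub _ _ sZ).1.
  + apply: filterS2 (smooth_at_near sZ) dZ => t st dt.
    by rewrite E1 (smooth_at_mxsub _ _ st).2 dt -(subE _).1 ZB block_mxKdl.
  + apply: filterS2 (smooth_at_near sZ) dZ => t st dt.
    by rewrite E2 (smooth_at_mxsub _ _ st).2 dt -(subE _).2 ZB block_mxKdr.
move=> v v0 vP s sI.
pose z t := row_mx (v t) ('D_1 v t).
have dz u : u \in I -> smooth_at z u /\ 'D_1 z u = z u *m B u.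
  move=> uI; have [sv dv] := vP u uI.
  have sv' : smooth_at (fun t => 'D_1 v t) u by exact: smooth_at_derive.
  have entl b : (fun t => z t 0 (lshift n b)) = (fun t => v t 0 b).
    by apply/funext => t; rewrite /z row_mxEl.
  have entr b : (fun t => z t 0 (rshift n b)) = (fun t => 'D_1 v t 0 b).
    by apply/funext => t; rewrite /z row_mxEr.
  have sz : smooth_at z u.
    apply/(smooth_at_mxP findim_real) => a b; rewrite [a]ord1.
    case: (split_ordP b) => k ->.
      by rewrite entl; move/(smooth_at_mxP findim_real): sv; apply.
    by rewrite entr; move/(smooth_at_mxP findim_real): sv'; apply.
  split=> //.
  have zB : z u *m B u = row_mx ('D_1 v u) (- (v u *m S u)).
    by rewrite /z /B mul_row_block !mulmx0 mulmx1 add0r addr0 mulmxN.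
  rewrite zB; apply/rowP => b; rewrite (derive_entry _ _ _ sz).
  case: (split_ordP b) => k ->.
    by rewrite entl row_mxEl -(derive_entry _ _ _ sv).
  by rewrite entr row_mxEr -dv -(derive_entry _ _ _ sv').
have zZ u : u \in I -> is_derive u (1 : R) (fun t => z t *m invmx (Z t)) 0.
  move=> uI; have [su du] := dz u uI; have [sZ /nbhs_singleton dZ uZ] := ZP u uI.
  have si := smooth_at_invmx findim_real uZ sZ.
  have E : 'D_1 (fun t => z t *m invmx (Z t)) u = 0.
    rewrite (derive_mulmx findim_real (1 : R) su si) (derive_invmx findim_real (1 : R) uZ sZ) dZ du.
    by rewrite (mulKmx uZ) mulmxN mulmxA addNr.
  have := smooth_at_is_derive (1 : R) (smooth_at_mulmx findim_real su si).
  by rewrite E.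
have cz : z s *m invmx (Z s) = z 0.
  have -> : z 0 = z 0 *m invmx (Z 0) by rewrite Z0 invmx1 mulmx1.
  have [s0|/ltW s0] := leP 0 s.
    apply/esym; apply: (derive0_constant (C := fun t => z t *m invmx (Z t)) s0) => u us; apply: zZ.
    exact: (interval_is_interval I0 sI).
  apply: (derive0_constant (C := fun t => z t *m invmx (Z t)) s0) => u us; apply: zZ.
  exact: (interval_is_interval sI I0).
have [_ _ uZ] := ZP s sI.
have : z s = row_mx ('D_1 v 0 *m dlsubmx (Z s)) ('D_1 v 0 *m drsubmx (Z s)).
  rewrite -(mulmxKV uZ (z s)) cz -{1}[Z s]submxK /z v0 mul_row_block.
  by rewrite !mul0mx !add0r.
by move=> /eq_row_mx[].
Qed.

End second_order_ode.

Section form_calculus.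
Context {R : realType} {n : nat}.
Implicit Types (G : 'M[R]_n) (u v : R -> 'rV[R]_n).

Lemma posdef_ge0 G (x : 'rV[R]_n) : posdef G -> 0 <= mxform G x x.
Proof.
move=> [_ pos]; have [->|/pos/ltW//] := eqVneq x 0.
by rewrite mxform0l.
Qed.

Lemma cauchy_schwarz G (x y : 'rV[R]_n) : posdef G ->
  mxform G x y ^+ 2 <= mxform G x x * mxform G y y.
Proof.
move=> pG; have [sym pos] := pG.
have [->|y0] := eqVneq y 0; first by rewrite !mxform0r expr0n mulr0.
have c0 := pos _ y0; set a := mxform G x x; set b := mxform G x y; set c := mxform G y y in c0 *.
have : 0 <= mxform G (c *: x + - (b *: y)) (c *: x + - (b *: y)) by exact: posdef_ge0.
rewrite !mxformDl !mxformDr !mxformNl !mxformNr !mxformZl !mxformZr (sym y x) -/a -/b -/c.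
have -> : c * (c * a) + - (c * (b * b)) + (- (b * (c * b)) + - - (b * (b * c)))
    = c * (a * c - b ^+ 2) by ring.
by rewrite pmulr_rge0// subr_ge0.
Qed.

Lemma smooth_at_form G u v s : smooth_at u s -> smooth_at v s ->
  smooth_at (fun t => mxform G (u t) (v t)) s /\
  'D_1 (fun t => mxform G (u t) (v t)) s =
  mxform G ('D_1 u s) (v s) + mxform G (u s) ('D_1 v s).
Proof.
move=> su sv.
have sG := smooth_at_cst G s.
have su' := smooth_at_mulmx findim_real su sG.
have sv' := smooth_at_trmx findim_real sv.
have sm := smooth_at_mulmx findim_real su' sv'.
split; first by move/(smooth_at_mxP findim_real): sm; apply.
have E := derive_entry (1 : R) 0 0 sm.
apply: (etrans (esym E)).
rewrite (derive_mulmx findim_real _ su' sv') (derive_mulmx findim_real _ su sG).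
rewrite (derive_trmx findim_real _ sv) derive_cst mulmx0 add0r mxE addrC.
by [].
Qed.

Lemma cvg_mxform {S : Type} (F : set_system S) {FF : Filter F} G (u v : S -> 'rV[R]_n) a b :
  u x @[x --> F] --> a -> v x @[x --> F] --> b ->
  mxform G (u x) (v x) @[x --> F] --> mxform G a b.
Proof.
move=> ua vb.
have E (x y : 'rV[R]_n) : mxform G x y = \sum_k (\sum_l x 0 l * G l k) * y 0 k.
  by rewrite /mxform mxE; apply: eq_bigr => k _; rewrite !mxE.
under eq_cvg do rewrite E.
rewrite E; apply: cvg_big => [|k _]; first exact: add_continuous.
apply: cvgM; last exact: (cvg_comp _ _ vb (@coord_continuous _ _ _ 0 k b)).
apply: cvg_big => [|l _]; first exact: add_continuous.
apply: cvgM; last exact: cvg_cst.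
exact: (cvg_comp _ _ ua (@coord_continuous _ _ _ 0 l a)).
Qed.

End form_calculus.

(** * Riccati comparison of a Jacobi field with a parallel field *)

Section index_comparison.
Context {R : realType} {m n : nat}.
Variables (GM : 'M[R]_m) (GN : 'M[R]_n) (pM : posdef GM) (pN : posdef GN).
Variables (SM : R -> 'M[R]_m) (SN : R -> 'M[R]_n) (b : R).
Variables (j : R -> 'rV[R]_m) (A A1 : R -> 'M[R]_n) (w : 'rV[R]_n).
Hypothesis b0 : 0 < b.
Hypothesis sj : forall s, 0 <= s <= b ->
  smooth_at j s /\ 'D_1 (fun t => 'D_1 j t) s = - (j s *m SM s).
Hypothesis j0 : j 0 = 0.
Hypothesis sA : forall s, 0 <= s <= b -> [/\ smooth_at A s, smooth_at A1 s,
  'D_1 A s = A1 s & 'D_1 A1 s = - (A s *m SN s)].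
Hypotheses (A0 : A 0 = 0) (A10 : A1 0 = 1%:M).
Hypothesis uA : forall s, 0 < s <= b -> A s \in unitmx.
Hypothesis symS : forall s, 0 <= s <= b -> SN s *m GN = GN *m (SN s)^T.
Hypothesis w0 : w != 0.
(** The inequality between the sectional curvatures of [j s] and [w], cross-multiplied so that it
    remains meaningful where [j] vanishes. *)
Hypothesis curv : forall s, 0 < s <= b ->
  mxform GM (j s *m SM s) (j s) * mxform GN w w <=
  mxform GN (w *m SN s) w * mxform GM (j s) (j s).

Let in_cc s : 0 < s <= b -> 0 <= s <= b.
Proof. by move=> /andP[/ltW-> ->]. Qed.

(** The difference of the two sides is the Wronskian matrix of the solutions. Its derivative is 0
    because [SN] is self-adjoint, and it vanishes at 0 together with [A]. *)
Let wronskian s : 0 <= s <= b -> A1 s *m GN *m (A s)^T = A s *m GN *m (A1 s)^T.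
Proof.
move=> /andP[s0 sb]; apply/eqP; rewrite -subr_eq0; apply/eqP.
pose W t := A1 t *m GN *m (A t)^T - A t *m GN *m (A1 t)^T.
have -> : A1 s *m GN *m (A s)^T - A s *m GN *m (A1 s)^T = W 0.
  rewrite -[LHS]/(W s); apply/esym; apply: (derive0_constant s0) => u /andP[u0 us].
  have ub : 0 <= u <= b by rewrite u0 (le_trans us).
  have [sAu sA1u dA dA1] := sA ub.
  have sG := smooth_at_cst GN u.
  have s1 := smooth_at_mulmx findim_real sA1u sG.
  have s2 := smooth_at_mulmx findim_real sAu sG.
  have s3 := smooth_at_trmx findim_real sAu.
  have s4 := smooth_at_trmx findim_real sA1u.
  have s5 := smooth_at_mulmx findim_real s1 s3.
  have s6 := smooth_at_mulmx findim_real s2 s4.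
  have h := smooth_at_is_derive (1 : R) (smooth_atB s5 s6).
  suff E : 'D_1 W u = 0 by rewrite -E.
  have [_ E] := is_deriveB (smooth_at_is_derive (1 : R) s5) (smooth_at_is_derive (1 : R) s6).
  apply: (etrans E).
  rewrite (derive_mulmx findim_real _ s1 s3) (derive_mulmx findim_real _ s2 s4).
  rewrite (derive_mulmx findim_real _ sA1u sG) (derive_mulmx findim_real _ sAu sG).
  rewrite (derive_trmx findim_real _ sAu) (derive_trmx findim_real _ sA1u).
  rewrite !derive_cst !mulmx0 !add0r dA dA1.
  rewrite linearN/= trmx_mul !mulNmx mulmxN -[A u *m SN u *m GN]mulmxA (symS ub) !mulmxA.
  by rewrite opprD opprK addrA subrK subrr.
by rewrite /W A0 A10 trmx0 mulmx0 !mul0mx subrr.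
Qed.

Let U t := invmx (A t) *m A1 t.

(** Writing [x = x' A] and [y = y' A], which the invertibility of [A] permits, turns the symmetry of
    [U] into the Wronskian identity. *)
Let U_sym s (x y : 'rV[R]_n) : 0 < s <= b -> mxform GN (x *m U s) y = mxform GN x (y *m U s).
Proof.
move=> sb; have uAs := uA sb.
rewrite -{1}[y](mulmxKV uAs) -{2}[x](mulmxKV uAs) /mxform /U.
set x' := x *m invmx _; set y' := y *m invmx _.
rewrite [y *m (_ *m _)]mulmxA -/y' [x *m (_ *m _)]mulmxA -/x' !trmx_mul !mulmxA.
rewrite -[x' *m A1 s *m GN *m _]mulmxA -[x' *m A1 s *m _]mulmxA.
rewrite -[x' *m A s *m GN *m _]mulmxA -[x' *m A s *m _]mulmxA.
have -> : A1 s *m (GN *m (A s)^T) = A s *m (GN *m (A1 s)^T).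
  by rewrite !mulmxA wronskian// in_cc.
by [].
Qed.

Let sU s : 0 < s <= b -> smooth_at U s /\ 'D_1 U s = - (U s *m U s) - SN s.
Proof.
move=> sb; have uAs := uA sb; have [sAs sA1s dA dA1] := sA (in_cc sb).
have sI := smooth_at_invmx findim_real uAs sAs.
split; first exact: smooth_at_mulmx.
rewrite (derive_mulmx findim_real _ sI sA1s) (derive_invmx findim_real _ uAs sAs) dA dA1.
by rewrite mulmxN (mulKmx uAs) mulNmx /U !mulmxA addrC.
Qed.

(* [<w, w> (<j', j> - rho |j|^2)] with [rho = <w U, w> / <w, w>]. *)
Let Phi t := mxform GN w w * mxform GM ('D_1 j t) (j t)
  - mxform GN (w *m U t) w * mxform GM (j t) (j t).

Let dPhi s : 0 < s <= b -> derivable Phi s 1 /\ 0 <= 'D_1 Phi s.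
Proof.
move=> sb; have [sjs ddj] := sj (in_cc sb).
have sj' : smooth_at (fun t => 'D_1 j t) s by exact: smooth_at_derive.
have [sUs dU] := sU sb.
have swU := smooth_at_mulmx findim_real (smooth_at_cst w s) sUs.
have [sa da] := smooth_at_form GN swU (smooth_at_cst w s).
have [sp dp] := smooth_at_form GM sj' sjs.
have [sq dq] := smooth_at_form GM sjs sjs.
have N0 : 0 < mxform GN w w by have [_ pos] := pN; exact: pos.
have d1 := is_derive_scale (smooth_at_is_derive (1 : R) (smooth_at_cst (mxform GN w w) s))
  (smooth_at_is_derive (1 : R) sp).
have d2 := is_derive_scale (smooth_at_is_derive (1 : R) sa) (smooth_at_is_derive (1 : R) sq).
have [dPhi PhiE] := is_deriveB d1 d2.
split; first exact: dPhi.
have h X : 'D_1 Phi s = X -> 0 <= X -> 0 <= 'D_1 Phi s by move=> ->.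
apply: (h _ PhiE) => {h}.
rewrite derive_cst da dp dq ddj (derive_mulmx findim_real _ (smooth_at_cst w s) sUs).
rewrite !derive_cst mul0mx addr0 dU mxform0r addr0.
rewrite mulmxBr mulmxN [w *m (U s *m U s)]mulmxA mxformDl !mxformNl (U_sym (w *m U s) w sb).
have [symM _] := pM; rewrite (symM (j s) ('D_1 j s)).
have CS := cauchy_schwarz (w *m U s) w pN.
have K := curv sb.
have q0 : 0 <= mxform GM (j s) (j s) by exact: posdef_ge0.
have sq0 : 0 <= mxform GM (mxform GN w w *: 'D_1 j s + - (mxform GN (w *m U s) w *: j s))
                 (mxform GN w w *: 'D_1 j s + - (mxform GN (w *m U s) w *: j s)).
  exact: posdef_ge0.
rewrite !mxformDl !mxformDr !mxformNl !mxformNr !mxformZl !mxformZr (symM (j s) ('D_1 j s)) in sq0.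
move: N0 CS K q0 sq0.
move: (mxform GN w w) (mxform GN (w *m U s) (w *m U s)) (mxform GN (w *m U s) w)
  (mxform GM (j s) (j s)) (mxform GM (j s *m SM s) (j s)) (mxform GN (w *m SN s) w)
  (mxform GM ('D_1 j s) ('D_1 j s)) (mxform GM ('D_1 j s) (j s)).
move=> N u2 a q k kw d p N0 CS K q0 sq0.
rewrite -[N *: _]/(N * (- k + d)) -[0 *: _]/(0 * p) -[a *: _]/(a * (p + p)).
rewrite -[_ *: q]/((- u2 - kw) * q).
(* [N (N d - 2 a p + u2 q)] is the square of [N j' - a j] plus [(u2 N - a^2) q], the Cauchy-Schwarz
   defect of [w U] and [w] times [q]. What remains of the derivative of [Phi] is the curvature term
   [kw q - N k]. *)
have h : 0 <= N * (N * d - a * p *+ 2 + u2 * q).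
  have h1 : 0 <= (u2 * N - a ^+ 2) * q by rewrite mulr_ge0// subr_ge0.
  rewrite (_ : N * _ = (N * (N * d) + - (N * (a * p)) + (- (a * (N * p)) + - - (a * (a * q))))
     + (u2 * N - a ^+ 2) * q); last by rewrite -mulr_natr; ring.
  exact: addr_ge0 sq0 h1.
rewrite pmulr_rge0// in h.
apply: (le_trans h); rewrite -subr_ge0 in K; rewrite -subr_ge0.
apply: (le_trans K); rewrite le_eqVlt; apply/orP; left; apply/eqP.
by rewrite -mulr_natr; ring.
Qed.

Let Phi_mono s : 0 < s <= b -> Phi s <= Phi b.
Proof.
move=> /andP[s0 sb].
have inb x : x \in `[s, b] -> 0 < x <= b.
  by rewrite in_itv/= => /andP[sx ->]; rewrite (lt_le_trans s0).
have h1 x : x \in `]s, b[ -> is_derive x 1 Phi ('D_1 Phi x).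
  by move=> xI; apply/derivableP; apply: (dPhi _).1; apply/inb/subset_itv_oo_cc.
have h2 : {within `[s, b], continuous Phi}.
  apply: derivable_within_continuous => x /inb xb; exact: (dPhi xb).1.
have [c /inb cI E] := MVT_segment sb h1 h2.
by rewrite -subr_ge0 E mulr_ge0 ?subr_ge0// (dPhi cI).2.
Qed.

Let Phi_cvg : Phi s @[s --> 0^'+] --> (0 : R).
Proof.
have zb : 0 <= (0 : R) <= b by rewrite lexx ltW.
have [sj0 _] := sj zb; have [sA0 sA10 dA0 _] := sA zb.
have sj' : smooth_at (fun t => 'D_1 j t) 0 by exact: smooth_at_derive.
have jc : j s @[s --> 0^'+] --> (0 : 'rV[R]_m).
  rewrite -j0; apply: cvg_at_right_filter; exact: smooth_at_continuous.
have j'c : 'D_1 j s @[s --> 0^'+] --> 'D_1 j 0.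
  by apply: cvg_at_right_filter; exact: (smooth_at_continuous sj').
have pc : mxform GM ('D_1 j s) (j s) @[s --> 0^'+] --> mxform GM ('D_1 j 0) 0.
  exact: (cvg_mxform (G := GM) j'c jc).
rewrite mxform0r in pc.
have jq := quotient_cvg sj0 j0.
have qc : mxform GM (s^-1 *: j s) (j s) @[s --> 0^'+] --> mxform GM ('D_1 j 0) 0.
  exact: (cvg_mxform (G := GM) jq jc).
rewrite mxform0r in qc.
have Xc := quotient_cvg sA0 A0; rewrite dA0 A10 in Xc.
have invc : {for 1%:M, continuous (fun X : 'M[R]_n => w *m invmx X)}.
  apply: smooth_at_continuous; apply: smooth_at_mulmx => //; first exact: smooth_at_cst.
  by apply: smooth_at_invmx => //; [exact: unitmx1|exact: smooth_at_id].
have wXc : w *m invmx (s^-1 *: A s) @[s --> 0^'+] --> w *m invmx 1%:M.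
  exact: (cvg_comp _ _ Xc invc).
have yc : (A1 s *m GN *m w^T)^T @[s --> 0^'+] --> (A1 0 *m GN *m w^T)^T.
  apply: cvg_at_right_filter.
  have s1 := smooth_at_mulmx findim_real sA10 (smooth_at_cst GN (0 : R)).
  have s2 := smooth_at_mulmx findim_real s1 (smooth_at_cst w^T (0 : R)).
  exact: (smooth_at_continuous (smooth_at_trmx findim_real s2)).
have kc : mxform 1%:M (w *m invmx (s^-1 *: A s)) ((A1 s *m GN *m w^T)^T) @[s --> 0^'+] -->
    mxform 1%:M (w *m invmx 1%:M) ((A1 0 *m GN *m w^T)^T) by exact: (cvg_mxform (G := 1%:M) wXc yc).
(* [Psi] is [Phi] with a factor 1/s moved: <w U, w> |j|^2 = <w (A/s)^-1 A1, w> <j/s, j>. The first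
   factor on the right has a finite limit and the second tends to 0. *)
pose Psi s := mxform GN w w * mxform GM ('D_1 j s) (j s) -
  mxform 1%:M (w *m invmx (s^-1 *: A s)) ((A1 s *m GN *m w^T)^T) *
  mxform GM (s^-1 *: j s) (j s).
have Pc : Psi s @[s --> 0^'+] --> mxform GN w w * 0 -
    mxform 1%:M (w *m invmx 1%:M) ((A1 0 *m GN *m w^T)^T) * 0.
  exact: (cvgB (cvgM (cvg_cst _) pc) (cvgM kc qc)).
rewrite !mulr0 subrr in Pc.
apply: (cvg_trans _ Pc); apply: near_eq_cvg; near=> s.
have s0 : 0 < s by near: s; exact: nbhs_right_gt.
have sb : s <= b by near: s; exact: nbhs_right_le.
have uX : s^-1 *: A s \in unitmx.
  by rewrite unitmxZ ?uA ?s0// unitfE invr_eq0 gt_eqF.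
rewrite /Phi /Psi; congr (_ - _).
rewrite (invmxZ uX) invrK -scalemxAr mxformZl mxformZl mulrACA mulfV ?gt_eqF// mul1r.
by congr (_ * _); rewrite /mxform /U trmxK mulmx1 !mulmxA.
Unshelve. all: by end_near. Qed.

Lemma index_comparison :
  mxform GN (w *m (invmx (A b) *m A1 b)) w * mxform GM (j b) (j b) <=
  mxform GN w w * mxform GM ('D_1 j b) (j b).
Proof.
rewrite -subr_ge0 -[_ - _]/(Phi b).
apply: (cvgr_to_le Phi_cvg); near=> s; apply: Phi_mono.
have s0 : 0 < s by near: s; exact: nbhs_right_gt.
have sb : s <= b by near: s; exact: nbhs_right_le.
by rewrite s0.
Unshelve. all: by end_near. Qed.

End index_comparison.

(** * Jacobi fields, orthogonality and conjugate points in frame coordinates *)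

Section jacobi_coordinates.
Context {R : realType} (M : riemannian R).
Local Notation T := 'rV[R]_(mf_dim M).
Local Notation MX := 'M[R]_(mf_dim M).
Variable c : R -> M.
Implicit Types (V W J : R -> T) (s t : R) (Y : R -> MX).

Lemma covD_germ V W s : (\forall t \near s, V t = W t) -> covD c V s = covD c W s.
Proof.
move=> VW; rewrite !covD_at; apply: cov_eq; apply: filterS VW => t Et.
by rewrite /loc Et.
Qed.

Lemma pframe_field2 Y s (v : R -> T) : pframe c Y s -> smooth_at v s ->
  covD c (covD c (fun t => v t *m Y t)) s = 'D_1 (fun t => 'D_1 v t) s *m Y s.
Proof.
move=> PY sv.
have E : \forall t \near s, covD c (fun t => v t *m Y t) t = 'D_1 v t *m Y t.
  apply: filterS2 (pframe_near PY) (smooth_at_near sv) => t PYt svt.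
  exact: (pframe_field PYt svt).2.
rewrite (covD_germ E); apply: (pframe_field PY _).2.
exact: smooth_at_derive.
Qed.

Lemma jacobi_coord Y J s : pframe c Y s -> sfield c J s ->
  covD c (covD c J) s + curvature (c s) (velocity c s) (J s) (velocity c s) = 0 ->
  let j := fun t => J t *m invmx (Y t) in
  [/\ smooth_at j s, J s = j s *m Y s, covD c J s = 'D_1 j s *m Y s &
      'D_1 (fun t => 'D_1 j t) s = - (j s *m curvmx c Y s)].
Proof.
move=> PY sJ eqJ j; have [cs _ _ uY] := PY.
have sj : smooth_at j s := pframe_coord PY sJ.
have Jj : \forall t \near s, J t = j t *m Y t.
  by apply: filterS (pframe_near PY) => t [_ _ _ ut]; rewrite /j mulmxKV.
have Jjs := nbhs_singleton Jj.
have E1 : covD c J s = 'D_1 j s *m Y s.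
  apply: (etrans (covD_germ Jj)); exact: (pframe_field PY sj).2.
have E2 : covD c (covD c J) s = 'D_1 (fun t => 'D_1 j t) s *m Y s.
  rewrite -(pframe_field2 PY sj); apply: covD_germ.
  by apply: filterS (near_join Jj) => t h; exact: (covD_germ h).
split; [exact: sj|exact: Jjs|exact: E1|].
move: eqJ; rewrite E2 Jjs (curvature_frame c _ uY) -mulmxDl.
move=> /(congr1 (mulmx^~ (invmx (Y s)))) /=; rewrite mul0mx (mulmxK uY) => /eqP.
by rewrite addr_eq0 => /eqP.
Qed.

(** The velocity of a geodesic is parallel, so its inner product with a parallel field is constant.
    This admits the comparison field to the curvature hypothesis. *)
Lemma parallel_orthogonal Y (I : interval R) (w : T) t0 : geodesic [set` I] c ->
  (forall s, s \in I -> pframe c Y s) -> t0 \in I ->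
  metric (c t0) (w *m Y t0) (velocity c t0) = 0 ->
  forall s, s \in I -> metric (c s) (w *m Y s) (velocity c s) = 0.
Proof.
move=> gc PY t0I t00 s sI.
pose f t := metric (c t) (w *m Y t) (velocity c t).
(* The function is wrapped into a 1 x 1 matrix because [derive0_constant] is stated for matrices. *)
have df u : u \in I -> is_derive u (1 : R) (fun t => (f t)%:M : 'M[R]_1) 0.
  move=> uI; have [cu /nbhs_singleton gu] := gc u uI.
  have [sV dV] := pframe_field (PY u uI) (smooth_at_cst w u).
  have sv := sfield_velocity cu.
  have sf : smooth_at f u := smooth_at_metric sV sv.
  have df0 : 'D_1 f u = 0.
    rewrite (derive_metric sV sv) dV gu derive_cst mul0mx.
    by rewrite /metric mxform0l mxform0r addr0.
  rewrite (_ : (fun t => _) = fun t => f t *: (1%:M : 'M[R]_1)); last first.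
    by apply/funext => t; exact: esym (scalemx1 _ (f t)).
  have := is_derive_scale (smooth_at_is_derive (1 : R) sf)
    (is_derive_cst (1%:M : 'M[R]_1) u (1 : R)).
  have E (a d : R) : d = 0 -> a *: (0 : 'M[R]_1) + d *: 1%:M = 0.
    by move=> ->; rewrite scale0r scaler0 addr0.
  by rewrite (E _ _ df0).
suff : (f s)%:M = (f t0)%:M :> 'M[R]_1.
  have key (a b : R) : a%:M = b%:M :> 'M[R]_1 -> a = b.
    by move=> /matrixP/(_ 0 0); rewrite !mxE !mulr1n.
  by move=> /key E; exact: etrans E t00.
have [ts|/ltW ts] := leP s t0.
  apply: (derive0_constant (C := fun t => (f t)%:M) ts) => u us.
  by apply: df; exact: (interval_is_interval sI t0I).
apply/esym; apply: (derive0_constant (C := fun t => (f t)%:M) ts) => u us.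
by apply: df; exact: (interval_is_interval t0I sI).
Qed.

Lemma tlength_sqr p (v : T) : tlength p v ^+ 2 = metric p v v.
Proof. by rewrite /tlength sqr_sqrtr//; apply: posdef_ge0; exact: metric_posdef. Qed.

(** The velocity is a unit vector orthogonal to [v *m Y s], so the area term in the denominator is
    just the squared length of that vector. *)
Lemma sectional_frame Y s (v : T) : pframe c Y s ->
  tlength (c s) (velocity c s) = 1 ->
  metric (c s) (v *m Y s) (velocity c s) = 0 ->
  sectional (c s) (velocity c s) (v *m Y s) =
  mxform (gram c Y s) (v *m curvmx c Y s) v / mxform (gram c Y s) v v.
Proof.
move=> [_ _ _ uY] u1 vX; rewrite /sectional (curvature_frame c _ uY) !metric_frame.
have [sym _] := metric_posdef (c s).
rewrite [metric _ _ (v *m Y s)]sym [mxform _ (v *m Y s) _]vX.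
by rewrite -tlength_sqr u1 expr1n mul1r expr0n subr0.
Qed.

(** A nonzero row [v] killed by [A r] gives the Jacobi field with coordinates [v A]. It vanishes at
    0 and at [r] but has derivative [v] at 0, so [r] would be conjugate. *)
Lemma nonconjugate_unitmx Y (I : interval R) (A A1 : R -> MX) (r : R) :
  0 \in I -> r \in I -> 0 < r -> (forall s, s \in I -> pframe c Y s) ->
  A 0 = 0 -> A1 0 = 1%:M ->
  (forall s, s \in I -> [/\ smooth_at A s, smooth_at A1 s,
     \forall t \near s, 'D_1 A t = A1 t &
     \forall t \near s, 'D_1 A1 t = - (A t *m curvmx c Y t)]) ->
  ~ conjugate c r -> A r \in unitmx.
Proof.
move=> I0 rI r0 PY A0 A10 AP ncj; apply/negPn/negP => nu; apply: ncj.
have : kermx (A r) != 0 by rewrite kermx_eq0 row_free_unit.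
move=> /rowV0Pn[v /sub_kermxP vA v0].
have inI s : s \in `[0, r] -> s \in I.
  by rewrite in_itv => sr; exact: (interval_is_interval I0 rI).
have svA s : s \in I -> smooth_at (fun t => v *m A t) s /\
    \forall t \near s, 'D_1 (fun t => v *m A t) t = v *m A1 t.
  move=> sI; have [sA _ dA _] := AP s sI.
  split; first exact: (smooth_at_mulmx findim_real (smooth_at_cst v s) sA).
  apply: filterS2 (smooth_at_near sA) dA => t st dt.
  rewrite (derive_mulmx findim_real (1 : R) (smooth_at_cst v t) st) dt.
  by rewrite derive_cst mul0mx addr0.
have zero_r : 0 \in `[0, r] by rewrite in_itv/= lexx ltW.
exists (fun t => v *m A t *m Y t); split.
- by move=> s /inI sI; have [sv _] := svA s sI; exact: (pframe_field (PY s sI) sv).1.2.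
- move=> s /inI sI; have [sv dv] := svA s sI; have [_ sA1 _ dA1] := AP s sI.
  have [_ _ _ uY] := PY s sI.
  rewrite (pframe_field2 (PY s sI) sv) (curvature_frame c _ uY) (near_eq_derive (1 : R) dv).
  rewrite (derive_mulmx findim_real (1 : R) (smooth_at_cst v s) sA1) (nbhs_singleton dA1).
  by rewrite derive_cst mul0mx addr0 mulmxN mulmxA mulNmx addNr.
- by rewrite A0 mulmx0 mul0mx.
- by rewrite vA mul0mx.
(* If the field vanished on all of [0, r], then [s^-1 *: (v *m A s)] would tend to 0, whereas it
   tends to [v]. *)
apply: contrapT => nz; move/eqP: v0; apply.
have [sv dv] := svA 0 I0.
have vA0 : v *m A 0 = 0 by rewrite A0 mulmx0.
have h := quotient_cvg sv vA0.
rewrite (nbhs_singleton dv) A10 mulmx1 in h.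
have E0 : \forall s \near 0^'+, (cst 0 : R -> T) s = s^-1 *: (v *m A s); last first.
  exact: (cvg_unique (@norm_hausdorff _ _) h (cvg_trans (near_eq_cvg E0) (cvg_cst _))).
near=> s.
have s0 : 0 <= s by apply/ltW; near: s; exact: nbhs_right_gt.
have sr : s <= r by near: s; exact: nbhs_right_le.
have sI : s \in I by apply: inI; rewrite in_itv/= s0.
have [_ _ _ uY] := PY s sI.
rewrite /cst; apply/esym; have [E|/eqP E] := eqVneq (v *m A s *m Y s) 0.
  by rewrite -[v *m A s](mulmxK uY) E mul0mx scaler0.
by case: nz; exists s; [rewrite s0|apply/eqP].
Unshelve. all: by end_near. Qed.

End jacobi_coordinates.

(** * Monotonicity of the quotient of squared lengths and its behaviour at 0 *)

Section ratio.
Context {R : realType}.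

Lemma ratio_nondecreasing (p q : R -> R) (b s t : R) :
  (forall u, 0 < u <= b -> [/\ smooth_at p u, smooth_at q u, 0 < q u &
     'D_1 q u * p u <= q u * 'D_1 p u]) ->
  0 < s -> s <= t -> t <= b -> p s / q s <= p t / q t.
Proof.
move=> H s0 st tb.
have inb x : x \in `[s, t] -> 0 < x <= b.
  rewrite in_itv/= => /andP[sx xt]; rewrite (lt_le_trans s0)//.
  exact: le_trans tb.
pose h u := (q u)^-1 *: p u.
have dh x : x \in `[s, t] -> derivable h x 1 /\ 0 <= 'D_1 h x.
  move=> /inb/H[sp sq q0 ineq].
  have qn0 : q x != 0 by rewrite gt_eqF.
  have sv : smooth_at (fun u => (q u)^-1) x by apply: smooth_atV.
  have d := is_derive_scale (smooth_at_is_derive (1 : R) sv) (smooth_at_is_derive (1 : R) sp).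
  have [dh hE] := d; split; first exact: dh.
  have dq : 'D_1 (fun u => (q u)^-1) x = - (q x)^-2 *: 'D_1 q x.
    by have [dq _] := smooth_at_is_derive (1 : R) sq; exact: deriveV.
  rewrite dq in hE.
  have key X : 'D_1 h x = X -> 0 <= X -> 0 <= 'D_1 h x by move=> ->.
  apply: (key _ hE).
  rewrite -[(q x)^-1 *: _]/((q x)^-1 * 'D_1 p x) -[_ *: p x]/(- (q x)^-2 * 'D_1 q x * p x).
  have -> : (q x)^-1 * 'D_1 p x + - (q x)^-2 * 'D_1 q x * p x =
      (q x) ^-2 * (q x * 'D_1 p x - 'D_1 q x * p x).
    by move: ('D_1 p x) ('D_1 q x) (p x) (q x) qn0 => a d' p0 q1 qn1; field.
  by rewrite mulr_ge0 ?subr_ge0// invr_ge0 exprn_ge0// ltW.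
have h1 x : x \in `]s, t[ -> is_derive x 1 h ('D_1 h x).
  by move=> xI; apply/derivableP; apply: (dh _ _).1; exact: subset_itv_oo_cc.
have h2 : {within `[s, t], continuous h}.
  by apply: derivable_within_continuous => x /dh[].
have [c cI E] := MVT_segment st h1 h2.
rewrite mulrC [leRHS]mulrC -subr_ge0 -[_ - _]/(h t - h s) E.
by rewrite mulr_ge0 ?subr_ge0// (dh _ cI).2.
Qed.

(** Dividing the inequality by [s^2] and letting [s] tend to 0 replaces both fields by their
    derivatives at 0, which have the same positive length. In the application [r] is the quotient at
    a later parameter. *)
Lemma ratio_at_zero {m n} (GM : 'M[R]_m) (GN : 'M[R]_n) (j : R -> 'rV[R]_m)
    (l : R -> 'rV[R]_n) (b r : R) :
  0 < b -> smooth_at j 0 -> smooth_at l 0 -> j 0 = 0 -> l 0 = 0 ->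
  mxform GM ('D_1 j 0) ('D_1 j 0) = mxform GN ('D_1 l 0) ('D_1 l 0) ->
  0 < mxform GN ('D_1 l 0) ('D_1 l 0) ->
  (forall s, 0 < s <= b -> mxform GM (j s) (j s) <= r * mxform GN (l s) (l s)) ->
  1 <= r.
Proof.
move=> b0 sj sl j0 l0 jl p0 H.
have jc := quotient_cvg sj j0; have lc := quotient_cvg sl l0.
have jcc : mxform GM (s^-1 *: j s) (s^-1 *: j s) @[s --> 0^'+] -->
    mxform GM ('D_1 j 0) ('D_1 j 0) by exact: (cvg_mxform (G := GM) jc jc).
have lcc : mxform GN (s^-1 *: l s) (s^-1 *: l s) @[s --> 0^'+] -->
    mxform GN ('D_1 l 0) ('D_1 l 0) by exact: (cvg_mxform (G := GN) lc lc).
pose Psi s := r * mxform GN (s^-1 *: l s) (s^-1 *: l s) - mxform GM (s^-1 *: j s) (s^-1 *: j s).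
have Pc : Psi s @[s --> 0^'+] --> r * mxform GN ('D_1 l 0) ('D_1 l 0) -
    mxform GM ('D_1 j 0) ('D_1 j 0).
  exact: (cvgB (cvgM (cvg_cst _) lcc) jcc).
have : 0 <= r * mxform GN ('D_1 l 0) ('D_1 l 0) - mxform GM ('D_1 j 0) ('D_1 j 0).
  apply: (cvgr_to_ge Pc); near=> s.
  have s0 : 0 < s by near: s; exact: nbhs_right_gt.
  have sb : s <= b by near: s; exact: nbhs_right_le.
  rewrite /Psi !mxformZl !mxformZr mulrCA [r * _]mulrCA -!mulrBr.
  by rewrite !mulr_ge0 ?invr_ge0 ?(ltW s0)// subr_ge0 H// s0.
by rewrite jl -{2}[mxform GN _ _]mul1r -mulrBl pmulr_lge0// subr_ge0.
Unshelve. all: by end_near. Qed.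

End ratio.

Theorem theorem9p11 (R : realType) (M N : riemannian R) (I : interval R)
    (gamma : R -> M) (sigma : R -> N)
    (J : R -> 'rV[R]_(mf_dim M)) (L : R -> 'rV[R]_(mf_dim N)) :
  0 \in I ->
  geodesic [set` I] gamma -> unit_speed [set` I] gamma ->
  geodesic [set` I] sigma -> unit_speed [set` I] sigma ->
  (forall (Z : R -> 'rV[R]_(mf_dim M)) (W : R -> 'rV[R]_(mf_dim N)),
     smooth_field [set` I] gamma Z -> orthogonal_field [set` I] gamma Z ->
     smooth_field [set` I] sigma W -> orthogonal_field [set` I] sigma W ->
     forall s, s \in I -> Z s != 0 -> W s != 0 ->
       sectional (gamma s) (velocity gamma s) (Z s) <=
       sectional (sigma s) (velocity sigma s) (W s)) ->
  jacobi_field [set` I] gamma J -> orthogonal_field [set` I] gamma J ->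
  jacobi_field [set` I] sigma L -> orthogonal_field [set` I] sigma L ->
  (exists2 s, s \in I & J s != 0) -> (exists2 s, s \in I & L s != 0) ->
  J 0 = 0 -> L 0 = 0 ->
  tlength (gamma 0) (covD gamma J 0) = tlength (sigma 0) (covD sigma L 0) ->
  (forall s t, s \in I -> t \in I -> 0 < s -> s <= t ->
     (forall r, 0 < r <= t -> ~ conjugate sigma r) ->
     metric (gamma s) (J s) (J s) / metric (sigma s) (L s) (L s) <=
     metric (gamma t) (J t) (J t) / metric (sigma t) (L t) (L t)) /\
  (forall s, s \in I -> 0 < s ->
     (forall r, 0 < r <= s -> ~ conjugate sigma r) ->
     tlength (sigma s) (L s) <= tlength (gamma s) (J s)).
Proof.
move=> I0 gM uM gN uN curv JJ JO LL LO _ [sL sLI Lne] J0 L0 tl.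
have smM s : s \in I -> smooth_map_at gamma s by move=> sI; have [] := gM s sI.
have smN s : s \in I -> smooth_map_at sigma s by move=> sI; have [] := gN s sI.
have [YM [_ PM]] := pframe_interval I0 smM.
have [YN [_ PN]] := pframe_interval I0 smN.
have eqJ := jacobi_field_equation gM JJ; have eqL := jacobi_field_equation gN LL.
pose j t := J t *m invmx (YM t); pose l t := L t *m invmx (YN t).
have cJ s : s \in I -> [/\ smooth_at j s, J s = j s *m YM s,
    covD gamma J s = 'D_1 j s *m YM s &
    'D_1 (fun t => 'D_1 j t) s = - (j s *m curvmx gamma YM s)].
  by move=> sI; have [s1 s2] := eqJ s sI; exact: jacobi_coord (PM s sI) s1 s2.
have cL s : s \in I -> [/\ smooth_at l s, L s = l s *m YN s,
    covD sigma L s = 'D_1 l s *m YN s &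
    'D_1 (fun t => 'D_1 l t) s = - (l s *m curvmx sigma YN s)].
  by move=> sI; have [s1 s2] := eqL s sI; exact: jacobi_coord (PN s sI) s1 s2.
have sSN s : s \in I -> smooth_at (curvmx sigma YN) s by move=> /PN/curvmx_smooth.
have [A [A1 [A0 A10 AP Auniq]]] := jacobi_fundamental I0 sSN.
have j0 : j 0 = 0 by rewrite /j J0 mul0mx.
have l0 : l 0 = 0 by rewrite /l L0 mul0mx.
pose v := 'D_1 l 0.
(* [L] is determined by its derivative at 0: its coordinates are [v A] with a constant row [v]. *)
have lA : forall s, s \in I -> l s = v *m A s /\ 'D_1 l s = v *m A1 s.
  by apply: Auniq l0 _ => u uI; have [s1 _ _ s2] := cL u uI.
have v0 : v != 0.
  apply/eqP => v0; move/eqP: Lne; apply; have [_ -> _ _] := cL sL sLI.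
  by rewrite (lA _ sLI).1 v0 !mul0mx.
(* Gram matrices of parallel frames are constant, so all lengths along the two curves are measured
   by these two fixed forms. *)
set GM := gram gamma YM 0; set GN := gram sigma YN 0.
have gramM s : s \in I -> gram gamma YM s = GM by exact: gram_interval I0 PM.
have gramN s : s \in I -> gram sigma YN s = GN by exact: gram_interval I0 PN.
have pM : posdef GM by apply: gram_posdef; have [] := PM 0 I0.
have pN : posdef GN by apply: gram_posdef; have [] := PN 0 I0.
pose QJ s := mxform GM (j s) (j s); pose QL s := mxform GN (l s) (l s).
have mJ s : s \in I -> metric (gamma s) (J s) (J s) = QJ s.
  by move=> sI; have [_ -> _ _] := cJ s sI; rewrite metric_frame gramM.
have mL s : s \in I -> metric (sigma s) (L s) (L s) = QL s.
  by move=> sI; have [_ -> _ _] := cL s sI; rewrite metric_frame gramN.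
have jl : mxform GM ('D_1 j 0) ('D_1 j 0) = mxform GN v v.
  have [_ _ dJ _] := cJ 0 I0; have [_ _ dL _] := cL 0 I0.
  by have := congr1 (fun x => x ^+ 2) tl; rewrite !tlength_sqr dJ dL !metric_frame.
have p0 : 0 < mxform GN v v by have [_ pos] := pN; exact: pos.
have inI t s : t \in I -> 0 <= s <= t -> s \in I.
  by move=> tI st; exact: (interval_is_interval I0 tI).
have symS s : s \in I -> curvmx sigma YN s *m GN = GN *m (curvmx sigma YN s)^T.
  move=> sI; have [_ _ _ uY] := PN s sI.
  have GT : GN^T = GN.
    by apply/matrixP => a b; rewrite mxE -!mxform_delta; have [sym _] := pN; exact: sym.
  rewrite -{2}GT -trmx_mul; apply/matrixP => a b; rewrite [RHS]mxE.
  have S a' b' : (curvmx sigma YN s *m GN) a' b' =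
      mxform GN (delta_mx 0 a' *m curvmx sigma YN s) (delta_mx 0 b').
    by rewrite -mxform_delta /mxform !mulmxA.
  by rewrite !S -(gramN s sI); exact: curvmx_sym.
(* The comparison is run anew for each [s], on the interval [0, s] and with [w = l s]: these are the
   constant coordinates of the parallel field that agrees with [L] at [s]. *)
have key t : t \in I -> (forall r, 0 < r <= t -> ~ conjugate sigma r) ->
    forall s, 0 < s <= t -> [/\ smooth_at QJ s, smooth_at QL s, 0 < QL s &
      'D_1 QL s * QJ s <= QL s * 'D_1 QJ s].
  move=> tI nc s /andP[s0 st].
  have inI' u : 0 <= u <= s -> u \in I.
    by move=> /andP[u0 us]; apply: (inI t) => //; rewrite u0 (le_trans us).
  have sI : s \in I by apply: inI'; rewrite lexx ltW.
  have uA u : 0 < u <= s -> A u \in unitmx.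
    move=> /andP[u0 us]; apply: (nonconjugate_unitmx I0 _ u0 PN A0 A10 AP).
      by apply: inI'; rewrite us ltW.
    by apply: nc; rewrite u0 (le_trans us).
  have uAs : A s \in unitmx by apply: uA; rewrite s0 lexx.
  have [sj Jj _ _] := cJ s sI; have [sl Ll _ _] := cL s sI.
  have [lAs l'As] := lA s sI.
  have w0 : l s != 0.
    apply: contra v0 => /eqP ls0; rewrite -[v](mulmxK uAs) -lAs ls0.
    by rewrite mul0mx.
  have sA u : 0 <= u <= s -> [/\ smooth_at A u, smooth_at A1 u,
      'D_1 A u = A1 u & 'D_1 A1 u = - (A u *m curvmx sigma YN u)].
    move=> /inI'/AP[s1 s2 /nbhs_singleton s3 /nbhs_singleton s4].
    by split; [exact: s1|exact: s2|exact: s3|exact: s4].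
  have orthW : forall u, u \in I -> metric (sigma u) (l s *m YN u) (velocity sigma u) = 0.
    by apply: (parallel_orthogonal gN PN sI); rewrite -Ll; exact: LO.
  have cv u : 0 < u <= s -> mxform GM (j u *m curvmx gamma YM u) (j u) * mxform GN (l s) (l s) <=
      mxform GN (l s *m curvmx sigma YN u) (l s) * mxform GM (j u) (j u).
    move=> /andP[u0 us]; have uI : u \in I by apply: inI'; rewrite us ltW.
    have [_ Ju _ _] := cJ u uI.
    (* The curvature hypothesis speaks of nonzero vectors only; where [J] vanishes the
       cross-multiplied inequality reads 0 <= 0. *)
    have [ju0|ju0] := eqVneq (j u) 0; first by rewrite ju0 !mxform0r mul0r mulr0.
    have [_ _ _ uYM] := PM u uI; have [_ _ _ uYN] := PN u uI.
    have Jn0 : J u != 0.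
      by apply: contra ju0 => /eqP Ju0; rewrite /j Ju0 mul0mx.
    have Wn0 : l s *m YN u != 0.
      by apply: contra w0 => /eqP W0; rewrite -[l s](mulmxK uYN) W0 mul0mx.
    have sfJ : smooth_field [set` I] gamma J by move=> q /eqJ[[]].
    have sfW : smooth_field [set` I] sigma (fun q => l s *m YN q).
      by move=> q qI; exact: (pframe_field (PN q qI) (smooth_at_cst (l s) q)).1.2.
    have := curv J (fun q => l s *m YN q) sfJ JO sfW orthW u uI Jn0 Wn0.
    have oJ : metric (gamma u) (j u *m YM u) (velocity gamma u) = 0.
      by rewrite -Ju; exact: JO.
    rewrite Ju (sectional_frame (PM u uI) (uM u uI) oJ).
    rewrite (sectional_frame (PN u uI) (uN u uI) (orthW u uI)) gramM// gramN//.
    have qM : 0 < mxform GM (j u) (j u) by have [_ pos] := pM; exact: pos.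
    have qN : 0 < mxform GN (l s) (l s) by have [_ pos] := pN; exact: pos.
    by rewrite ler_pdivrMr// mulrAC ler_pdivlMr.
  have cj u : 0 <= u <= s -> smooth_at j u /\
      'D_1 (fun t => 'D_1 j t) u = - (j u *m curvmx gamma YM u).
    by move=> /inI'/cJ[s1 _ _ s2].
  have symS' u : 0 <= u <= s -> curvmx sigma YN u *m GN = GN *m (curvmx sigma YN u)^T.
    by move=> /inI'/symS.
  have := index_comparison pM pN s0 cj j0 sA A0 A10 uA symS' w0 cv.
  (* As [l s] is [v *m A s], the row [w U] at [s] is [v *m A1 s], the derivative of [l]. So the
     comparison at its end point relates the logarithmic derivatives of the two squared lengths. *)
  rewrite {1}lAs mulmxA (mulmxK uAs) -l'As => ineq.
  have [sQJ dQJ] := smooth_at_form GM sj sj; have [sQL dQL] := smooth_at_form GN sl sl.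
  split; [exact: sQJ|exact: sQL|by have [_ pos] := pN; exact: pos|].
  have [symM _] := pM; have [symN _] := pN.
  rewrite dQJ dQL (symM (j s) ('D_1 j s)) (symN (l s) ('D_1 l s)).
  by rewrite mulrDl mulrDr lerD.
have mono t : t \in I -> (forall r, 0 < r <= t -> ~ conjugate sigma r) ->
    forall s, 0 < s -> s <= t -> QJ s / QL s <= QJ t / QL t.
  by move=> tI nc s s0 st; apply: (ratio_nondecreasing (key t tI nc) s0 st).
split=> [s t sI tI s0 st nc|t tI t0 nc].
  by rewrite !mJ// !mL//; exact: mono.
rewrite /tlength mJ// mL//; apply: ler_wsqrtr.
have [_ _ qt _] : [/\ smooth_at QJ t, smooth_at QL t, 0 < QL t &
      'D_1 QL t * QJ t <= QL t * 'D_1 QJ t] by apply: (key t tI nc); rewrite t0 lexx.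
(* By monotonicity the quotient at [t] bounds all earlier ones, so it can serve as [r] in
   [ratio_at_zero]. *)
have : 1 <= QJ t / QL t.
  have [sj _ _ _] := cJ 0 I0; have [sl _ _ _] := cL 0 I0.
  apply: (ratio_at_zero t0 sj sl j0 l0 jl p0) => s st.
  have [_ _ qs _] := key t tI nc s st; have /andP[s0 st'] := st.
  by rewrite -ler_pdivrMr//; exact: mono.
by rewrite ler_pdivlMr// mul1r.
Qed.
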